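(* Let $T\in(0,\infty)$, $n,d\in\mathbb{N}$, $x_0\in\mathbb{R}^n$, $A^\star\in\mathbb{R}^{n\times n}$, $B^\star\in\mathbb{R}^{n\times d}$, $Q\in\mathbb{R}^{n\times n}$ symmetric positive semidefinite, $R\in\mathbb{R}^{d\times d}$ symmetric positive definite, $\theta^\star=(A^\star,B^\star)^\top$. Let $\Theta\subset\mathbb{R}^{(n+d)\times n}$ be such that there exists $C_1>0$ satisfying $\|(\mathbb{E}[V^{\psi^\theta}])^{-1}\|_2\le C_1$ and $|\theta|\le C_1$ for all $\theta\in\Theta$. Then there exist constants $\bar C_1,\bar C_2\ge0$ and $n_0\in\mathbb{N}$ such that for all $\theta\in\Theta$, $N\in\mathbb{N}\cap[n_0,\infty)$ and $\delta\in(0,1/2)$, if $m\in\mathbb{N}$ satisfies $m\ge\bar C_1(-\ln\delta)$, then with probability at least $1-2\delta$, $$|\hat\theta-\theta^\star|\le\bar C_2\bigg(\sqrt{\frac{-\ln\delta}{m}}+\frac{-\ln\delta}{m}+\frac{(-\ln\delta)^2}{m^2}+\frac1N\bigg),$$ where, with $\tau=T/N$, $t_i=i\tau$, $$\hat\theta=\bigg(\frac1m\sum_{j=1}^m\sum_{i=0}^{N-1}Z^{\psi^{\theta,\tau},j}_{t_i}(Z^{\psi^{\theta,\tau},j}_{t_i})^\top\tau+\frac1mI\bigg)^{-1}\bigg(\frac1m\sum_{j=1}^m\sum_{i=0}^{N-1}Z^{\psi^{\theta,\tau},j}_{t_i}\big(X^{\psi^{\theta,\tau},j}_{t_{i+1}}-X^{\psi^{\theta,\tau},j}_{t_i}\big)^\top\bigg)$$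 and $(X^{\psi^{\theta,\tau},j},Z^{\psi^{\theta,\tau},j})_{j=1}^m$ are independent copies of $(X^{\psi^{\theta,\tau}},Z^{\psi^{\theta,\tau}})$.
   Context: $W$ is an $n$-dimensional standard Brownian motion; $|\cdot|$ is the Euclidean (Frobenius) norm and $\|\cdot\|_2$ the spectral norm; the bound on the inverse includes the assertion that $\mathbb{E}[V^{\psi^\theta}]$ is invertible. Continuous-time gain: for $\theta=(A,B)^\top\in\mathbb{R}^{(n+d)\times n}$ ($A\in\mathbb{R}^{n\times n}$, $B\in\mathbb{R}^{n\times d}$), $\psi^\theta(t,x)=K^\theta_tx$ with $K^\theta_t=-R^{-1}B^\top P^\theta_t$, where $P^\theta$ is the unique solution of $\tfrac{\mathrm{d}}{\mathrm{d}t}P_t+A^\top P_t+P_tA-P_tBR^{-1}B^\top P_t+Q=0$ on $[0,T]$, $P_T=0$. Piecewise constant gain: with $\tau=T/N$, $t_i=i\tau$, set $P^{\theta,\tau}_T=0$ and, for $i=N,N-1,\dots,1$, $$P^{\theta,\tau}_{t_{i-1}}=\tau Q+(I+\tau A)^\top P^{\theta,\tau}_{t_i}(I+\tau A)-(I+\tau A)^\top P^{\theta,\tau}_{t_i}\tau B(R+\tau B^\top P^{\theta,\tau}_{t_i}B)^{-1}B^\top P^{\theta,\tau}_{t_i}(I+\tau A);$$ then $\psi^{\theta,\tau}(t,x)=K^{\theta,\tau}_tx$ with $K^{\theta,\tau}_t=-(R+\tau B^\top P^{\theta,\tau}_{t_{i+1}}B)^{-1}B^\top P^{\theta,\tau}_{t_{i+1}}(I+\tau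 A)$ for $t\in[t_i,t_{i+1})$, $i=0,\dots,N-1$. For a linear feedback $\psi(t,x)=K_tx$, $X^\psi$ is the solution of $\mathrm{d}X_t=(A^\star X_t+B^\star\psi(t,X_t))\,\mathrm{d}t+\mathrm{d}W_t$, $X_0=x_0$, on $[0,T]$ (always driven by the true parameter $\theta^\star$), $Z^\psi_t=\begin{pmatrix}X^\psi_t\\\psi(t,X^\psi_t)\end{pmatrix}$, and $V^\psi=\int_0^TZ^\psi_t(Z^\psi_t)^\top\,\mathrm{d}t$. *)

(* Defs.v *)
From HB Require Import structures.
From mathcomp Require Import all_boot all_order all_algebra.
From mathcomp Require Import all_classical all_reals all_analysis.

Set Implicit Arguments.
Unset Strict Implicit.
Unset Printing Implicit Defensive.

Import Order.TTheory GRing.Theory Num.Theory.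
Import numFieldNormedType.Exports.

Local Open Scope classical_set_scope.
Local Open Scope ring_scope.

Section Matrices.
Context {R : realType}.

(* The library norm on matrices is the max norm, hence these two. *)
Definition frobenius_norm {m n : nat} (M : 'M[R]_(m, n)) : R :=
  Num.sqrt (\sum_i \sum_j M i j ^+ 2).

Definition spectral_norm {m n : nat} (M : 'M[R]_(m, n)) : R :=
  sup [set frobenius_norm (M *m x) | x in
         [set x : 'cV[R]_n | frobenius_norm x <= 1]].

Definition sym_psd {n : nat} (M : 'M[R]_n) : Prop :=
  M^T = M /\ forall v : 'cV[R]_n, 0 <= (v^T *m M *m v) 0 0.

Definition sym_pd {n : nat} (M : 'M[R]_n) : Prop :=
  M^T = M /\ forall v : 'cV[R]_n, v != 0 -> 0 < (v^T *m M *m v) 0 0.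

Definition mx_integral {m n : nat} (D : set R) (F : R -> 'M[R]_(m, n)) :
    'M[R]_(m, n) :=
  \matrix_(i, j) (\int[lebesgue_measure]_(t in D) F t i j)%R.

(* theta = (A, B)^T *)
Definition theta_of {n d : nat} (A : 'M[R]_n) (B : 'M[R]_(n, d)) :
    'M[R]_(n + d, n) := col_mx A^T B^T.
Definition A_of {n d : nat} (theta : 'M[R]_(n + d, n)) : 'M[R]_n :=
  (usubmx theta)^T.
Definition B_of {n d : nat} (theta : 'M[R]_(n + d, n)) : 'M[R]_(n, d) :=
  (dsubmx theta)^T.

End Matrices.

Section Feedback.
Context {R : realType} {n d : nat}.
Variables (T : R) (Q : 'M[R]_n) (Rc : 'M[R]_d) (theta : 'M[R]_(n + d, n)).
Let A := A_of theta.
Let B := B_of theta.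

Definition riccati_solution (P : R -> 'M[R]_n) : Prop :=
  [/\ {within `[0, T], continuous P},
      forall t, 0 < t < T ->
        is_derive t 1 P
          (- (A^T *m P t + P t *m A - P t *m B *m invmx Rc *m B^T *m P t + Q))
    & P T = 0].

Definition gain_ct (P : R -> 'M[R]_n) (t : R) : 'M[R]_(d, n) :=
  - (invmx Rc *m B^T *m P t).

Definition riccati_step (tau : R) (P : 'M[R]_n) : 'M[R]_n :=
  let M := 1%:M + tau *: A in
  tau *: Q + M^T *m P *m M
  - M^T *m P *m (tau *: B) *m invmx (Rc + tau *: (B^T *m P *m B))
    *m B^T *m P *m M.

(* The value at t_i, i <= N, of the backward recursion started from 0 at
   t_N = T with step T / N. *)
Definition riccati_pw (N i : nat) : 'M[R]_n :=
  iter (N - i) (riccati_step (T / N%:R)) 0.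

(* For 0 <= t < T, the index i below is the one with t_i <= t < t_{i+1}; at
   the end point t = T, where the piecewise constant gain is not specified,
   this formula gives 0. *)
Definition gain_pw (N : nat) (t : R) : 'M[R]_(d, n) :=
  let tau := T / N%:R in
  let i := Num.truncn (t / tau) in
  let P := riccati_pw N i.+1 in
  - (invmx (Rc + tau *: (B^T *m P *m B)) *m B^T *m P *m (1%:M + tau *: A)).

End Feedback.

Section Processes.
Context {R : realType}.

(* Borel sigma-algebra of R^p, as a product sigma-algebra. *)
Definition vec_sigma (p : nat) : set (set 'cV[R]_p) :=
  <<s [set C | exists (i : 'I_p) (E : set R),
         measurable E /\ C = [set v : 'cV[R]_p | E (v i 0)]] >>.

(* Product (Kolmogorov) sigma-algebra of (R^p)^D, on paths indexed by R of
   which only the values at times in D are observed. *)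
Definition path_sigma (D : set R) (p : nat) : set (set (R -> 'cV[R]_p)) :=
  <<s [set C | exists (t : R) (E : set 'cV[R]_p),
         [/\ D t, vec_sigma E & C = [set x : R -> 'cV[R]_p | E (x t)]]] >>.

Context {dOm : measure_display} {Om : measurableType dOm}.
Variable P : probability Om R.

Definition stochastic_process (D : set R) {p : nat} (X : Om -> R -> 'cV[R]_p) :
    Prop :=
  forall t, D t -> forall i, measurable_fun setT (fun w => X w t i 0).

Definition independent {I : finType} {U : Type} (S : set (set U))
    (X : I -> Om -> U) : Prop :=
  forall (J : {set I}) (C : I -> set U), (forall i, i \in J -> S (C i)) ->
    P (\bigcap_(i in [set` J]) (X i @^-1` C i)) =
    (\prod_(i in J) P (X i @^-1` C i))%E.

Definition brownian_motion {n : nat} (W : Om -> R -> 'cV[R]_n) : Prop :=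
  [/\ stochastic_process `[0, +oo[ W,
      {ae P, forall w, W w 0 = 0 /\ {within `[0, +oo[, continuous (W w)}},
      (forall (k : nat) (t : nat -> R), 0 <= t 0%N ->
         {homo t : i j / (i <= j)%N >-> i <= j} ->
         independent (vec_sigma (p := n))
           (fun (i : 'I_k) w => W w (t i.+1) - W w (t i)))
    & forall s t : R, 0 <= s -> s < t ->
        independent measurable (fun (c : 'I_n) w => (W w t - W w s) c 0) /\
        forall (c : 'I_n) (E : set R), measurable E ->
          P [set w | E ((W w t - W w s) c 0)] =
          normal_prob 0 (Num.sqrt (t - s)) E].

(* The noise being additive, the stochastic differential equation
   dX_t = (A X_t + B K_t X_t) dt + dW_t, X_0 = x0, is the pathwise integral
   equation below and involves no stochastic integral. *)
Definition sde_solution {n d : nat} (T : R) (A : 'M[R]_n) (B : 'M[R]_(n, d))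
    (x0 : 'cV[R]_n) (W : Om -> R -> 'cV[R]_n) (K : R -> 'M[R]_(d, n))
    (X : Om -> R -> 'cV[R]_n) : Prop :=
  stochastic_process `[0, T] X /\
  {ae P, forall w, {within `[0, T], continuous (X w)} /\
    forall t, 0 <= t <= T ->
      X w t = x0
        + mx_integral `[0, t] (fun s => A *m X w s + B *m (K s *m X w s))
        + W w t}.

Definition state_control {n d : nat} (K : R -> 'M[R]_(d, n))
    (X : Om -> R -> 'cV[R]_n) : Om -> R -> 'cV[R]_(n + d) :=
  fun w t => col_mx (X w t) (K t *m X w t).

Definition joint_process {p q : nat} (X : Om -> R -> 'cV[R]_p)
    (Z : Om -> R -> 'cV[R]_q) : Om -> R -> 'cV[R]_(p + q) :=
  fun w t => col_mx (X w t) (Z w t).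

Definition expected_V {p : nat} (T : R) (Z : Om -> R -> 'cV[R]_p) : 'M[R]_p :=
  \matrix_(i, j) fine
    ('E_P[fun w => mx_integral `[0, T] (fun t => Z w t *m (Z w t)^T) i j]).

End Processes.

(* The copies may live on another probability space, such as an extension of
   the original one. *)
Definition independent_copies {R : realType} {dOm dOm' : measure_display}
    {Om : measurableType dOm} {Om' : measurableType dOm'}
    (P : probability Om R) (P' : probability Om' R) (D : set R) {p m : nat}
    (U : Om -> R -> 'cV[R]_p) (Uc : 'I_m -> Om' -> R -> 'cV[R]_p) : Prop :=
  [/\ forall j, stochastic_process D (Uc j),
      independent P' (path_sigma D (p := p)) Uc
    & forall j (C : set (R -> 'cV[R]_p)), path_sigma D C ->
        P' (Uc j @^-1` C) = P (U @^-1` C)].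

Definition theta_hat {R : realType} {n d : nat} (T : R) (N m : nat)
    (x : 'I_m -> R -> 'cV[R]_n) (z : 'I_m -> R -> 'cV[R]_(n + d)) :
    'M[R]_(n + d, n) :=
  let tau := T / N%:R in
  let t (i : nat) := i%:R * tau in
  invmx (m%:R^-1 *: (\sum_(j < m) \sum_(i < N)
           tau *: (z j (t i) *m (z j (t i))^T)) + m%:R^-1 *: 1%:M)
  *m (m%:R^-1 *: (\sum_(j < m) \sum_(i < N)
           z j (t i) *m (x j (t i.+1) - x j (t i))^T)).

(* Main.v *)
Require Import Defs.
From HB Require Import structures.
From mathcomp Require Import all_boot all_order all_algebra.
From mathcomp Require Import all_classical all_reals all_analysis.
From mathcomp Require Import measurable_realfun.
From mathcomp Require Import ring lra.

Set Implicit Arguments.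
Unset Strict Implicit.
Unset Printing Implicit Defensive.

Import Order.TTheory GRing.Theory Num.Theory.
Import numFieldNormedType.Exports.

Local Open Scope classical_set_scope.
Local Open Scope ring_scope.


(** Write [tau = T / N], [t i = i tau], and let [z j] be the regressors of the
    [j]-th path. Replacing the increments in the estimator by the drift at the
    left end of the cell plus a residual gives
    [theta_hat - theta = (G + I / m)^-1 (F - theta / m)],
    where [G] and [F] are the sample means of [sum_i tau z z^T] and of
    [sum_i z rho^T], [rho] being the residual on the cell
    ([theta_hat_split], [regression_error]). Hence the error is small as soon as
    [G] is close to the invertible matrix [E V] of the continuous-time model and
    [F] is close to zero. Three facts have to be uniform in [theta] and [N].

    Gains. A step of the discrete Riccati recursion maps symmetric positive
    semidefinite matrices to such matrices, and increases the bound on their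
    quadratic forms by a factor [1 + O(tau)] and a term [O(tau)]; the recursion
    therefore stays in a fixed ball ([riccati_iter_psd]). There the right-hand
    side of the Riccati equation is Lipschitz, the recursion is its Euler scheme
    up to [O(tau ^ 2)], and discrete Gronwall gives the distance [O(tau)]
    ([riccati_error], [gains_uniform], [gains_grid]).

    Means. The Gram matrix of the discretised model differs in mean from [E V]
    by [O(sqrt tau)], which is enough to keep its inverse bounded for large [N]
    ([gram_mean]). The rate [1 / N] of the theorem comes from [F] alone: the
    increments of the motion are orthogonal to the past of the state
    ([state_orth]), so the mean of a residual only sees the change of the drift
    over a cell, correlated with the state at the left end. This correlation is
    a Lipschitz function of time on the cell, so that each of the [N] cells
    contributes [O(tau ^ 2)] ([residual_mean]).

    Fluctuations. Path by path, both sums are bounded by a constant multiple of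
    a quadratic functional of the motion, up to a discrete stochastic integral
    of the motion against itself ([path_sums]). The functional has an
    exponential moment because squares of Gaussian variables have one
    ([grid_energy_exp]); the stochastic integral has one by comparison with its
    exponential martingale ([noise_sum_exp]). Both moments are uniform in [N].
    Chernoff's inequality with rate [sqrt (ln (1 / delta) / m)] and a union
    bound over the entries then place [G] and [F] near their means with
    probability at least [1 - 2 delta] ([chernoff], [entries_concentrate]). Since
    [m] exceeds a large multiple of [ln (1 / delta)], this rate is below the
    threshold that keeps [G + I / m] invertible; and since [delta < 1 / 2], the
    contribution of [theta / m] is at most a multiple of [ln (1 / delta) / m]. *)

(** * Matrix norms *)

Section MatrixNorm.
Context {R : realType}.
Implicit Types m n p : nat.

Lemma ler_mx_normP m n (M : 'M[R]_(m, n)) (c : R) : 0 <= c ->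
  (forall i j, `|M i j| <= c) -> `|M| <= c.
Proof.
move=> c0 h; by rewrite [leLHS]mx_normrE; apply: bigmax_le => // -[i j] _ /=.
Qed.

Lemma mx_norm_entry m n (M : 'M[R]_(m, n)) i j : `|M i j| <= `|M|.
Proof.
rewrite [leRHS]mx_normrE.
exact: (@le_bigmax _ _ _ 0 (fun k => `|M k.1 k.2|) (i, j)).
Qed.

Lemma mx_norm_mulmx m n p (A : 'M[R]_(m, n)) (B : 'M[R]_(n, p)) :
  `|A *m B| <= n%:R * `|A| * `|B|.
Proof.
apply: ler_mx_normP => [|i j]; first by rewrite !mulr_ge0.
rewrite !mxE; apply: (le_trans (ler_norm_sum _ _ _)).
apply: (@le_trans _ _ (\sum_(k < n) `|A| * `|B|)).
  apply: ler_sum => k _; rewrite normrM.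
  by apply: ler_pM => //; exact: mx_norm_entry.
by rewrite sumr_const card_ord -mulrA mulr_natl.
Qed.

Lemma mx_norm_mulmx_le m n p (A : 'M[R]_(m, n)) (B : 'M[R]_(n, p)) (a b : R) :
  `|A| <= a -> `|B| <= b -> `|A *m B| <= n%:R * a * b.
Proof.
move=> ha hb; apply: (le_trans (mx_norm_mulmx A B)).
by apply: ler_pM => //; rewrite ?mulr_ge0// ler_wpM2l.
Qed.

Lemma mx_norm_trmx m n (A : 'M[R]_(m, n)) : `|A^T| = `|A|.
Proof.
by apply/eqP; rewrite eq_le; apply/andP; split;
  apply: ler_mx_normP => // i j; rewrite ?mxE ?mx_norm_entry//;
  rewrite (_ : A i j = A^T j i) ?mxE// (le_trans _ (mx_norm_entry _ j i))// mxE.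
Qed.

Lemma mx_norm_1 n : `|1%:M : 'M[R]_n| <= 1.
Proof.
apply: ler_mx_normP => // i j; rewrite mxE.
by case: (i == j); rewrite ?normr1 ?normr0.
Qed.

Lemma frobenius_norm_ge0 m n (M : 'M[R]_(m, n)) : 0 <= frobenius_norm M.
Proof. exact: sqrtr_ge0. Qed.

Lemma frobenius_entry m n (M : 'M[R]_(m, n)) i j :
  `|M i j| <= frobenius_norm M.
Proof.
rewrite -sqrtr_sqr ler_wsqrtr// (bigD1 i)//= (bigD1 j)//= -addrA lerDl.
by rewrite addr_ge0// ?sumr_ge0// => *; rewrite ?sumr_ge0// => *; rewrite sqr_ge0.
Qed.

Lemma mx_norm_frobenius m n (M : 'M[R]_(m, n)) : `|M| <= frobenius_norm M.
Proof.
apply: ler_mx_normP => [|i j]; [exact: frobenius_norm_ge0|exact: frobenius_entry].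
Qed.

Lemma frobenius_mx_norm m n (M : 'M[R]_(m, n)) :
  frobenius_norm M <= (m * n)%:R * `|M|.
Proof.
have h0 : 0 <= (m * n)%:R * `|M| by rewrite mulr_ge0.
rewrite -[leRHS]ger0_norm// -sqrtr_sqr ler_wsqrtr//.
apply: (@le_trans _ _ (\sum_(i < m) \sum_(j < n) `|M| ^+ 2)).
  apply: ler_sum => i _; apply: ler_sum => j _.
  by rewrite -[leLHS]real_normK ?num_real// lerXn2r ?nnegrE// mx_norm_entry.
rewrite !sumr_const !card_ord -mulrnA exprMn -[leLHS]mulr_natl mulnC.
apply: ler_wpM2r; first exact: sqr_ge0.
by rewrite -natrX ler_nat; case: (_ * _)%N => // k; rewrite leq_pmulr.
Qed.

(** Testing the operator norm on the unit vectors bounds every entry. *)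
Lemma mx_norm_spectral m n (M : 'M[R]_(m, n)) : `|M| <= spectral_norm M.
Proof.
have ub (x : 'cV[R]_n) : frobenius_norm x <= 1 ->
    frobenius_norm (M *m x) <= spectral_norm M.
  move=> x1; apply: ub_le_sup; last by exists x.
  exists ((m * 1)%:R * (n%:R * `|M| * 1)) => _ [y y1 <-].
  apply: (le_trans (frobenius_mx_norm _)); apply: ler_wpM2l => //.
  apply: mx_norm_mulmx_le => //; exact: le_trans (mx_norm_frobenius _) y1.
apply: ler_mx_normP => [|i j].
  apply: le_trans (ub 0 _); first exact: frobenius_norm_ge0.
  rewrite /frobenius_norm big1 ?sqrtr0// => i _; rewrite big1// => j _.
  by rewrite mxE expr0n.
have -> : M i j = (M *m delta_mx j (0 : 'I_1)) i 0.
  rewrite mxE (bigD1 j)//= mxE !eqxx mulr1 big1 ?addr0// => k kj.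
  by rewrite mxE (negbTE kj) mulr0.
apply: (le_trans (frobenius_entry _ _ _)); apply: ub.
rewrite /frobenius_norm (bigD1 j)//= big_ord1 mxE !eqxx expr1n big1 ?addr0 ?sqrtr1//.
by move=> k kj; rewrite big_ord1 mxE (negbTE kj) expr0n.
Qed.

(** A matrix close to an invertible one is invertible, with a comparable
    inverse: [M^-1 = E^-1 + M^-1 (E - M) E^-1] and the last term is at most half
    of [M^-1]. *)
Lemma invmx_perturb n (E M : 'M[R]_n) (c e : R) : E \in unitmx ->
  `|invmx E| <= c -> `|M - E| <= e -> n%:R ^+ 2 * e * c <= 1 / 2 ->
  M \in unitmx /\ `|invmx M| <= 2 * c.
Proof.
move=> Eu hE hM hec.
have key m (v : 'M[R]_(m, n)) : `|v *m (E - M) *m invmx E| <= `|v| / 2.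
  apply: (@le_trans _ _ (n%:R * (n%:R * `|v| * e) * c)).
    do !apply: mx_norm_mulmx_le => //; by rewrite distrC.
  rewrite (_ : _ * c = `|v| * (n%:R ^+ 2 * e * c)); last by ring.
  by apply: ler_wpM2l => //; rewrite -div1r.
have Mu : M \in unitmx.
  rewrite -row_free_unit -kermx_eq0; apply/eqP.
  set K := kermx M.
  have KM : K *m M = 0 by apply/sub_kermxP.
  have hK : K = K *m (E - M) *m invmx E.
    by rewrite mulmxBr KM subr0 mulmxK.
  have := key _ K; rewrite -hK => h.
  apply/eqP; rewrite -normr_le0; lra.
split=> //.
have hI : invmx M = invmx E + invmx M *m (E - M) *m invmx E.
  by rewrite mulmxBr mulVmx// mulmxBl mulmxK// mul1mx addrC subrK.
have h1 : `|invmx M| <= `|invmx E| + `|invmx M *m (E - M) *m invmx E|.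
  by rewrite {1}hI ler_normD.
have := key _ (invmx M); lra.
Qed.

End MatrixNorm.

(** * Quadratic forms *)

Section QuadraticForm.
Context {R : realType}.

Lemma mxeD m n (A B : 'M[R]_(m, n)) i j : (A + B) i j = A i j + B i j.
Proof. by rewrite mxE. Qed.

Lemma mxeN m n (A : 'M[R]_(m, n)) i j : (- A) i j = - A i j.
Proof. by rewrite mxE. Qed.

Lemma mxeZ m n (A : 'M[R]_(m, n)) a i j : (a *: A) i j = a * A i j.
Proof. by rewrite mxE. Qed.

Definition qform {n} (M : 'M[R]_n) (v : 'cV[R]_n) : R := (v^T *m M *m v) 0 0.
Definition sqnorm {n} (v : 'cV[R]_n) : R := \sum_i v i 0 ^+ 2.

Lemma sqnorm_ge0 n (v : 'cV[R]_n) : 0 <= sqnorm v.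
Proof. by apply: sumr_ge0 => i _; exact: sqr_ge0. Qed.

Lemma sqnorm_dot n (v : 'cV[R]_n) : (v^T *m v) 0 0 = sqnorm v.
Proof. by rewrite mxE; apply: eq_bigr => i _; rewrite mxE expr2. Qed.

Lemma sqnorm_eq0 n (v : 'cV[R]_n) : sqnorm v = 0 -> v = 0.
Proof.
move=> /eqP; rewrite psumr_eq0 => [/allP h|i _]; last exact: sqr_ge0.
apply/colP => i; rewrite mxE; apply/eqP.
by have := h i (mem_index_enum _); rewrite sqrf_eq0.
Qed.

Lemma sqr_entry_le_sqnorm n (v : 'cV[R]_n) i : v i 0 ^+ 2 <= sqnorm v.
Proof.
by rewrite /sqnorm (bigD1 i)//= lerDl sumr_ge0// => j _; exact: sqr_ge0.
Qed.

Lemma qformE n (M : 'M[R]_n) v :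
  qform M v = \sum_i \sum_j v i 0 * M i j * v j 0.
Proof.
rewrite /qform mxE exchange_big/=; apply: eq_bigr => j _.
rewrite mxE mulr_suml; apply: eq_bigr => i _; by rewrite mxE.
Qed.

Lemma qformD n (M N : 'M[R]_n) v : qform (M + N) v = qform M v + qform N v.
Proof. by rewrite /qform mulmxDr mulmxDl mxE. Qed.

Lemma qformN n (M : 'M[R]_n) v : qform (- M) v = - qform M v.
Proof. by rewrite /qform mulmxN mulNmx mxE. Qed.

Lemma qformZ n (M : 'M[R]_n) a v : qform (a *: M) v = a * qform M v.
Proof. by rewrite /qform -scalemxAr -scalemxAl mxE. Qed.

Lemma qform_congr n m (P : 'M[R]_n) (M : 'M[R]_(n, m)) v :
  qform (M^T *m P *m M) v = qform P (M *m v).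
Proof. by rewrite /qform trmx_mul !mulmxA. Qed.

Lemma qform_le n (M : 'M[R]_n) v : `|qform M v| <= n%:R * `|M| * sqnorm v.
Proof.
rewrite qformE; apply: (le_trans (ler_norm_sum _ _ _)).
apply: (@le_trans _ _ (\sum_i \sum_j `|M| * ((v i 0 ^+ 2 + v j 0 ^+ 2) / 2))).
  apply: ler_sum => i _; apply: (le_trans (ler_norm_sum _ _ _)).
  apply: ler_sum => j _; rewrite !normrM mulrAC mulrC.
  apply: ler_pM => //; first exact: mx_norm_entry.
  rewrite -normrM; apply/ler_normlP; split;
    have := sqr_ge0 (v i 0 + v j 0); have := sqr_ge0 (v i 0 - v j 0); nra.
under eq_bigr do rewrite -mulr_sumr -mulr_suml big_split/= sumr_const card_ord.
rewrite -mulr_sumr -mulr_suml big_split/= sumr_const card_ord -/(sqnorm v).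
rewrite sumrMnl -/(sqnorm v) -[_ *+ n]mulr_natl.
by rewrite [leLHS](_ : _ = n%:R * `|M| * sqnorm v); last by field.
Qed.

End QuadraticForm.

Section Bounds.
Context {R : realType}.

Lemma bndD m n (X Y : 'M[R]_(m, n)) a b :
  `|X| <= a -> `|Y| <= b -> `|X + Y| <= a + b.
Proof. by move=> h1 h2; rewrite (le_trans (ler_normD _ _))// lerD. Qed.

Lemma bndN m n (X : 'M[R]_(m, n)) a : `|X| <= a -> `|- X| <= a.
Proof. by rewrite normrN. Qed.

Lemma bndT m n (X : 'M[R]_(m, n)) a : `|X| <= a -> `|X^T| <= a.
Proof. by rewrite mx_norm_trmx. Qed.

Lemma bndZ m n (X : 'M[R]_(m, n)) (t b a : R) :
  `|t| <= b -> `|X| <= a -> `|t *: X| <= b * a.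
Proof. by move=> h1 h2; rewrite normrZ ler_pM. Qed.

End Bounds.

(** The estimates on the Riccati maps are mechanical: the norm of a product or a
    sum is bounded by the same expression in the norms of its leaves. *)
Ltac bnd := first [eassumption | lazymatch goal with
  | |- is_true (`|_ + _| <= _) => eapply bndD; bnd
  | |- is_true (`|- _| <= _) => eapply bndN; bnd
  | |- is_true (`|_ *m _| <= _) => eapply mx_norm_mulmx_le; bnd
  | |- is_true (`|_^T| <= _) => eapply bndT; bnd
  | |- is_true (`|1%:M| <= _) => eapply mx_norm_1
  | |- is_true (`|_ *: _| <= _) => eapply bndZ; bnd
  | |- is_true (`|_| <= _) => exact: lexx
  end].

Section PositiveDefinite.
Context {R : realType}.

Lemma sym_pd_unit d (S : 'M[R]_d) : sym_pd S -> S \in unitmx.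
Proof.
case=> ST h; rewrite -row_free_unit -kermx_eq0; apply/eqP/row_matrixP => i.
rewrite row0; set v := row i _.
have vS : v *m S = 0.
  by rewrite /v -row_mul mulmx_ker row0.
apply/eqP; apply: contraT => v0.
have /h : v^T != 0.
  by apply: contra v0 => /eqP h0; rewrite -[v]trmxK h0 trmx0.
by rewrite trmxK vS mul0mx mxE ltxx.
Qed.

(** Expanding the form at [v - s R^-1 v] gives
    [v^T R v >= (2 s - s^2 c) v^T v], and [s = 1 / c] is the best choice. *)
Lemma sym_pd_coercive d (S : 'M[R]_d) : sym_pd S ->
  exists2 r : R, 0 < r & forall v, r * sqnorm v <= qform S v.
Proof.
move=> hS; have Su := sym_pd_unit hS; case: hS => ST h.
have S0 w : 0 <= qform S w.
  have [->|/h/ltW//] := eqVneq w 0.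
  by rewrite /qform mulmx0 mxE.
pose c := d%:R * `|invmx S| + 1.
have c0 : 0 < c by rewrite ltr_wpDl// mulr_ge0.
exists c^-1; first by rewrite invr_gt0.
move=> v; have := S0 (v - c^-1 *: (invmx S *m v)).
have ST' : (invmx S)^T = invmx S by rewrite trmx_inv ST.
have -> : qform S (v - c^-1 *: (invmx S *m v)) =
    qform S v - 2 * c^-1 * sqnorm v + c^-1 ^+ 2 * qform (invmx S) v.
  have uT : (v - c^-1 *: (invmx S *m v))^T = v^T - c^-1 *: (v^T *m invmx S).
    by rewrite [LHS]linearB/= [(_ *: _)^T]linearZ/= trmx_mul ST'.
  rewrite /qform -sqnorm_dot uT !mulmxBl !mulmxBr -?scalemxAl -?scalemxAr -?scalemxAl.
  rewrite !mulmxA !mulmxK// !mulmxKV//.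
  by rewrite !(mxeD, mxeN, mxeZ); ring.
have := qform_le (invmx S) v; move=> /(le_trans (ler_norm _)) h1 h2.
have h3 : qform (invmx S) v <= c * sqnorm v.
  by apply: (le_trans h1); rewrite ler_wpM2r ?sqnorm_ge0// lerDl.
have h4 : c^-1 ^+ 2 * qform (invmx S) v <= c^-1 * sqnorm v.
  apply: (@le_trans _ _ (c^-1 ^+ 2 * (c * sqnorm v))).
    by rewrite ler_wpM2l// sqr_ge0.
  by rewrite expr2 mulrA mulfVK ?gt_eqF// mulrC.
have := sqnorm_ge0 v; nra.
Qed.

Lemma coercive_invmx d (S : 'M[R]_d) (r : R) : 0 < r ->
  (forall v, r * sqnorm v <= qform S v) ->
  S \in unitmx /\ `|invmx S| <= r^-1.
Proof.
move=> r0 h.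
have Su : S \in unitmx.
  rewrite -unitmx_tr -row_free_unit -kermx_eq0; apply/eqP/row_matrixP => i.
  rewrite row0; set v := row i _.
  have vS : S *m v^T = 0.
    by rewrite -[S]trmxK -trmx_mul /v -row_mul mulmx_ker row0 trmx0.
  have := h v^T; rewrite /qform trmxK -mulmxA vS mulmx0 mxE pmulr_rle0// => h0.
  suff : v^T = 0 by move=> v0; rewrite -[v]trmxK v0 trmx0.
  by apply: sqnorm_eq0; apply/eqP; rewrite eq_le h0 sqnorm_ge0.
split=> //; apply: ler_mx_normP => [|i j]; first by rewrite invr_ge0 ltW.
pose w := invmx S *m delta_mx j (0 : 'I_1).
have wE k : invmx S k j = w k 0.
  rewrite mxE (bigD1 j)//= mxE !eqxx mulr1 big1 ?addr0// => l lj.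
  by rewrite mxE (negbTE lj) mulr0.
have hw : r * sqnorm w <= w j 0.
  apply: (le_trans (h w)); rewrite /qform -mulmxA mulKVmx// -colE [col _ _ _ _]mxE.
  by rewrite [_^T _ _]mxE.
have w_le k : r * w k 0 ^+ 2 <= w j 0.
  by apply: le_trans hw; rewrite ler_pM2l// sqr_entry_le_sqnorm.
have wj0 : 0 <= w j 0 by rewrite (le_trans _ (w_le j))// mulr_ge0 ?sqr_ge0// ltW.
have wj : w j 0 <= r^-1.
  have := w_le j; have [->|wj1] := eqVneq (w j 0) 0.
    by rewrite invr_ge0 (ltW r0).
  rewrite expr2 mulrA -[leRHS]mul1r ler_pM2r ?lt_neqAle 1?eq_sym ?wj1//.
  by rewrite -ler_pdivlMl// mulr1.
rewrite wE -ler_sqr ?nnegrE// ?invr_ge0 ?(ltW r0)// real_normK ?num_real//.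
rewrite -(ler_pM2l r0) (le_trans (w_le i))// (le_trans wj)//.
by rewrite expr2 mulrA divff ?gt_eqF// mul1r.
Qed.

(** The nonlinear term of the Riccati step has a sign only as a quadratic form, so
    the bound on the recursion is carried by forms rather than by entries. *)
Definition psd_le n (c : R) (P : 'M[R]_n) : Prop :=
  P^T = P /\ forall v, 0 <= qform P v <= c * sqnorm v.

Lemma psd_le_norm n c (P : 'M[R]_n) : 0 <= c -> psd_le c P -> `|P| <= c.
Proof.
move=> c0 [PT h]; apply: ler_mx_normP => // i j.
pose e k : 'cV[R]_n := delta_mx k 0.
have Pe k l : ((e k)^T *m P *m e l) 0 0 = P k l.
  rewrite /e trmx_delta -rowE -colE !mxE//.
have ee k : sqnorm (e k) = 1.
  rewrite /sqnorm (bigD1 k)//= mxE !eqxx expr1n big1 ?addr0// => l lk.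
  by rewrite mxE (negbTE lk) expr0n.
have hP k : 0 <= P k k <= c by rewrite -Pe -[c]mulr1 -(ee k); exact: h.
have [->|ij] := eqVneq i j.
  by have /andP[h1 h2] := hP j; rewrite ger0_norm.
have eN s : sqnorm (e i + s *: e j) = 1 + s ^+ 2.
  rewrite /sqnorm (bigD1 i)//= (bigD1 j)//= 1?eq_sym//.
  rewrite !mxE !eqxx (negbTE ij) [j == i]eq_sym (negbTE ij) /=.
  rewrite big1 => [|k /andP[ki kj]]; first by ring.
  by rewrite !mxE (negbTE ki) (negbTE kj) /= mulr0 addr0 expr0n.
have qE s : qform P (e i + s *: e j) = P i i + 2 * s * P i j + s ^+ 2 * P j j.
  have uT : (e i + s *: e j)^T = (e i)^T + s *: (e j)^T.
    by rewrite [LHS]linearD/= [(_ *: _)^T]linearZ.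
  rewrite /qform uT !mulmxDl !mulmxDr -?scalemxAl -?scalemxAr -?scalemxAl.
  have Pji : P j i = P i j by rewrite -[in RHS]PT mxE.
  by rewrite !(mxeD, mxeN, mxeZ) !Pe Pji; ring.
have := h (e i + 1 *: e j); have := h (e i + (-1) *: e j).
rewrite !qE !eN; have := hP i; have := hP j => /andP[? ?] /andP[? ?].
move=> /andP[? ?] /andP[? ?]; apply/ler_normlP; split; lra.
Qed.

End PositiveDefinite.

(** * The discrete Riccati recursion *)

Section RiccatiStep.
Context {R : realType} {n d : nat}.
Variables (Q : 'M[R]_n) (Rc : 'M[R]_d) (theta : 'M[R]_(n + d, n)).
Hypotheses (hQ : sym_psd Q) (hRc : sym_pd Rc).
Variable r : R.
Hypotheses (r0 : 0 < r) (rRc : forall v, r * sqnorm v <= qform Rc v).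
Local Notation A := (A_of theta).
Local Notation B := (B_of theta).

Definition step_weight (tau : R) (P : 'M[R]_n) : 'M[R]_d :=
  Rc + tau *: (B^T *m P *m B).

Definition step_core (tau : R) (P : 'M[R]_n) : 'M[R]_n :=
  P - tau *: (P *m B *m invmx (step_weight tau P) *m B^T *m P).

Lemma riccati_stepE tau P :
  riccati_step Q Rc theta tau P =
  tau *: Q + (1%:M + tau *: A)^T *m step_core tau P *m (1%:M + tau *: A).
Proof.
rewrite /riccati_step -/(step_weight tau P) /step_core.
rewrite mulmxBr mulmxBl addrA; congr (_ - _).
by rewrite -?scalemxAr -?scalemxAl !mulmxA -?scalemxAr -?scalemxAl.
Qed.

Lemma step_weight_inv tau P c : 0 <= tau -> psd_le c P ->
  step_weight tau P \in unitmx /\ `|invmx (step_weight tau P)| <= r^-1.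
Proof.
move=> t0 [PT hP]; apply: coercive_invmx => // v.
rewrite /step_weight qformD qformZ qform_congr.
rewrite (le_trans (rRc v))// lerDl mulr_ge0//.
by have /andP[] := hP (B *m v).
Qed.

Lemma step_weight_sym tau P : P^T = P ->
  (step_weight tau P)^T = step_weight tau P.
Proof.
move=> PT; rewrite /step_weight; case: hRc => RT _.
by rewrite [LHS]linearD/= [(_ *: _)^T]linearZ/= !trmx_mul PT trmxK RT !mulmxA.
Qed.

(** [step_core] is the value of an optimization problem: with
    [u = - S^-1 B^T P v] the form is the cost of the control [u],
    hence nonnegative, and the zero control bounds it by that of [P]. *)
Lemma step_core_qform tau P c v : 0 <= tau -> psd_le c P ->
  0 <= qform (step_core tau P) v <= qform P v.
Proof.
move=> t0 hPc; have [Su _] := step_weight_inv t0 hPc.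
case: (hPc) => PT hP.
set S := step_weight tau P in Su *.
have ST : S^T = S by exact: step_weight_sym.
pose u := - (invmx S *m (B^T *m P *m v)).
pose k := qform S u.
have uT : u^T = - (v^T *m P *m B *m invmx S).
  by rewrite /u [LHS]linearN/= !trmx_mul trmxK PT trmx_inv ST !mulmxA.
have kE : k = (v^T *m (P *m B *m invmx S *m B^T *m P) *m v) 0 0.
  rewrite /k /qform uT !mulNmx {1}/u mulmxN opprK.
  by rewrite !mulmxA mulmxKV.
have coreE : qform (step_core tau P) v = qform P v - tau * k.
  by rewrite /step_core qformD qformN qformZ kE.
have k_S : k = qform Rc u + tau * qform P (B *m u).
  by rewrite /k /S /step_weight qformD qformZ qform_congr.
have R0 w : 0 <= qform Rc w.
  by rewrite (le_trans _ (rRc w))// mulr_ge0 ?sqnorm_ge0// ltW.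
have P0 w : 0 <= qform P w by have /andP[] := hP w.
have k0 : 0 <= k by rewrite k_S addr_ge0// mulr_ge0.
rewrite coreE gerBl mulr_ge0// andbT.
have crossE : (v^T *m P *m (B *m u)) 0 0 = - k.
  by rewrite kE /u !mulmxN mxeN !mulmxA.
have crossE' : ((B *m u)^T *m P *m v) 0 0 = - k.
  by rewrite kE trmx_mul uT !mulNmx mxeN !mulmxA.
have -> : qform P v - tau * k =
    qform P (v + tau *: (B *m u)) + tau * qform Rc u.
  have wT : (v + tau *: (B *m u))^T = v^T + tau *: (B *m u)^T.
    by rewrite [LHS]linearD/= [(_ *: _)^T]linearZ.
  have -> : qform P (v + tau *: (B *m u)) =
      qform P v - 2 * tau * k + tau ^+ 2 * qform P (B *m u).
    rewrite {1}/qform wT !mulmxDl !mulmxDr -?scalemxAl -?scalemxAr -?scalemxAl.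
    by rewrite !(mxeD, mxeZ) crossE crossE' /qform; ring.
  by have := k_S => /eqP; rewrite -subr_eq0 => /eqP h; rewrite k_S; ring.
by rewrite addr_ge0// mulr_ge0.
Qed.

(** By [step_core_qform] the nonlinear term only decreases the quadratic form,
    so the growth of a step is that of the linear recursion
    [P -> tau Q + (1 + tau A)^T P (1 + tau A)]. *)
Lemma riccati_step_psd tau T P a q c : 0 <= tau -> tau <= T -> 0 <= c ->
  `|A| <= a -> `|Q| <= q -> psd_le c P ->
  psd_le (tau * (n%:R * q) + (1 + tau * (n%:R * (2 * a + T * (n%:R * a * a)))) * c)
    (riccati_step Q Rc theta tau P).
Proof.
move=> t0 tT c0 hA hq hPc; case: (hPc) => PT hP; case: hQ => QT Q0.
rewrite riccati_stepE; set M := 1%:M + tau *: A.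
have coreT : (step_core tau P)^T = step_core tau P.
  rewrite /step_core [LHS]linearB/= [(_ *: _)^T]linearZ/= !trmx_mul trmx_inv.
  by rewrite step_weight_sym// PT trmxK !mulmxA.
split.
  rewrite [LHS]linearD/= [(_ *: _)^T]linearZ/= QT !trmx_mul coreT trmxK.
  by rewrite !mulmxA.
move=> v; have /andP[h1 h2] := step_core_qform (M *m v) t0 hPc.
rewrite qformD qformZ qform_congr; apply/andP; split.
  by rewrite addr_ge0// mulr_ge0//; exact: Q0.
rewrite mulrDl; apply: lerD.
  rewrite -mulrA; apply: ler_wpM2l => //.
  apply: (le_trans (ler_norm _)); apply: (le_trans (qform_le _ _)).
  by rewrite ler_wpM2r ?sqnorm_ge0// ler_wpM2l.
apply: (le_trans h2).
have /andP[_ hPM] := hP (M *m v); apply: (le_trans hPM).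
rewrite [leRHS]mulrAC mulrC; apply: ler_wpM2r => //.
have -> : sqnorm (M *m v) = sqnorm v + tau * qform (A + A^T + tau *: (A^T *m A)) v.
  rewrite -!sqnorm_dot trmx_mul.
  have -> : M^T = 1%:M + tau *: A^T.
    by rewrite [LHS]linearD/= [(_ *: _)^T]linearZ/= trmx1.
  rewrite /qform mulmxDr mulmx1 !mulmxDl mul1mx !(mulmxDr, mulmxDl).
  rewrite -?scalemxAl -?scalemxAr -?scalemxAl -?scalemxAr.
  by rewrite !mulmxA !(mxeD, mxeZ); ring.
rewrite [leRHS](_ : _ = sqnorm v +
  tau * (n%:R * (2 * a + T * (n%:R * a * a)) * sqnorm v)); last by ring.
rewrite lerD2l ler_wpM2l//.
apply: (le_trans (ler_norm _)); apply: (le_trans (qform_le _ _)).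
rewrite ler_wpM2r ?sqnorm_ge0// ler_wpM2l//.
apply: bndD; last by apply: bndZ; rewrite ?ger0_norm//; bnd.
by rewrite mulr2n mulrDl mul1r; bnd.
Qed.

End RiccatiStep.

Section RiccatiIter.
Context {R : realType} {n d : nat}.
Variables (Q : 'M[R]_n) (Rc : 'M[R]_d).
Hypotheses (hQ : sym_psd Q) (hRc : sym_pd Rc).

(** Discrete Gronwall inequality; [1 + a <= exp a] makes the bound depend only
    on [k a] and [k b], which stay bounded when the step is refined. *)
Lemma affine_recursion (u : nat -> R) (a b : R) : 0 <= a -> 0 <= b ->
  u 0%N = 0 -> (forall k, u k.+1 <= (1 + a) * u k + b) ->
  forall k, u k <= k%:R * b * expR (k%:R * a).
Proof.
move=> a0 b0 u0 h; elim=> [|k IH]; first by rewrite u0 !mul0r.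
apply: (le_trans (h k)).
have e1 : (1 + a) <= expR a by exact: expR_ge1Dx.
have -> : expR (k.+1%:R * a) = expR a * expR (k%:R * a).
  by rewrite -expRD -natr1 mulrDl mul1r addrC.
have e2 : 1 <= expR (k%:R * a) by rewrite -expR0 ler_expR mulr_ge0.
have e3 : 1 <= expR a by rewrite -expR0 ler_expR.
apply: (@le_trans _ _ (expR a * (k%:R * b * expR (k%:R * a)) + b)).
  rewrite lerD2r; apply: (@le_trans _ _ ((1 + a) * (k%:R * b * expR (k%:R * a)))).
    by rewrite ler_wpM2l// addr_ge0.
  by rewrite ler_wpM2r// !mulr_ge0// ltW// expR_gt0.
have e4 : 1 <= expR a * expR (k%:R * a) by rewrite mulr_ege1.
rewrite -natr1; have := e4; set E := expR a * _.
rewrite (_ : expR a * (k%:R * b * _) = k%:R * b * E); last by rewrite /E; ring.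
move=> hE; rewrite [leRHS](_ : _ = k%:R * b * E + b * E); last by ring.
by rewrite lerD2l ler_peMr.
Qed.

(** The bound obtained by iterating [riccati_step_psd] depends neither on the
    number of steps nor on the parameter, as [k tau <= T]. *)
Lemma riccati_iter_psd T a theta (N k : nat) : 0 < T -> (0 < N)%N ->
  `|A_of theta| <= a -> (k <= N)%N ->
  psd_le (T * (n%:R * `|Q|) * expR (T * (n%:R * (2 * a + T * (n%:R * a * a)))))
    (iter k (riccati_step Q Rc theta (T / N%:R)) 0).
Proof.
move=> T0 N0 hA kN; set tau := T / N%:R.
have a0 : 0 <= a by exact: le_trans hA.
have N1 : 1 <= N%:R :> R by rewrite ler1n.
have t0 : 0 <= tau by rewrite divr_ge0// ltW.
have tT : tau <= T by rewrite ler_pdivrMr ?(lt_le_trans _ N1)// ler_peMr// ltW.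
have [r r0 hr] := sym_pd_coercive hRc.
set al := n%:R * (2 * a + T * (n%:R * a * a)).
have al0 : 0 <= al by rewrite !(mulr_ge0, addr_ge0)// ltW.
pose u := fix u k := if k is k'.+1 then (1 + tau * al) * u k' + tau * (n%:R * `|Q|)
  else 0.
have u0 j : 0 <= u j.
  by elim: j => //= j IH; rewrite addr_ge0// mulr_ge0 ?addr_ge0// mulr_ge0.
have hu j : psd_le (u j) (iter j (riccati_step Q Rc theta tau) 0).
  elim: j => [|j IH] /=.
    split; first by rewrite trmx0.
    by move=> v; rewrite /qform mulmx0 mul0mx mxE mul0r lexx.
  by rewrite addrC; exact: (riccati_step_psd hQ hRc r0 hr t0 tT).
have ktau : k%:R * tau <= T.
  by rewrite /tau mulrCA ler_piMr ?(ltW T0)// ler_pdivrMr ?ltr0n// mul1r ler_nat.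
have hk : u k <= T * (n%:R * `|Q|) * expR (T * al).
  have b0 : 0 <= tau * (n%:R * `|Q|) by apply: mulr_ge0 => //; rewrite mulr_ge0.
  have hS j : u j.+1 <= (1 + tau * al) * u j + tau * (n%:R * `|Q|).
    by rewrite /= lexx.
  apply: (le_trans (affine_recursion (mulr_ge0 t0 al0) b0 erefl hS k)).
  apply: ler_pM.
  - exact: mulr_ge0.
  - exact: expR_ge0.
  - by rewrite mulrA ler_wpM2r// mulr_ge0.
  - by rewrite ler_expR mulrA ler_wpM2r.
case: (hu k) => hT hv; split=> // v; have /andP[-> /= h2] := hv v.
by rewrite (le_trans h2)// ler_wpM2r// sqnorm_ge0.
Qed.

End RiccatiIter.

(** * The Riccati equation and its discretisation *)

Section RiccatiConvergence.
Context {R : realType} {n d : nat}.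
Variables (Q : 'M[R]_n) (Rc : 'M[R]_d).
Hypotheses (hQ : sym_psd Q) (hRc : sym_pd Rc).
Variables (T a : R).
Hypothesis T0 : 0 < T.
Implicit Types (theta : 'M[R]_(n + d, n)) (P : 'M[R]_n).

Definition riccati_rhs theta P : 'M[R]_n :=
  (A_of theta)^T *m P + P *m A_of theta
  - P *m B_of theta *m invmx Rc *m (B_of theta)^T *m P + Q.

Definition small theta := `|A_of theta| <= a /\ `|B_of theta| <= a.

Lemma riccati_rhs_bounded c : exists C, forall theta P,
  small theta -> `|P| <= c -> `|riccati_rhs theta P| <= C.
Proof.
eexists => theta P [hA hB] hP; rewrite /riccati_rhs.
have hR : `|invmx Rc| <= `|invmx Rc| by [].
have hQ' : `|Q| <= `|Q| by [].
by bnd.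
Qed.

Lemma riccati_rhs_lipschitz c : exists L, forall theta P P',
  small theta -> `|P| <= c -> `|P'| <= c ->
  `|riccati_rhs theta P - riccati_rhs theta P'| <= L * `|P - P'|.
Proof.
exists (n%:R * a + n%:R * a + (n%:R * (d%:R * (d%:R * (n%:R * a) * `|invmx Rc|) * a) * c
  + n%:R * (d%:R * (d%:R * (n%:R * c * a) * `|invmx Rc|) * a))).
move=> theta P P' [hA hB] hP hP'.
set D := P - P'; set A := A_of theta in hA *; set B := B_of theta in hB *.
have -> : riccati_rhs theta P - riccati_rhs theta P' = A^T *m D + D *m A
   - (D *m B *m invmx Rc *m B^T *m P + P' *m B *m invmx Rc *m B^T *m D).
  rewrite /riccati_rhs -/A -/B /D !(mulmxBl, mulmxBr).
  set X1 := A^T *m P; set X2 := A^T *m P'; set X3 := P *m A; set X4 := P' *m A.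
  set Y1 := _ *m P; set Y2 := _ *m P'; set Y3 := _ *m P.
  by apply/matrixP => i j; rewrite !(mxeD, mxeN); ring.
have hR : `|invmx Rc| <= `|invmx Rc| by [].
have hD : `|D| <= `|D| by [].
by apply: le_trans; first bnd; rewrite le_eqVlt; apply/orP; left; apply/eqP; ring.
Qed.

(** One step of the recursion is an Euler step of the Riccati equation up to
    an error of order [tau ^ 2]; replacing the inverse of [Rc + tau B^T P B]
    by that of [Rc] is part of that error. *)
Lemma riccati_step_consistent c : 0 <= c -> exists C, forall theta P tau,
  small theta -> psd_le c P -> 0 <= tau -> tau <= T ->
  `|riccati_step Q Rc theta tau P - P - tau *: riccati_rhs theta P| <= tau ^+ 2 * C.
Proof.
move=> c0; have [r r0 hr] := sym_pd_coercive hRc.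
eexists => theta P tau [hA hB] hPc t0 tT; have hP := psd_le_norm c0 hPc.
have [Su hS] := step_weight_inv theta r0 hr t0 hPc.
set S := step_weight Rc theta tau P in Su hS.
set A := A_of theta in hA *; set B := B_of theta in hB *.
pose Y := P *m B *m invmx S *m B^T *m P.
pose X := P - tau *: Y.
pose V := P *m B *m (invmx S *m (B^T *m P *m B) *m invmx Rc) *m B^T *m P.
have RSinv : invmx Rc - invmx S = tau *: (invmx S *m (B^T *m P *m B) *m invmx Rc).
  rewrite scalemxAl scalemxAr.
  have -> : tau *: (B^T *m P *m B) = S - Rc by rewrite /S /step_weight addrC addKr.
  by rewrite mulmxBr mulVmx// mulmxBl mul1mx mulmxK// sym_pd_unit.
have VE : tau *: V = P *m B *m invmx Rc *m B^T *m P - Y.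
  by rewrite /Y /V scalemxAl scalemxAl scalemxAr -RSinv mulmxBr !mulmxBl.
have -> : riccati_step Q Rc theta tau P - P - tau *: riccati_rhs theta P =
    tau ^+ 2 *: (V + A^T *m X *m A - (A^T *m Y + Y *m A)).
  rewrite riccati_stepE -/A (_ : step_core _ _ _ _ = X)//.
  have -> : (1%:M + tau *: A)^T = 1%:M + tau *: A^T.
    by rewrite [LHS]linearD/= [(_ *: _)^T]linearZ/= trmx1.
  rewrite /riccati_rhs -/A -/B.
  set Z := P *m B *m invmx Rc *m B^T *m P in VE *.
  have -> : Z = tau *: V + Y by rewrite VE subrK.
  rewrite mulmxDl mul1mx mulmxDr mulmx1 mulmxDl.
  rewrite -[tau *: A^T *m X]scalemxAl -[X *m (tau *: A)]scalemxAr.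
  rewrite -scalemxAl -scalemxAr.
  have -> : A^T *m X = A^T *m P - tau *: (A^T *m Y).
    by rewrite /X mulmxBr -scalemxAr.
  have -> : X *m A = P *m A - tau *: (Y *m A).
    by rewrite /X mulmxBl -scalemxAl.
  rewrite mulmxBl -[_ *: (A^T *m Y) *m A]scalemxAl.
  set X1 := A^T *m P *m A; set X2 := A^T *m Y *m A; rewrite /X.
  set X3 := A^T *m P; set X4 := A^T *m Y; set X5 := P *m A; set X6 := Y *m A.
  by clear; apply/matrixP => i j; rewrite !(mxeD, mxeN, mxeZ); ring.
rewrite normrZ ger0_norm ?sqr_ge0//; apply: ler_wpM2l; first exact: sqr_ge0.
have ht : `|tau| <= T by rewrite ger0_norm.
have hR : `|invmx Rc| <= `|invmx Rc| by [].
by rewrite /V /X /Y; bnd.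
Qed.

Lemma riccati_entry theta p : riccati_solution T Q Rc theta p ->
  forall i j, {within `[0, T], continuous (fun t => p t i j)} /\
  forall t, 0 < t < T ->
    is_derive t 1 (fun t => p t i j) (- riccati_rhs theta (p t) i j).
Proof.
move=> [pc pd _] i j; split.
  move=> x; apply: (@cvg_comp _ _ _ p (fun M => M i j) _ _ _ (pc x)).
  exact: coord_continuous.
move=> t /pd h; have dp : derivable p t 1 by exact: ex_derive.
have dpij := (derivable_mxP p t 1).1 dp i j.
apply: DeriveDef => //.
have := derive_val (is_derive := h).
by rewrite derive_mx// => /matrixP/(_ i j); rewrite mxE mxeN => ->.
Qed.

Lemma within_continuousS (V : topologicalType) (f : R -> V) (s t : R) :
  0 <= s -> t <= T -> {within `[0, T], continuous f} ->
  {within `[s, t], continuous f}.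
Proof.
move=> s0 tT; apply: continuous_subspaceW => x /=; rewrite !in_itv/=.
by move=> /andP[h1 h2]; rewrite (le_trans s0)//= (le_trans h2).
Qed.

Lemma riccati_sol_lipschitz theta p c C : riccati_solution T Q Rc theta p ->
  (forall P, `|P| <= c -> `|riccati_rhs theta P| <= C) ->
  (forall t, 0 <= t <= T -> `|p t| <= c) ->
  forall s t, 0 <= s -> s <= t -> t <= T -> `|p t - p s| <= C * (t - s).
Proof.
move=> hp hC hc s t s0 st tT.
have C0 : 0 <= C.
  by apply: le_trans (hC (p s) _) => //; rewrite hc// s0 (le_trans st).
apply: ler_mx_normP => [|i j]; first by rewrite mulr_ge0// subr_ge0.
have [pc pd] := riccati_entry hp i j.
have [x|x] := @MVT_segment R (fun t => p t i j)
   (fun t => - riccati_rhs theta (p t) i j) s t st _ (within_continuousS s0 tT pc).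
  rewrite in_itv/= => /andP[sx xt]; apply: pd.
  by rewrite (le_lt_trans s0)//= (lt_le_trans xt).
rewrite in_itv/= => /andP[sx xt] h.
rewrite mxeD mxeN h normrM normrN [`|t - s|]ger0_norm ?subr_ge0//.
rewrite ler_wpM2r ?subr_ge0// (le_trans (mx_norm_entry _ _ _))// hC// hc//.
by rewrite (le_trans s0)//= (le_trans xt).
Qed.

(** Mean value theorem for [u -> p u + u f (p t)]: its derivative is at most
    [L C (t - s)], since [p] moves by at most [C (t - s)]. *)
Lemma riccati_sol_consistent theta p c C L : riccati_solution T Q Rc theta p ->
  (forall P, `|P| <= c -> `|riccati_rhs theta P| <= C) ->
  (forall P P', `|P| <= c -> `|P'| <= c ->
     `|riccati_rhs theta P - riccati_rhs theta P'| <= L * `|P - P'|) ->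
  0 <= L ->
  (forall t, 0 <= t <= T -> `|p t| <= c) ->
  forall s t, 0 <= s -> s <= t -> t <= T ->
  `|p s - p t - (t - s) *: riccati_rhs theta (p t)| <= L * C * (t - s) ^+ 2.
Proof.
move=> hp hC hL L0 hc s t s0 st tT.
have t0T : 0 <= t <= T by rewrite (le_trans s0)//=.
have C0 : 0 <= C by apply: le_trans (hC (p t) _) => //; rewrite hc.
apply: ler_mx_normP => [|i j]; first by apply: mulr_ge0; [exact: mulr_ge0|exact: sqr_ge0].
have [pc pd] := riccati_entry hp i j.
set D := riccati_rhs theta (p t).
have [x|x|x] := @MVT_segment R (fun u => p u i j + u * D i j)
   (fun u => - riccati_rhs theta (p u) i j + D i j) s t st _ _.
- rewrite in_itv/= => /andP[sx xt].
  have := pd x; rewrite (le_lt_trans s0)//= (lt_le_trans xt)// => /(_ isT) pd'.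
  apply: is_deriveD.
  have := @is_deriveM R R^o id (cst (D i j)) x 1 1 0 _ _.
  rewrite scaler0 add0r scaler1; apply.
- apply: (within_continuousS s0 tT) => y; apply: cvgD; first exact: pc.
  apply: cvgM; last exact: cvg_cst.
  exact: (@continuous_subspaceT _ _ _ (fun u : R => u) (fun z => cvg_id) y).
rewrite in_itv/= => /andP[sx xt] h.
have x0T : 0 <= x <= T by rewrite (le_trans s0)//= (le_trans xt).
have -> : (p s - p t - (t - s) *: D) i j = (riccati_rhs theta (p x) - D) i j * (t - s).
  move: h; move: (riccati_rhs _ _) => F; move: D => D.
  by rewrite !(mxeD, mxeN, mxeZ) => h; lra.
rewrite normrM [`|t - s|]ger0_norm ?subr_ge0// expr2 mulrA ler_wpM2r ?subr_ge0//.
apply: (le_trans (mx_norm_entry _ _ _)); apply: (le_trans (hL _ _ _ _)).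
- exact: hc.
- exact: hc.
rewrite -mulrA ler_wpM2l// distrC.
apply: (le_trans (riccati_sol_lipschitz hp hC hc _ xt tT)).
  by case/andP : x0T.
by rewrite ler_wpM2l// lerD2l lerN2.
Qed.

End RiccatiConvergence.

(** * Uniform bounds on the Riccati solutions and on the gains *)

Section RiccatiUniform.
Context {R : realType} {n d : nat}.
Variables (Q : 'M[R]_n) (Rc : 'M[R]_d).
Hypotheses (hQ : sym_psd Q) (hRc : sym_pd Rc).
Variables (T a : R).
Hypothesis T0 : 0 < T.
Implicit Types (theta : 'M[R]_(n + d, n)) (P : 'M[R]_n).
Local Notation small := (small a).

Definition riccati_bound : R :=
  T * (n%:R * `|Q|) * expR (T * (n%:R * (2 * a + T * (n%:R * a * a)))).

Lemma riccati_bound_ge0 : 0 <= riccati_bound.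
Proof. by rewrite !mulr_ge0// ?expR_ge0// ltW. Qed.

Lemma tau_le (N k : nat) : (0 < N)%N -> (k <= N)%N -> k%:R * (T / N%:R) <= T.
Proof.
move=> N0 kN; rewrite mulrCA ler_piMr ?(ltW T0)// ler_pdivrMr ?ltr0n//.
by rewrite mul1r ler_nat.
Qed.

Lemma tau_ge0 (N : nat) : 0 <= T / N%:R.
Proof. by rewrite divr_ge0// ltW. Qed.

(** Stability of the explicit Euler scheme. The constant depends on the
    bound [c] of the solution, which [riccati_sol_bound] makes uniform in [theta]. *)
Lemma riccati_error c : exists C, forall theta p (N k : nat),
  small theta -> riccati_solution T Q Rc theta p ->
  (forall t, 0 <= t <= T -> `|p t| <= c) -> (0 < N)%N -> (k <= N)%N ->
  `|iter k (riccati_step Q Rc theta (T / N%:R)) 0 - p (T - k%:R * (T / N%:R))|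
    <= C * (T / N%:R).
Proof.
pose c' := Num.max c riccati_bound.
have [C1 hC1] := riccati_rhs_bounded Q Rc a c'.
have [L hL] := riccati_rhs_lipschitz Q Rc a c'.
have [Cs hCs] := riccati_step_consistent Q hRc T a riccati_bound_ge0.
pose L' := Num.max L 0; have L'0 : 0 <= L' by rewrite le_max lexx orbT.
pose b0 := `|Cs| + L' * `|C1|.
exists (T * b0 * expR (T * L')) => theta p N k hs hp hc N0 kN.
set tau := T / N%:R; have t0 : 0 <= tau := tau_ge0 N.
pose e k := `|iter k (riccati_step Q Rc theta tau) 0 - p (T - k%:R * tau)|.
pose u k := e (minn k N).
have kT j : (j <= N)%N -> 0 <= T - j%:R * tau <= T.
  by move=> jN; rewrite subr_ge0 tau_le//= gerBl mulr_ge0.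
have hpsd j : (j <= N)%N -> psd_le riccati_bound (iter j (riccati_step Q Rc theta tau) 0).
  by move=> jN; apply: riccati_iter_psd => //; case: hs.
have hc' t : 0 <= t <= T -> `|p t| <= c'.
  by move=> /hc h; rewrite le_max h.
have b00 : 0 <= b0 by rewrite addr_ge0// mulr_ge0.
have tb : 0 <= tau * L' by rewrite mulr_ge0.
have tb2 : 0 <= tau ^+ 2 * b0 by rewrite mulr_ge0// sqr_ge0.
have tauT : tau <= T by have := tau_le N0 N0; rewrite mul1r.
have hu j : u j.+1 <= (1 + tau * L') * u j + tau ^+ 2 * b0.
  rewrite /u; have [jN|Nj] := ltnP j N; last first.
    rewrite !(minn_idPr _)// 1?ltnW// mulrDl mul1r -addrA lerDl addr_ge0//.
    by rewrite mulr_ge0// normr_ge0.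
  rewrite !(minn_idPl _)// ?(ltnW jN)// {1}/e.
  have -> : iter j.+1 (riccati_step Q Rc theta tau) 0 =
    riccati_step Q Rc theta tau (iter j (riccati_step Q Rc theta tau) 0) by [].
  rewrite /e; have hPj := hpsd j (ltnW jN).
  set Pj := iter j _ 0 in hPj *.
  set s := T - j.+1%:R * tau; set t := T - j%:R * tau.
  have ts : t - s = tau by rewrite /t /s -natr1; ring.
  have hPn := psd_le_norm riccati_bound_ge0 hPj.
  have hPn' : `|Pj| <= c' by rewrite le_max hPn orbT.
  have /andP[t0' t1'] := kT j (ltnW jN); have /andP[s0' s1'] := kT _ jN.
  have ht : 0 <= t <= T by apply: kT; exact: ltnW.
  have h1 := hCs theta Pj tau hs hPj t0 tauT.
  have h2 : `|riccati_rhs Q Rc theta Pj - riccati_rhs Q Rc theta (p t)| <= L' * `|Pj - p t|.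
    apply: (le_trans (hL _ _ _ hs hPn' (hc' _ ht))).
    by rewrite ler_wpM2r// le_max lexx.
  have h3 : `|p s - p t - tau *: riccati_rhs Q Rc theta (p t)| <= L' * `|C1| * tau ^+ 2.
    rewrite -ts; apply: (riccati_sol_consistent hp _ _ L'0 hc') => //.
    - by move=> P hP; rewrite (le_trans (hC1 _ _ hs hP))// ler_norm.
    - move=> P P' hP hP'; apply: (le_trans (hL _ _ _ hs hP hP')).
      by rewrite ler_wpM2r// le_max lexx.
    - by rewrite -subr_ge0 ts.
  have -> : riccati_step Q Rc theta tau Pj - p s =
     (riccati_step Q Rc theta tau Pj - Pj - tau *: riccati_rhs Q Rc theta Pj)
     + (Pj - p t)
     + tau *: (riccati_rhs Q Rc theta Pj - riccati_rhs Q Rc theta (p t))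
     - (p s - p t - tau *: riccati_rhs Q Rc theta (p t)).
    move: (riccati_step _ _ _ _ _) (riccati_rhs _ _ _ _) (riccati_rhs _ _ _ _) => x1 x2 x3.
    by apply/matrixP => i' j'; rewrite !(mxeD, mxeN, mxeZ); ring.
  have h2' : `|tau *: (riccati_rhs Q Rc theta Pj - riccati_rhs Q Rc theta (p t))|
     <= tau * (L' * `|Pj - p t|) by rewrite normrZ ger0_norm// ler_wpM2l.
  have h1' : tau ^+ 2 * Cs <= tau ^+ 2 * `|Cs| by rewrite ler_wpM2l ?sqr_ge0// ler_norm.
  apply: (le_trans (bndD (bndD (bndD (le_trans h1 h1') (lexx _)) h2') (bndN h3))).
  by rewrite le_eqVlt /b0; apply/orP; left; apply/eqP; ring.
have u0 : u 0%N = 0.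
  by rewrite /u min0n /e /= mul0r subr0; case: hp => _ _ ->; rewrite subrr normr0.
have := affine_recursion tb tb2 u0 hu k; rewrite /u (minn_idPl kN) => h.
apply: (le_trans h).
have kt := tau_le N0 kN; rewrite -/tau in kt.
apply: (@le_trans _ _ (T * (tau * b0) * expR (T * L'))); last first.
  by rewrite le_eqVlt; apply/orP; left; apply/eqP; ring.
apply: ler_pM; rewrite ?expR_ge0//; first by rewrite mulr_ge0.
  by rewrite expr2 -[tau * tau * b0]mulrA mulrA ler_wpM2r// mulr_ge0.
by rewrite ler_expR mulrA ler_wpM2r.
Qed.

(** The recursion runs backwards from [T], so its grid points are the
    [T - k tau]. *)
Lemma grid_above (N : nat) t : (0 < N)%N -> 0 <= t <= T ->
  exists2 k, (k <= N)%N & t <= T - k%:R * (T / N%:R) <= t + T / N%:R.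
Proof.
move=> N0 /andP[t0 tT]; set tau := T / N%:R.
have tau0 : 0 < tau by rewrite divr_gt0// ltr0n.
have x0 : 0 <= (T - t) / tau by rewrite divr_ge0 ?subr_ge0// ltW.
have /andP[h1 h2] := truncn_itv x0.
exists (Num.truncn ((T - t) / tau)).
  rewrite -(ler_nat R); apply: (le_trans h1).
  rewrite ler_pdivrMr// /tau mulrCA divff ?pnatr_eq0 -?lt0n// mulr1.
  by rewrite gerBl.
move: h1 h2; rewrite ler_pdivlMr// ltr_pdivrMr// -natr1 => h1 h2.
apply/andP; split; lra.
Qed.

(** A solution is continuous, hence bounded by some constant that may depend on
    [theta]. With that constant, [riccati_error] shows that it is the limit of the
    discrete recursions, whose bound does not depend on [theta]. *)
Lemma riccati_sol_bound theta p : small theta -> riccati_solution T Q Rc theta p ->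
  forall t, 0 <= t <= T -> `|p t| <= riccati_bound.
Proof.
move=> hs hp t htT.
have [c hc] : exists c, forall t, 0 <= t <= T -> `|p t| <= c.
  have [pc _ _] := hp.
  have [M [_ hM]] := compact_bounded (continuous_compact pc (@segment_compact R 0 T)).
  exists (M + 1) => s hs'; apply: (hM (M + 1)); first by rewrite ltrDl.
  by exists s => //=; rewrite in_itv.
have [C hC] := riccati_error c.
have [C1 hC1] := riccati_rhs_bounded Q Rc a c.
have [//|hlt] := leP `|p t| riccati_bound.
have key N : (0 < N)%N -> `|p t| <= riccati_bound + (`|C| + `|C1|) * (T / N%:R).
  move=> N0; have [k kN /andP[k1 k2]] := grid_above N0 htT.
  have := hC theta p N k hs hp hc N0 kN.
  have hP : `|iter k (riccati_step Q Rc theta (T / N%:R)) 0| <= riccati_bound.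
    by apply: psd_le_norm riccati_bound_ge0 _; apply: riccati_iter_psd => //; case: hs.
  have hl : `|p (T - k%:R * (T / N%:R)) - p t| <= `|C1| * (T / N%:R).
    apply: (@le_trans _ _ (`|C1| * (T - k%:R * (T / N%:R) - t))).
      apply: (riccati_sol_lipschitz hp _ hc) => //.
      - by move=> P hP'; rewrite (le_trans (hC1 _ _ hs hP'))// ler_norm.
      - by case/andP : htT.
      - by rewrite gerBl mulr_ge0// tau_ge0.
    by rewrite ler_wpM2l// lerBlDl.
  set X := iter _ _ _ in hP *; set Y := p (T - _) in hl * => hXY.
  have -> : p t = X - (X - Y) - (Y - p t).
    by apply/matrixP => i j; rewrite !(mxeD, mxeN); ring.
  have hXY' := le_trans hXY (ler_wpM2r (tau_ge0 N) (ler_norm C)).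
  apply: (le_trans (bndD (bndD hP (bndN hXY')) (bndN hl))).
  by rewrite mulrDl addrA.
exfalso; pose x := (`|C| + `|C1|) * T / (`|p t| - riccati_bound).
have x0 : 0 <= x.
  apply: divr_ge0; last by rewrite subr_ge0 ltW.
  by apply: mulr_ge0; [exact: addr_ge0|exact: ltW].
have /andP[_ hx] := truncn_itv x0.
have := key (Num.truncn x).+1 isT; move: hx.
set N := (Num.truncn x).+1; rewrite ltr_pdivrMr ?subr_gt0// => h1.
have N0 : 0 < N%:R :> R by rewrite ltr0n.
rewrite -lerBlDl mulrA ler_pdivlMr// mulrC => h2.
by have := le_lt_trans h2 h1; rewrite ltxx.
Qed.

End RiccatiUniform.

Section Gains.
Context {R : realType} {n d : nat}.
Variables (Q : 'M[R]_n) (Rc : 'M[R]_d).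
Hypotheses (hQ : sym_psd Q) (hRc : sym_pd Rc).
Variable T : R.
Hypothesis T0 : 0 < T.
Implicit Types (theta : 'M[R]_(n + d, n)) (P : 'M[R]_n).

Lemma small_of_frobenius a theta : frobenius_norm theta <= a -> small a theta.
Proof.
move=> h; have h' := le_trans (mx_norm_frobenius theta) h.
have a0 : 0 <= a by exact: le_trans h'.
by split; rewrite mx_norm_trmx; apply: ler_mx_normP => // i j;
  rewrite mxE (le_trans (mx_norm_entry _ _ _)).
Qed.

Lemma gain_pwE theta N t : gain_pw T Q Rc theta N t =
  - (invmx (step_weight Rc theta (T / N%:R)
        (riccati_pw T Q Rc theta N (Num.truncn (t / (T / N%:R))).+1))
     *m (B_of theta)^T
     *m riccati_pw T Q Rc theta N (Num.truncn (t / (T / N%:R))).+1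
     *m (1%:M + (T / N%:R) *: A_of theta)).
Proof. by []. Qed.

(** Besides the error on the Riccati matrices, the piecewise constant gain
    differs from the continuous one by the weight [Rc + tau B^T P B] instead of
    [Rc], the factor [1 + tau A], and the evaluation at the next grid point;
    each costs [O(tau)]. *)
Lemma gains_uniform a : exists C, forall theta p, small a theta ->
  riccati_solution T Q Rc theta p ->
  [/\ forall t, 0 <= t <= T -> `|gain_ct Rc theta p t| <= C,
      forall s t, 0 <= s -> s <= t -> t <= T ->
        `|gain_ct Rc theta p t - gain_ct Rc theta p s| <= C * (t - s),
      forall N, (0 < N)%N -> forall t, `|gain_pw T Q Rc theta N t| <= C &
      forall N, (0 < N)%N -> forall t, 0 <= t < T ->
        `|gain_pw T Q Rc theta N t - gain_ct Rc theta p t| <= C * (T / N%:R)].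
Proof.
pose c := riccati_bound (n := n) Q T a.
have c0 : 0 <= c by exact: riccati_bound_ge0.
have [C1 hC1] := riccati_rhs_bounded Q Rc a c.
have [Ce hCe] := riccati_error (d := d) hQ hRc a T0 c.
have [r r0 hr] := sym_pd_coercive hRc.
have hR : `|invmx Rc| <= `|invmx Rc| by [].
suff [K hK] : exists K : R * R * R * R, forall theta p, small a theta ->
  riccati_solution T Q Rc theta p ->
  [/\ forall t, 0 <= t <= T -> `|gain_ct Rc theta p t| <= K.1.1.1,
      forall s t, 0 <= s -> s <= t -> t <= T ->
        `|gain_ct Rc theta p t - gain_ct Rc theta p s| <= K.1.1.2 * (t - s),
      forall N, (0 < N)%N -> forall t, `|gain_pw T Q Rc theta N t| <= K.1.2 &
      forall N, (0 < N)%N -> forall t, 0 <= t < T ->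
        `|gain_pw T Q Rc theta N t - gain_ct Rc theta p t| <= K.2 * (T / N%:R)].
  exists (Num.max (Num.max K.1.1.1 K.1.1.2) (Num.max K.1.2 K.2)) => theta p hs hp.
  have [h1 h2 h3 h4] := hK theta p hs hp; split.
  - by move=> t ht; rewrite !le_max h1.
  - move=> s t s0 st tT; apply: (le_trans (h2 _ _ s0 st tT)).
    by rewrite ler_wpM2r ?subr_ge0// !le_max lexx orbT.
  - by move=> N N0 t; rewrite !le_max h3// !orbT.
  - move=> N N0 t ht; apply: (le_trans (h4 _ N0 _ ht)).
    by rewrite ler_wpM2r ?tau_ge0// !le_max lexx !orbT.
pose k1 := d%:R * `|invmx Rc| * a.
pose k2 := n%:R * k1 * (`|C1|).
eexists (_, k2, _, _) => theta p hs hp /=; case: (hs) => hA hB.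
have hc := riccati_sol_bound hQ hRc T0 hs hp; rewrite -/c in hc.
have hRB : `|invmx Rc *m (B_of theta)^T| <= k1 by rewrite /k1; bnd.
have hlip s t : 0 <= s -> s <= t -> t <= T -> `|p t - p s| <= `|C1| * (t - s).
  apply: (riccati_sol_lipschitz hp) hc _ _ => P hP.
  by rewrite (le_trans (hC1 _ _ hs hP))// ler_norm.
have hlip' s t : 0 <= s -> s <= t -> t <= T ->
    `|gain_ct Rc theta p t - gain_ct Rc theta p s| <= k2 * (t - s).
  move=> s0 st tT; rewrite /gain_ct -opprD normrN -mulmxBr.
  by have := mx_norm_mulmx_le hRB (hlip _ _ s0 st tT); rewrite /k2 mulrA.
have hpw N j : psd_le c (riccati_pw T Q Rc theta N j.+1) \/ N = 0%N.
  case: N => [|N]; first by right.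
  by left; apply: riccati_iter_psd => //; exact: leq_subr.
split=> //.
- move=> t /hc hpt; rewrite /gain_ct; bnd.
- move=> N N0 t; rewrite gain_pwE.
  have [hP|N00] := hpw N (Num.truncn (t / (T / N%:R))); last by rewrite N00 in N0.
  have hPn := psd_le_norm c0 hP.
  have [Su hS] := step_weight_inv theta r0 hr (tau_ge0 T0 N) hP.
  have ht : `|T / N%:R| <= T.
    by rewrite ger0_norm ?tau_ge0//; have := tau_le T0 N0 N0; rewrite mul1r.
  by bnd.
- move=> N N0 t /andP[t0 tT].
  set tau := T / N%:R; set i := Num.truncn (t / tau).
  have tau0 : 0 < tau by rewrite divr_gt0// ltr0n.
  have /andP[i1 i2] : i%:R <= t / tau < i.+1%:R by rewrite truncn_itv// divr_ge0// ltW.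
  move: i1 i2; rewrite ler_pdivlMr// ltr_pdivrMr// => i1 i2.
  have Ntau : N%:R * tau = T by rewrite /tau mulrCA divff ?mulr1// pnatr_eq0 -lt0n.
  have iN : (i < N)%N.
    by rewrite -(ltr_nat R) -(ltr_pM2r tau0) Ntau (le_lt_trans i1).
  rewrite gain_pwE -/tau -/i; set P := riccati_pw _ _ _ _ _ _.
  have [hP|N00] := hpw N i; last by rewrite N00 in N0.
  rewrite -/P in hP; have hPn := psd_le_norm c0 hP.
  have [Su hS] := step_weight_inv theta r0 hr (ltW tau0) hP.
  set S := step_weight _ _ _ _ in Su hS *.
  set A := A_of theta in hA *; set B := B_of theta in hB hRB *.
  have si : T - (N - i.+1)%:R * tau = i.+1%:R * tau.
    by rewrite natrB// mulrBl Ntau subKr.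
  have siT : i.+1%:R * tau <= T by exact: tau_le.
  have hPe : `|P - p (i.+1%:R * tau)| <= `|Ce| * tau.
    have := hCe theta p N (N - i.+1)%N hs hp hc N0 (leq_subr _ _).
    rewrite -/tau si => h; apply: (le_trans h).
    by rewrite ler_wpM2r ?(ltW tau0)// ler_norm.
  have hpe : `|p (i.+1%:R * tau) - p t| <= `|C1| * tau.
    apply: (le_trans (hlip _ _ t0 (ltW i2) siT)); rewrite ler_wpM2l//.
    by rewrite lerBlDl; rewrite -natr1 mulrDl mul1r lerD2r.
  have hPp : `|P - p t| <= (`|Ce| + `|C1|) * tau.
    rewrite (_ : P - p t = P - p (i.+1%:R * tau) + (p (i.+1%:R * tau) - p t)).
      by rewrite mulrDl bndD.
    by apply/matrixP => i' j'; rewrite !(mxeD, mxeN); ring.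
  have RS : invmx S - invmx Rc = - (tau *: (invmx S *m (B^T *m P *m B) *m invmx Rc)).
    rewrite scalemxAl scalemxAr.
    have -> : tau *: (B^T *m P *m B) = S - Rc by rewrite /S /step_weight addrC addKr.
    by rewrite mulmxBr mulVmx// mulmxBl mul1mx mulmxK ?sym_pd_unit// opprB.
  have -> : - (invmx S *m B^T *m P *m (1%:M + tau *: A)) - gain_ct Rc theta p t =
     - (tau *: (invmx S *m B^T *m P *m A
          - (invmx S *m (B^T *m P *m B) *m invmx Rc) *m B^T *m P)
        + invmx Rc *m B^T *m (P - p t)).
    rewrite /gain_ct opprK -/B mulmxDr mulmx1 -scalemxAr.
    set X := invmx S *m (B^T *m P *m B) *m invmx Rc in RS *.
    set Y := invmx S *m B^T *m P; set YA := Y *m A.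
    have YE : Y = invmx Rc *m B^T *m P - tau *: (X *m B^T *m P).
      have -> : Y = (invmx Rc - tau *: X) *m B^T *m P by rewrite -RS addrC subrK.
      by rewrite !mulmxBl -!scalemxAl.
    rewrite mulmxBr; move: YA YE => YA ->.
    move: (invmx Rc *m B^T *m P) (X *m B^T *m P) (invmx Rc *m B^T *m p t).
    by move=> x1 x2 x3; apply/matrixP => i' j'; rewrite !(mxeD, mxeN, mxeZ); ring.
  rewrite normrN; apply: (le_trans (ler_normD _ _)).
  rewrite normrZ (ger0_norm (ltW tau0)).
  have hlast := mx_norm_mulmx_le hRB hPp.
  rewrite mulrA in hlast.
  apply: le_trans (lerD _ hlast) _.
    by rewrite mulrC; apply: ler_wpM2r; [exact: ltW|bnd].
  by rewrite -mulrDl.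
Qed.

End Gains.

(** * Time integrals and the Gronwall inequality *)

Notation integ f s t := (\int[lebesgue_measure]_(x in `[s, t]) f x)%R.

Section BoundedMeasurable.
Context {R : realType}.
Variable T : R.
Hypothesis T0 : 0 < T.
Local Notation mu := (@lebesgue_measure R).
Implicit Types (f g : R -> R).

(** The class of integrands in play: continuous paths, bounded measurable
    gains, and their sums and products. *)
Definition bmeas f : Prop :=
  measurable_fun (`[0, T] : set R) f /\ exists c, forall t, 0 <= t <= T -> `|f t| <= c.

Lemma bmeas_cont f : {within `[0, T], continuous f} -> bmeas f.
Proof.
move=> fc; split.
  by apply: subspace_continuous_measurable_fun => //; exact: measurable_itv.
have [M [_ hM]] := compact_bounded (continuous_compact fc (@segment_compact R 0 T)).
exists (M + 1) => s hs'; apply: (hM (M + 1)); first by rewrite ltrDl.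
by exists s => //=; rewrite in_itv.
Qed.

Lemma bmeas_cst c : bmeas (fun=> c).
Proof. by split; [exact: measurable_cst|exists `|c|]. Qed.

Lemma bmeasD f g : bmeas f -> bmeas g -> bmeas (fun t => f t + g t).
Proof.
move=> [mf [a ha]] [mg [b hb]]; split; first exact: measurable_funD.
by exists (a + b) => t ht; rewrite (le_trans (ler_normD _ _))// lerD// ?ha ?hb.
Qed.

Lemma bmeasM f g : bmeas f -> bmeas g -> bmeas (fun t => f t * g t).
Proof.
move=> [mf [a ha]] [mg [b hb]]; split; first exact: measurable_funM.
by exists (a * b) => t ht; rewrite normrM ler_pM// ?ha ?hb.
Qed.

Lemma bmeasN f : bmeas f -> bmeas (fun t => - f t).
Proof.
move=> hf; have := bmeasM (bmeas_cst (-1)) hf.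
by congr bmeas; apply/funext => t; rewrite mulN1r.
Qed.

Lemma bmeas_norm f : bmeas f -> bmeas (fun t => `|f t|).
Proof.
move=> [mf [a ha]]; split; first exact: measurableT_comp.
by exists a => t ht; rewrite normr_id ha.
Qed.

Lemma bmeas_sum (J : Type) (r : seq J) (f : J -> R -> R) :
  (forall j, bmeas (f j)) -> bmeas (fun t => \sum_(j <- r) f j t).
Proof.
move=> hf; elim: r => [|j r IH].
  by under eq_fun do rewrite big_nil; exact: bmeas_cst.
by under eq_fun do rewrite big_cons; exact: bmeasD.
Qed.

Lemma bmeas_integrable f s t : bmeas f -> 0 <= s -> t <= T ->
  mu.-integrable (`[s, t] : set R) (EFin \o f).
Proof.
move=> [mf [c hc]] s0 tT.
have sub : `[s, t]%classic `<=` (`[0, T]%classic : set R).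
  by move=> x /=; rewrite !in_itv/= => /andP[h1 h2]; rewrite (le_trans s0)//= (le_trans h2).
apply: measurable_bounded_integrable.
- exact: measurable_itv.
- by rewrite /= lebesgue_measure_itv/=; case: ifP => // _; rewrite -EFinB ltry.
- by apply: measurable_funS sub mf; exact: measurable_itv.
- exists c; split; first exact: num_real.
  move=> M cM x /sub; rewrite /= in_itv/= => hx.
  by apply: (le_trans (hc _ hx)); exact: ltW.
Qed.

Lemma integD f g s t : bmeas f -> bmeas g -> 0 <= s -> t <= T ->
  integ (fun x => f x + g x) s t = integ f s t + integ g s t.
Proof.
by move=> hf hg s0 tT; apply: RintegralD; try exact: bmeas_integrable; exact: measurable_itv.
Qed.

Lemma integZ c f s t : bmeas f -> 0 <= s -> t <= T ->
  integ (fun x => c * f x) s t = c * integ f s t.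
Proof.
by move=> hf s0 tT; apply: RintegralZl; try exact: bmeas_integrable; exact: measurable_itv.
Qed.

Lemma le_integ f g s t : bmeas f -> bmeas g -> 0 <= s -> t <= T ->
  (forall x, s <= x <= t -> f x <= g x) -> integ f s t <= integ g s t.
Proof.
move=> hf hg s0 tT h; apply: le_Rintegral; try exact: bmeas_integrable.
  exact: measurable_itv.
by move=> x /=; rewrite in_itv/=; exact: h.
Qed.

Lemma norm_integ f s t : bmeas f -> 0 <= s -> t <= T ->
  `|integ f s t| <= integ (fun x => `|f x|) s t.
Proof.
move=> hf s0 tT; apply: le_normr_Rintegral; last exact: bmeas_integrable.
exact: measurable_itv.
Qed.

Lemma integ_cst (c s t : R) : s <= t -> integ (fun=> c) s t = c * (t - s).
Proof.
move=> st; rewrite Rintegral_cst; last exact: measurable_itv.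
rewrite /= lebesgue_measure_itv/= lte_fin; case: ltP => [_|ts].
  by rewrite -EFinB.
by rewrite (le_anti (_ : s <= t <= s)) ?st// subrr.
Qed.

Lemma integ_ge0 f s t : (forall x, s <= x <= t -> 0 <= f x) -> 0 <= integ f s t.
Proof. by move=> h; apply: Rintegral_ge0 => x /=; rewrite in_itv/=; exact: h. Qed.

Lemma integ_chasles f s t : bmeas f -> 0 <= s -> s <= t -> t <= T ->
  integ f 0 t = integ f 0 s + integ f s t.
Proof.
move=> hf s0 st tT.
have h := @Rintegral_itvB R f (BLeft 0) (BRight t) s (bmeas_integrable hf (lexx _) tT).
have {}h := h s0 st.
apply/eqP; rewrite addrC -subr_eq; apply/eqP; rewrite h.
apply: Rintegral_itv_obnd_cbnd.
apply: integrableS (bmeas_integrable hf s0 tT); try exact: measurable_itv.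
by apply: subset_itvr; rewrite bnd_simp.
Qed.

Lemma eq_integ f g s t : (forall x, s <= x <= t -> f x = g x) ->
  integ f s t = integ g s t.
Proof.
by move=> h; apply: eq_Rintegral => x; rewrite inE/= in_itv/=; exact: h.
Qed.

Lemma integ_expR (c t : R) : 0 < c -> 0 <= t ->
  integ (fun x => expR (c * x)) 0 t = (expR (c * t) - 1) / c.
Proof.
move=> c0; rewrite le_eqVlt => /predU1P[<-|t0].
  by rewrite set_itv1 Rintegral_set1 mulr0 expR0 subrr mul0r.
pose F (x : R^o) : R^o := c^-1 * expR (c * x).
have dF (x : R^o) : is_derive x 1 F (expR (c * x)).
  have h1 : is_derive x 1 (fun x : R^o => c * x : R^o) c.
    by have := is_deriveZ c (is_derive_id x (1 : R^o)); rewrite -[c *: 1]/(c * 1) mulr1.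
  have h2 := is_derive1_comp (is_derive_expR (c * x)) h1.
  have := is_deriveZ c^-1 h2; rewrite /F => h3; apply: (is_derive_eq h3).
  by rewrite -[LHS]/(c^-1 * (expR (c * x) * c)) mulrCA mulVf ?gt_eqF// mulr1.
have cF (x : R^o) : {for x, continuous F}.
  apply: differentiable_continuous; apply/derivable1_diffP.
  exact: (@ex_derive _ _ _ _ _ _ _ (dF x)).
have hc : {within `[0, t], continuous (fun x : R => expR (c * x))}.
  apply: continuous_subspaceT => x.
  apply: continuous_comp; last exact: continuous_expR.
  by apply: cvgM; [exact: cvg_cst|exact: cvg_id].
rewrite /Rintegral (@continuous_FTC2 R _ F _ _ t0 hc).
- by rewrite -EFinB /= /F mulr0 expR0 mulr1 mulrBl mul1r mulrC.
- split.
  + by move=> x _; exact: (@ex_derive _ _ _ _ _ _ _ (dF x)).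
  + by apply: cvg_at_right_filter; exact: cF.
  + by apply: cvg_at_left_filter; exact: cF.
- by move=> x _; rewrite derive1E; exact: (@derive_val _ _ _ _ _ _ _ (dF x)).
Qed.

(** Weighted supremum proof: if [M] bounds [exp (- 2 c t) g t], the hypothesis
    improves this bound to [a + U + M / 2], the integral of [c exp (2 c s)]
    being half an exponential. *)
Lemma gronwall (g u : R -> R) (a c : R) : 0 < c -> 0 <= a ->
  bmeas g -> bmeas u -> (forall t, 0 <= t <= T -> 0 <= u t) ->
  (forall t, 0 <= t <= T -> 0 <= g t) ->
  (forall t, 0 <= t <= T -> g t <= a + (c * integ g 0 t + integ u 0 t)) ->
  forall t, 0 <= t <= T -> g t <= 2 * expR (2 * c * T) * (a + integ u 0 T).
Proof.
move=> c0 a0 hg hu u0 g0 h t ht.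
have T00 : 0 <= T by exact: ltW.
set U := integ u 0 T.
have U0 : 0 <= U by exact: integ_ge0.
have uU s : 0 <= s <= T -> integ u 0 s <= U.
  move=> /andP[s0 sT]; rewrite /U (integ_chasles hu s0 sT (lexx _)) lerDl.
  by apply: integ_ge0 => x /andP[sx xT]; rewrite u0// xT (le_trans s0).
pose w s := expR (- (2 * c * s)) * g s.
pose S := [set w s | s in [set s | 0 <= s <= T]].
have w0 : S (w 0) by exists 0 => //=; rewrite lexx.
have hS : has_ubound S.
  case: hg => _ [B hB]; exists B => _ [s /= hs <-].
  have /andP[s0 _] := hs.
  have e1 : expR (- (2 * c * s)) <= 1.
    by rewrite -expR0 ler_expR oppr_le0 !mulr_ge0// ltW.
  rewrite /w; apply: (@le_trans _ _ (1 * g s)).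
    by rewrite ler_wpM2r// g0.
  by rewrite mul1r (le_trans (ler_norm _))// hB.
pose M := sup S.
have hM s : 0 <= s <= T -> g s <= M * expR (2 * c * s).
  move=> hs; have : w s <= M by apply: ub_le_sup => //; exists s.
  by rewrite /w expRN -ler_pdivlMl ?invr_gt0 ?expR_gt0// invrK mulrC.
have key s : 0 <= s <= T -> w s <= (a + U) + M / 2.
  move=> hs; have /andP[s0 sT] := hs.
  have c20 : 0 < 2 * c by rewrite mulr_gt0.
  have bE : bmeas (fun x => expR (2 * c * x)).
    apply: bmeas_cont; apply: continuous_subspaceT => x.
    apply: continuous_comp; last exact: continuous_expR.
    by apply: cvgM; [exact: cvg_cst|exact: cvg_id].
  have M0 : 0 <= M.
    apply: (@le_trans _ _ (w 0)); last by apply: ub_le_sup.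
    by rewrite /w mulr_ge0 ?expR_ge0// g0// lexx.
  have i1 : integ g 0 s <= M * ((expR (2 * c * s) - 1) / (2 * c)).
    rewrite -integ_expR// -(integZ _ bE (lexx _) sT).
    apply: le_integ => //; first exact: bmeasM (bmeas_cst _) bE.
    by move=> x /andP[x0 xs]; rewrite hM// x0 (le_trans xs).
  have i2 : c * integ g 0 s <= M / 2 * expR (2 * c * s).
    apply: (@le_trans _ _ (c * (M * ((expR (2 * c * s) - 1) / (2 * c))))).
      by rewrite ler_wpM2l// ltW.
    rewrite [leLHS](_ : _ = M / 2 * (expR (2 * c * s) - 1)).
      by rewrite ler_wpM2l ?divr_ge0// gerDl oppr_le0.
    by field; rewrite gt_eqF.
  have e1 : expR (- (2 * c * s)) <= 1.
    by rewrite -expR0 ler_expR oppr_le0 !mulr_ge0// ltW.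
  have e2 : expR (- (2 * c * s)) * expR (2 * c * s) = 1.
    by rewrite -expRD addNr expR0.
  have := h s hs; have := uU s hs; rewrite /w => h1 h2.
  have h3 : g s <= a + U + M / 2 * expR (2 * c * s) by lra.
  apply: (@le_trans _ _ (expR (- (2 * c * s)) * (a + U + M / 2 * expR (2 * c * s)))).
    by rewrite ler_wpM2l ?expR_ge0.
  rewrite mulrDr [X in _ + X]mulrCA e2 mulr1 lerD2r.
  by rewrite ler_piMl// addr_ge0.
have M2 : M <= 2 * (a + U).
  have : M <= (a + U) + M / 2.
    by apply: ge_sup; [exists (w 0)|move=> _ [s hs <-]; exact: key].
  lra.
apply: (le_trans (hM t ht)).
have /andP[t0 tT] := ht.
apply: (@le_trans _ _ (expR (2 * c * t) * (2 * (a + U)))).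
  by rewrite [leLHS]mulrC ler_wpM2l ?expR_ge0.
rewrite [leRHS](_ : _ = expR (2 * c * T) * (2 * (a + U))); last by ring.
apply: ler_wpM2r; first by rewrite mulr_ge0 ?addr_ge0.
by rewrite ler_expR ler_wpM2l// ltW// mulr_gt0.
Qed.

End BoundedMeasurable.

(** * Pathwise estimates of the controlled state *)

Section Paths.
Context {R : realType} {n d : nat}.
Variables (T : R) (A : 'M[R]_n) (B : 'M[R]_(n, d)) (x0 : 'cV[R]_n) (k : R).
Hypotheses (T0 : 0 < T) (k0 : 0 <= k).
Implicit Types (K : R -> 'M[R]_(d, n)) (W X : R -> 'cV[R]_n).

Definition drift K X (s : R) : 'cV[R]_n := A *m X s + B *m (K s *m X s).

Definition path_sol K W X : Prop :=
  [/\ {within `[0, T], continuous X}, {within `[0, T], continuous W} &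
    forall t, 0 <= t <= T -> X t = x0 + mx_integral `[0, t] (drift K X) + W t].

Definition admissible K : Prop :=
  (forall i j, measurable_fun (`[0, T] : set R) (fun s => K s i j)) /\
  forall s, 0 <= s <= T -> `|K s| <= k.

(** [1 + int_0^T |W|^2], the only functional of the whole Brownian path that
    the estimates involve. *)
Definition energy W : R := 1 + integ (fun s => sqnorm (W s)) 0 T.

Definition drift_const : R := n%:R * `|A| + d%:R * `|B| * (n%:R * k).

Lemma drift_const_ge0 : 0 <= drift_const.
Proof. by rewrite addr_ge0 ?mulr_ge0. Qed.

Lemma drift_le K X s : 0 <= s <= T -> admissible K ->
  `|drift K X s| <= drift_const * `|X s|.
Proof.
move=> hs [_ hK]; have hKs := hK s hs; have hX : `|X s| <= `|X s| by [].
rewrite /drift /drift_const mulrDl; apply: bndD; first exact: mx_norm_mulmx.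
by rewrite -[leRHS]mulrA -[n%:R * k * _]mulrA; have := mx_norm_mulmx_le (lexx `|B|)
  (mx_norm_mulmx_le hKs hX); rewrite !mulrA.
Qed.

Lemma cont_entry m (X : R -> 'cV[R]_m) i : {within `[0, T], continuous X} ->
  {within `[0, T], continuous (fun t => X t i 0)}.
Proof.
move=> Xc x; apply: (@cvg_comp _ _ _ X (fun M => M i 0) _ _ _ (Xc x)).
exact: coord_continuous.
Qed.

Lemma bmeas_entry m (X : R -> 'cV[R]_m) i : {within `[0, T], continuous X} ->
  bmeas T (fun t => X t i 0).
Proof. by move=> Xc; apply: bmeas_cont; exact: cont_entry. Qed.

Lemma bmeas_mxnorm m (X : R -> 'cV[R]_m) : {within `[0, T], continuous X} ->
  bmeas T (fun t => `|X t|).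
Proof.
move=> Xc; apply: bmeas_cont => x.
by apply: (@cvg_comp _ _ _ X (fun M => `|M|) _ _ _ (Xc x)); exact: norm_continuous.
Qed.

Lemma bmeas_sqnorm m (X : R -> 'cV[R]_m) : {within `[0, T], continuous X} ->
  bmeas T (fun t => sqnorm (X t)).
Proof.
move=> Xc; apply: bmeas_sum => i.
by under eq_fun do rewrite expr2; apply: bmeasM; exact: bmeas_entry.
Qed.

Lemma bmeas_gain K i j : admissible K -> bmeas T (fun s => K s i j).
Proof.
move=> [mK hK]; split=> //; exists k => t ht.
by rewrite (le_trans (mx_norm_entry _ _ _))// hK.
Qed.

Lemma bmeas_drift K X i : {within `[0, T], continuous X} -> admissible K ->
  bmeas T (fun s => drift K X s i 0).
Proof.
move=> Xc hK.
have -> : (fun s => drift K X s i 0) = (fun s => \sum_j A i j * X s j 0 +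
    \sum_j B i j * \sum_l K s j l * X s l 0).
  apply/funext => s; rewrite /drift mxeD !mxE; congr (_ + _).
  by apply: eq_bigr => j _; rewrite mxE.
apply: bmeasD; apply: bmeas_sum => j; apply: bmeasM (bmeas_cst _ _) _.
  exact: bmeas_entry.
apply: bmeas_sum => l; apply: bmeasM; [exact: bmeas_gain|exact: bmeas_entry].
Qed.

Lemma path_sol_entry K W X t i : path_sol K W X -> 0 <= t <= T ->
  X t i 0 - W t i 0 = x0 i 0 + integ (fun s => drift K X s i 0) 0 t.
Proof. by move=> [_ _ h] ht; rewrite h// !mxE addrK. Qed.

Lemma sqr_mxnorm m (v : 'cV[R]_m) : `|v| ^+ 2 <= sqnorm v.
Proof.
have h : `|v| <= Num.sqrt (sqnorm v).
  apply: ler_mx_normP => [|i j]; first exact: sqrtr_ge0.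
  by rewrite ord1 -sqrtr_sqr ler_wsqrtr// sqr_entry_le_sqnorm.
rewrite -[leRHS]sqr_sqrtr ?sqnorm_ge0// lerXn2r// nnegrE//; exact: sqrtr_ge0.
Qed.

Lemma energy_ge1 W : 1 <= energy W.
Proof. by rewrite lerDl integ_ge0// => s _; exact: sqnorm_ge0. Qed.

Lemma sqrt_energy W :
  [/\ 1 <= Num.sqrt (energy W), Num.sqrt (energy W) ^+ 2 = energy W &
      forall s, `|W s| <= (Num.sqrt (energy W) + sqnorm (W s) / Num.sqrt (energy W)) / 2].
Proof.
have h1 := energy_ge1 W.
have g1 : 1 <= Num.sqrt (energy W) by rewrite -sqrtr1 ler_wsqrtr.
have g2 : Num.sqrt (energy W) ^+ 2 = energy W.
  by rewrite sqr_sqrtr// (le_trans _ h1).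
split=> // s; set g := Num.sqrt _ in g1 *.
have g0 : 0 < g by rewrite (lt_le_trans _ g1).
have := sqr_mxnorm (W s) => h; rewrite ler_pdivlMr//.
have -> : g + sqnorm (W s) / g = (g ^+ 2 + sqnorm (W s)) / g.
  by rewrite expr2 mulrDl mulfK// gt_eqF.
rewrite ler_pdivlMr//; have := sqr_ge0 (g - `|W s|); nra.
Qed.

Lemma integ_norm_noise W : {within `[0, T], continuous W} ->
  integ (fun s => `|W s|) 0 T <= (T + 1) * Num.sqrt (energy W).
Proof.
move=> Wc; have [g1 g2 hg] := sqrt_energy W; set g := Num.sqrt _ in g1 g2 hg *.
have g0 : 0 < g by rewrite (lt_le_trans _ g1).
have bS := bmeas_sqnorm Wc.
have bG := bmeasM (bmeas_cst T (2^-1 / g)) bS.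
apply: (@le_trans _ _ (integ (fun s => g / 2 + 2^-1 / g * sqnorm (W s)) 0 T)).
  apply: (le_integ (bmeas_mxnorm Wc) (bmeasD (bmeas_cst T (g / 2)) bG)) => //.
  move=> s _; apply: (le_trans (hg s)); rewrite le_eqVlt; apply/orP; left.
  by apply/eqP; field; rewrite gt_eqF.
have T00 : 0 <= T := ltW T0; have z0 : (0 : R) <= 0 by [].
rewrite (integD (bmeas_cst T (g / 2)) bG)// integ_cst// (integZ _ bS)// subr0.
have : integ (fun s => sqnorm (W s)) 0 T <= g ^+ 2.
  by rewrite g2 /energy lerDr.
move=> h; have h' : 2^-1 / g * integ (fun s => sqnorm (W s)) 0 T <= 2^-1 * g.
  apply: (@le_trans _ _ (2^-1 / g * g ^+ 2)); first by rewrite ler_wpM2l// divr_ge0// ltW.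
  by rewrite expr2 mulrA mulfVK ?gt_eqF.
nra.
Qed.

(** The difference [X - W] satisfies a linear integral inequality forced by [|W|],
    to which the Gronwall inequality applies. *)
Lemma path_bound : exists2 C, 0 <= C & forall K W X,
  admissible K -> path_sol K W X -> forall t, 0 <= t <= T ->
  `|X t - W t| <= C * Num.sqrt (energy W).
Proof.
set l := drift_const; pose c := l + 1.
have l0 : 0 <= l by exact: drift_const_ge0.
have c0 : 0 < c by rewrite ltr_wpDl.
exists (2 * expR (2 * c * T) * (`|x0| + c * (T + 1))).
  have TT := ltW T0; have cc := ltW c0.
  by rewrite !(mulr_ge0, addr_ge0, expR_ge0).
move=> K W X hK hs t ht; have [Xc Wc _] := hs.
have [g1 _ _] := sqrt_energy W; set g := Num.sqrt _ in g1 *.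
have Dc : {within `[0, T], continuous (fun t => X t - W t)}.
  by move=> x; apply: cvgB; [exact: Xc|exact: Wc].
have bD := bmeas_mxnorm Dc; have bW := bmeas_mxnorm Wc; have bX := bmeas_mxnorm Xc.
have bcW := bmeasM (bmeas_cst T c) bW.
have h := @gronwall R T T0 (fun t => `|X t - W t|) (fun t => c * `|W t|) `|x0| c c0
  (normr_ge0 _) bD bcW _ _ _ t ht.
apply: le_trans (h _ _ _) _ => //.
- by move=> s _; rewrite mulr_ge0// ltW.
- move=> s hs'; have /andP[s0 sT] := hs'.
  have T0' : (0 : R) <= 0 by [].
  rewrite -(integZ _ bD)// -(integD (bmeasM (bmeas_cst T c) bD) bcW)//.
  apply: ler_mx_normP => [|i j].
    rewrite addr_ge0// integ_ge0// => x _; rewrite addr_ge0 ?mulr_ge0//; exact: ltW.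
  rewrite ord1 mxeD mxeN (path_sol_entry i hs hs').
  apply: (le_trans (ler_normD _ _)); apply: lerD; first exact: mx_norm_entry.
  have bdr := bmeas_drift i Xc hK.
  apply: (le_trans (norm_integ bdr T0' sT)).
  apply: (le_integ (bmeas_norm bdr) (bmeasD (bmeasM (bmeas_cst T c) bD) bcW)) => //.
  move=> x /andP[x0' xs]; have hx : 0 <= x <= T by rewrite x0' (le_trans xs).
  apply: (le_trans (mx_norm_entry _ _ _)); apply: (le_trans (drift_le _ hx hK)).
  have hXx : `|X x| <= `|X x - W x| + `|W x|.
    by rewrite -{1}[X x](subrK (W x)) ler_normD.
  rewrite -mulrDr; apply: ler_pM => //; rewrite /c lerDl//.
- have := integ_norm_noise Wc; rewrite -/g => hI.
  rewrite (integZ _ bW)//.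
  rewrite -[leRHS]mulrA; apply: ler_wpM2l; first by rewrite mulr_ge0 ?expR_ge0.
  rewrite [leRHS]mulrDl; apply: lerD; first by rewrite ler_peMr.
  by rewrite -mulrA ler_wpM2l// ltW.
Qed.

(** The drift part is Lipschitz up to the noise, in the form in which it gets
    multiplied by a factor [x] and summed over a grid. *)
Lemma path_increment : exists2 C, 0 <= C & forall K W X,
  admissible K -> path_sol K W X -> forall x s t, 0 <= x -> 0 <= s -> s <= t -> t <= T ->
  x * `|(X t - W t) - (X s - W s)| <=
    C * ((t - s) * (energy W + x ^+ 2) + integ (fun r => sqnorm (W r)) s t).
Proof.
have [C C0 hC] := path_bound; set l := drift_const.
have l0 : 0 <= l by exact: drift_const_ge0.
exists (l * (C + 1)); first by rewrite mulr_ge0// addr_ge0.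
move=> K W X hK hs x s t x0' s0 st tT; have [Xc Wc _] := hs.
have [g1 g2 _] := sqrt_energy W; set g := Num.sqrt _ in g1 g2 *.
have bW := bmeas_mxnorm Wc; have bX := bmeas_mxnorm Xc; have bS := bmeas_sqnorm Wc.
have hinc : `|(X t - W t) - (X s - W s)| <= integ (fun r => l * `|X r|) s t.
  apply: ler_mx_normP => [|i j].
    by rewrite integ_ge0// => r _; rewrite mulr_ge0.
  have bdr := bmeas_drift i Xc hK.
  have ht : 0 <= t <= T by rewrite tT (le_trans s0).
  have hs' : 0 <= s <= T by rewrite s0 (le_trans st).
  rewrite ord1 !(mxeD, mxeN) (path_sol_entry i hs ht) (path_sol_entry i hs hs').
  rewrite (integ_chasles bdr s0 st tT).
  rewrite [X in `|X|](_ : _ = integ (fun r => drift K X r i 0) s t); last by ring.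
  apply: (le_trans (norm_integ bdr s0 tT)).
  apply: (le_integ (bmeas_norm bdr) (bmeasM (bmeas_cst T l) bX)) => //.
  - move=> r /andP[sr rt]; apply: (le_trans (mx_norm_entry _ _ _)).
    by apply: drift_le hK; rewrite (le_trans s0)//= (le_trans rt).
apply: (@le_trans _ _ (x * integ (fun r => l * `|X r|) s t)).
  by rewrite ler_wpM2l.
have bS' : bmeas T (fun r => energy W + x ^+ 2 + sqnorm (W r)).
  by apply: bmeasD bS; exact: bmeas_cst.
have bS'' : bmeas T (fun r => l * (C + 1) * (energy W + x ^+ 2 + sqnorm (W r))).
  exact: bmeasM (bmeas_cst _ _) bS'.
have blX := bmeasM (bmeas_cst T l) bX.
rewrite -(integZ _ blX)//.
apply: (@le_trans _ _ (integ (fun r => l * (C + 1) * (energy W + x ^+ 2 + sqnorm (W r))) s t)).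
  apply: (le_integ (bmeasM (bmeas_cst T x) blX) bS'') => //.
  move=> r /andP[sr rt].
  have hr : 0 <= r <= T by rewrite (le_trans s0)//= (le_trans rt).
  have hXr : `|X r| <= C * g + `|W r|.
    rewrite -{1}[X r](subrK (W r)) (le_trans (ler_normD _ _))// lerD2r.
    exact: hC hK hs _ hr.
  rewrite mulrCA -mulrA ler_wpM2l//.
  apply: (@le_trans _ _ (x * (C * g + `|W r|))); first by rewrite ler_wpM2l.
  have h1 : x * g <= (x ^+ 2 + g ^+ 2) / 2 by have := sqr_ge0 (x - g); nra.
  have h2 : x * `|W r| <= (x ^+ 2 + sqnorm (W r)) / 2.
    by have := sqr_ge0 (x - `|W r|); have := sqr_mxnorm (W r); nra.
  have h3 := sqnorm_ge0 (W r); have h4 := sqr_ge0 x; have h5 := sqr_ge0 g.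
  rewrite -g2; have h6 : C * (x * g) <= C * (x ^+ 2 + g ^+ 2 + sqnorm (W r)).
    rewrite ler_wpM2l//; lra.
  rewrite mulrDr mulrCA mulrDl mul1r; apply: lerD => //; lra.
rewrite (integZ _ bS')// (integD (bmeas_cst T (energy W + x ^+ 2)) bS)// integ_cst//.
by rewrite [_ * (t - s)]mulrC.
Qed.

(** Both states are driven by the same noise, which cancels in the difference;
    the forcing left is [(K - K') X']. *)
Lemma path_diff : exists2 C, 0 <= C & forall K K' W X X' eps,
  admissible K -> admissible K' -> path_sol K W X -> path_sol K' W X' ->
  0 <= eps -> (forall s, 0 <= s <= T -> `|K s - K' s| <= eps) ->
  forall t, 0 <= t <= T -> `|X t - X' t| <= C * eps * Num.sqrt (energy W).
Proof.
have [C C0 hC] := path_bound; set l := drift_const; pose c := l + 1.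
have l0 : 0 <= l by exact: drift_const_ge0.
have c0 : 0 < c by rewrite ltr_wpDl.
pose b := d%:R * `|B| * n%:R; have b0 : 0 <= b by rewrite !mulr_ge0.
exists (2 * expR (2 * c * T) * (b * (C * T + (T + 1)))).
  have TT := ltW T0; have cc := ltW c0.
  by rewrite !(mulr_ge0, addr_ge0, expR_ge0).
move=> K K' W X X' eps hK hK' hs hs' e0 hKK t ht.
have [Xc Wc _] := hs; have [Xc' _ _] := hs'.
have [g1 _ _] := sqrt_energy W; set g := Num.sqrt _ in g1 *.
have Ec : {within `[0, T], continuous (fun t => X t - X' t)}.
  by move=> x; apply: cvgB; [exact: Xc|exact: Xc'].
have bE := bmeas_mxnorm Ec; have bX' := bmeas_mxnorm Xc'; have bW := bmeas_mxnorm Wc.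
pose u s := b * eps * `|X' s|.
have bu : bmeas T u by exact: bmeasM (bmeas_cst _ _) bX'.
have TT := ltW T0.
have h := @gronwall R T T0 (fun t => `|X t - X' t|) u 0 c c0
  (lexx _) bE bu _ _ _ t ht.
apply: le_trans (h _ _ _) _; rewrite ?lexx//.
- by move=> s _; rewrite /u !mulr_ge0.
- move=> s /andP[s0 sT].
  have T0' : (0 : R) <= 0 by [].
  have bcE := bmeasM (bmeas_cst T c) bE.
  rewrite add0r -(integZ _ bE)// -(integD bcE bu)//.
  apply: ler_mx_normP => [|i j].
    rewrite integ_ge0// => x _; rewrite addr_ge0 ?mulr_ge0//; exact: ltW.
  have hsT : 0 <= s <= T by rewrite s0.
  have bdr := bmeas_drift i Xc hK; have bdr' := bmeas_drift i Xc' hK'.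
  have bdd := bmeasD bdr (bmeasN bdr').
  have -> : (X s - X' s) i j = integ (fun s => drift K X s i 0 - drift K' X' s i 0) 0 s.
    rewrite ord1 !(mxeD, mxeN) (integD bdr (bmeasN bdr'))//.
    have -> : integ (fun x => - drift K' X' x i 0) 0 s =
        - integ (fun x => drift K' X' x i 0) 0 s.
      rewrite -[RHS]mulN1r -(integZ _ bdr')//.
      by apply: eq_integ => x _; rewrite mulN1r.
    have := path_sol_entry i hs hsT; have := path_sol_entry i hs' hsT; lra.
  apply: (le_trans (norm_integ bdd T0' sT)).
  apply: (le_integ (bmeas_norm bdd) (bmeasD bcE bu)) => //.
  move=> x /andP[x0' xs]; have hx : 0 <= x <= T by rewrite x0' (le_trans xs).
  have hKx := hKK x hx; have hX'x : `|X' x| <= `|X' x| by [].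
  have -> : drift K X x i 0 - drift K' X' x i 0 =
     (drift K (fun s => X s - X' s) x + B *m ((K x - K' x) *m X' x)) i 0.
    rewrite -mxeN -mxeD; congr (fun_of_matrix _ _ _).
    rewrite /drift !(mulmxBl, mulmxBr).
    by apply/matrixP => i' j'; rewrite !(mxeD, mxeN); ring.
  apply: (le_trans (mx_norm_entry _ _ _)); apply: bndD.
    apply: (le_trans (drift_le (fun s => X s - X' s) hx hK)).
    by rewrite ler_wpM2r// lerDl.
  have := mx_norm_mulmx_le (lexx `|B|) (mx_norm_mulmx_le hKx hX'x).
  by rewrite /u /b !mulrA.
- have T0' : (0 : R) <= 0 by [].
  rewrite add0r /u (integZ _ bX')//.
  have hI : integ (fun s => `|X' s|) 0 T <= (C * T + (T + 1)) * g.
    have bS := bmeasD (bmeas_cst T (C * g)) bW.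
    apply: (@le_trans _ _ (integ (fun s => C * g + `|W s|) 0 T)).
      apply: (le_integ bX' bS) => // s hsT.
      rewrite -{1}[X' s](subrK (W s)) (le_trans (ler_normD _ _))// lerD2r.
      exact: (hC _ _ _ hK' hs' s).
    rewrite (integD (bmeas_cst T (C * g)) bW)// integ_cst// subr0 mulrDl; apply: lerD.
      by rewrite mulrAC.
    exact: integ_norm_noise.
  apply: (@le_trans _ _ (2 * expR (2 * c * T) * (b * eps * ((C * T + (T + 1)) * g)))).
    by apply: ler_wpM2l; rewrite ?mulr_ge0 ?expR_ge0// ler_wpM2l// mulr_ge0.
  by rewrite le_eqVlt; apply/orP; left; apply/eqP; ring.
Qed.

End Paths.

(** * Independence of the past *)

Section MeasurableFunctions.

(** Packs a measurable map, to make it the argument of [distribution]. *)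
Definition mfun_of d1 d2 (T1 : measurableType d1) (T2 : measurableType d2)
  (f : T1 -> T2) (mf : measurable_fun setT f) : {mfun T1 >-> T2} :=
  HB.pack f (isMeasurableFun.Build _ _ _ _ f mf).

End MeasurableFunctions.

Section Independence.
Context {R : realType} {dOm : measure_display} {Om : measurableType dOm}.
Variable P : probability Om R.
Context {I : finType} {U : Type}.
Variables (S : set (set U)) (X : I -> Om -> U).
Hypotheses (hX : independent P S X) (ST : S setT) (SI : setI_closed S).
Hypothesis mX : forall i C, S C -> measurable (X i @^-1` C).

Definition past (J : {set I}) : set (set Om) :=
  [set E | exists C : I -> set U, (forall i, S (C i)) /\
    E = \bigcap_(i in [set` J]) (X i @^-1` C i)].

Lemma past_measurable J : past J `<=` measurable.
Proof.
move=> _ [C [SC ->]]; apply: fin_bigcap_measurable => // i _; exact: mX.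
Qed.

Lemma past_gen_measurable J E : <<s past J >> E -> measurable E.
Proof. exact: (smallest_sub (@sigma_algebra_measurable _ Om) (@past_measurable J)). Qed.

Lemma past_setI J : setI_closed (past J).
Proof.
move=> _ _ [C [SC ->]] [D [SD ->]]; exists (fun i => C i `&` D i); split.
  by move=> i; exact: SI.
by rewrite -bigcapI; apply: eq_bigcapr => i _; rewrite preimage_setI.
Qed.

Lemma past_setT J : past J setT.
Proof.
exists (fun=> setT); split=> //; rewrite eqEsubset; split=> // w _ i _; exact: I.
Qed.

Lemma past_coord (J : {set I}) j C : j \in J -> S C -> past J (X j @^-1` C).
Proof.
move=> jJ SC; exists (fun i => if i == j then C else setT); split.
  by move=> i; case: ifP.
rewrite eqEsubset; split=> [w hw i _|w /(_ j jJ)/=]; last by rewrite eqxx.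
by rewrite /preimage/=; case: ifPn => // /eqP ->.
Qed.

(** Independence is assumed on finite intersections of coordinate events; these
    are stable under intersection, so two finite measures that agree on them agree
    on the generated sigma-algebra. *)
Lemma past_indep (J : {set I}) j C E : j \notin J -> S C -> <<s past J >> E ->
  P (E `&` (X j @^-1` C)) = (P E * P (X j @^-1` C))%E.
Proof.
move=> jJ SC hE; set D := X j @^-1` C.
have mD : measurable D by exact: mX.
have PD : (P D = (fine (P D))%:E) by rewrite fineK// fin_num_measure.
have pD : 0 <= fine (P D) by rewrite fine_ge0.
pose m1 := mrestr P mD.
pose m2 := mscale (NngNum pD) P.
have m1E F : m1 F = P (F `&` D) by [].
have m2E F : m2 F = (P D * P F)%E by rewrite PD.
suff : m1 E = m2 E by rewrite m1E m2E muleC.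
apply: (g_sigma_algebra_measure_unique (past J) _ (fun=> setT)) hE => //.
- exact: past_measurable.
- by move=> _; exact: past_setT.
- by rewrite bigcup_const.
- exact: past_setI.
- move=> _ [B [SB ->]]; apply: (etrans (m1E _)); apply: (etrans _ (esym (m2E _))).
  have hJ := hX (J := J) (C := B) (fun i _ => SB i).
  pose B' i := if i == j then C else B i.
  have SB' i : i \in j |: J -> S (B' i) by rewrite /B'; case: ifP.
  have := hX SB'.
  have jB' : B' j = C by rewrite /B' eqxx.
  have iB' i : i \in J -> B' i = B i.
    by rewrite /B'; case: eqP => // -> h; rewrite h in jJ.
  rewrite big_setU1//= jB' (eq_bigr (fun i => P (X i @^-1` B i))); last first.
    by move=> i /iB' ->.
  rewrite -hJ => <-; congr (P _).
  rewrite eqEsubset; split=> [w [hw Dw] i|w hw].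
    by rewrite /= in_setU1 => /orP[/eqP ->|iJ]; [rewrite jB'|rewrite iB'//; exact: hw].
  split=> [i iJ|].
    by rewrite -iB'//; apply: hw; rewrite /= in_setU1; apply/orP; right.
  by rewrite /D -jB'; apply: hw; rewrite /= in_setU1 eqxx.
- move=> _; apply: le_lt_trans (ltry 1).
  exact: (probability_le1 P (measurableI _ _ measurableT mD)).
Qed.

(** By [past_indep] the past and the fresh variable have a product law on
    rectangles, hence everywhere, and Fubini's theorem applies to it. *)
Lemma past_fubini (J : {set I}) j (psi : U -> R) (mY : measurable_fun setT (psi \o X j))
  (f : g_sigma_algebraType (past J) * R -> \bar R) : j \notin J ->
  (forall B, measurable B -> S (psi @^-1` B)) ->
  measurable_fun setT f -> (forall z, (0 <= f z)%E) ->
  (\int[P]_w f (w, psi (X j w)) =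
   \int[P]_w \int[distribution P (mfun_of mY)]_y f (w, y))%E.
Proof.
move=> jJ hpsi mf f0.
pose T' := g_sigma_algebraType (past J).
have mid : measurable_fun setT (idfun : Om -> T').
  by move=> _ B mB; rewrite setTI; exact: (past_gen_measurable mB).
have mpair : measurable_fun setT (fun w : Om => ((w : T'), psi (X j w))).
  exact: measurable_fun_pair.
pose m1 := distribution P (mfun_of mid).
pose m2 := distribution P (mfun_of mY).
pose m := distribution P (mfun_of mpair).
have mE (A : set T') (B : set R) : measurable A -> measurable B ->
    m (A `*` B) = (m1 A * m2 B)%E.
  move=> mA mB; rewrite /m /m1 /m2 /distribution /pushforward /=.
  by rewrite -(past_indep jJ (hpsi B mB))//; congr (P _).
have mu := product_measure_unique mE.
transitivity (\int[m]_z f z)%E.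
  by rewrite /m ge0_integral_distribution.
transitivity (\int[(m1 \x m2)%E]_z f z)%E.
  by apply: eq_measure_integral => B mB _; exact/esym/mu.
rewrite fubini_tonelli1//.
have mF : measurable_fun setT (fubini_F m2 f) by exact: measurable_fun_fubini_tonelli_F.
by rewrite /m1 ge0_integral_distribution// => w; exact: integral_ge0.
Qed.

Lemma past_measurable_fun (J : {set I}) j (psi : U -> R) : j \in J ->
  (forall B, measurable B -> S (psi @^-1` B)) ->
  measurable_fun setT (psi \o X j : g_sigma_algebraType (past J) -> R).
Proof.
move=> jJ hpsi _ B mB; rewrite setTI.
by apply: sub_sigma_algebra; apply: past_coord jJ (hpsi B mB).
Qed.

End Independence.

(** * Exponential moments and the Chernoff bound *)

Section ExpectationTools.
Context {R : realType} {dOm : measure_display} {Om : measurableType dOm}.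
Variable P : probability Om R.

Lemma measurable_expR_comp (Y : Om -> R) (l : R) : measurable_fun setT Y ->
  measurable_fun setT (fun w => expR (l * Y w)).
Proof.
move=> mY; apply: measurableT_comp => //.
by apply: measurable_funM => //; exact: measurable_cst.
Qed.

Lemma ge0_le_int (f g : Om -> R) : measurable_fun setT f -> measurable_fun setT g ->
  (forall w, 0 <= f w) -> (forall w, f w <= g w) ->
  (\int[P]_w (f w)%:E <= \int[P]_w (g w)%:E)%E.
Proof.
move=> mf mg f0 fg; apply: ge0_le_integral => //.
- by move=> w _; rewrite lee_fin.
- exact/measurable_EFinP.
- exact/measurable_EFinP.
- by move=> w _; rewrite lee_fin.
Qed.

(** The copies are only known to agree in law with the original variable, and may
    live on another probability space. *)
Lemma eq_law_integral dO' (O' : measurableType dO') (P' : probability O' R)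
  (Y : Om -> R) (Y' : O' -> R) (g : R -> \bar R) :
  measurable_fun setT Y -> measurable_fun setT Y' ->
  (forall B, measurable B -> P' (Y' @^-1` B) = P (Y @^-1` B)) ->
  measurable_fun setT g -> (forall y, (0 <= g y)%E) ->
  (\int[P']_w g (Y' w) = \int[P]_w g (Y w))%E.
Proof.
move=> mY mY' h mg g0.
transitivity (\int[distribution P (mfun_of mY)]_y g y)%E; last first.
  by rewrite ge0_integral_distribution.
transitivity (\int[distribution P' (mfun_of mY')]_y g y)%E.
  by rewrite ge0_integral_distribution.
by apply: eq_measure_integral => B mB _; exact: h.
Qed.

Lemma expR_quadratic_bound (x : R) : expR x <= 1 + x + x ^+ 2 * expR `|x|.
Proof.
have [x0|x0] := leP 0 x.
  rewrite ger0_norm//.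
  have h1 : expR x - 1 <= x * expR x.
    have := expR_ge1Dx (- x); rewrite expRN => h.
    have e0 := expR_gt0 x.
    have : (1 - x) * expR x <= 1 by rewrite -ler_pdivlMr// div1r.
    lra.
  have h2 : x * (expR x - 1) <= x * (x * expR x) by rewrite ler_wpM2l.
  by rewrite expr2 -mulrA; lra.
rewrite ltr0_norm//; set u := - x; have u0 : 0 < u by rewrite oppr_gt0.
have -> : x = - u by rewrite opprK.
rewrite sqrrN expRN; set E := expR u.
have E1 : 1 + u <= E := expR_ge1Dx u.
have E0 : 0 < E by rewrite expR_gt0.
have i1 : E^-1 * E = 1 by rewrite mulVf// gt_eqF.
have i0 : 0 < E^-1 by rewrite invr_gt0.
have h1 : u * E^-1 <= 1 - E^-1 by nra.
have h3 : E^-1 - 1 + u <= u * (1 - E^-1) by lra.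
have h4 : 1 - E^-1 <= u.
  have := expR_ge1Dx (- u); rewrite expRN -/E; lra.
have h5 : u * (1 - E^-1) <= u * u by rewrite ler_wpM2l// ltW.
have h6 : u ^+ 2 <= u ^+ 2 * E by rewrite ler_peMr ?sqr_ge0//; lra.
rewrite expr2 in h6 *; lra.
Qed.

Lemma sqr_le_expR (x : R) : 0 <= x -> x ^+ 2 <= 4 * expR x.
Proof.
move=> x0; have := expR_ge1Dx (x / 2) => h.
have -> : expR x = expR (x / 2) ^+ 2 by rewrite expr2 -expRD -splitr.
have : (1 + x / 2) ^+ 2 <= expR (x / 2) ^+ 2 by rewrite lerXn2r ?nnegrE ?expR_ge0// addr_ge0// divr_ge0.
nra.
Qed.

(** Both factors of the quadratic error term are absorbed by half of the
    available exponential moment. *)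
Lemma expR_moment_bound (l l0 y : R) : 0 < l0 -> `|l| <= l0 / 2 ->
  expR (l * y) <= 1 + l * y + 16 * (l / l0) ^+ 2 * expR (l0 * `|y|).
Proof.
move=> l00 hl; apply: (le_trans (expR_quadratic_bound _)); rewrite lerD2l.
have e : expR (l0 * `|y|) = expR (l0 / 2 * `|y|) * expR (l0 / 2 * `|y|).
  by rewrite -expRD -mulrDl -splitr.
have h1 : expR `|l * y| <= expR (l0 / 2 * `|y|).
  by rewrite ler_expR normrM ler_wpM2r.
have u0 : 0 <= l0 / 2 * `|y| by rewrite mulr_ge0// divr_ge0// ltW.
have h2 := sqr_le_expR u0.
have -> : (l * y) ^+ 2 = 4 * (l / l0) ^+ 2 * (l0 / 2 * `|y|) ^+ 2.
  rewrite [(l0 / 2 * `|y|) ^+ 2]exprMn real_normK ?num_real//.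
  by field; rewrite gt_eqF.
rewrite e mulrA; apply: ler_pM => //; rewrite ?expR_ge0//.
  by apply: mulr_ge0; [apply: mulr_ge0 => //; exact: sqr_ge0|exact: sqr_ge0].
rewrite [16 * _](_ : _ = 4 * (l / l0) ^+ 2 * 4); last by ring.
by rewrite -[leRHS]mulrA ler_wpM2l// mulr_ge0// sqr_ge0.
Qed.

Lemma expmoment_integrable (Y : Om -> R) (l0 M : R) : 0 < l0 ->
  measurable_fun setT Y -> (\int[P]_w (expR (l0 * `|Y w|))%:E <= M%:E)%E ->
  P.-integrable setT (EFin \o Y).
Proof.
move=> l00 mY h; apply/integrableP; split; first exact/measurable_EFinP.
apply: le_lt_trans (ltry (l0^-1 * M)).
rewrite EFinM; apply: (@le_trans _ _ ((l0^-1)%:E * \int[P]_w (expR (l0 * `|Y w|))%:E)%E); last first.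
  by rewrite lee_wpmul2l// lee_fin invr_ge0 ltW.
have mE := measurable_expR_comp l0 (measurableT_comp (@normr_measurable R setT) mY).
rewrite -ge0_integralZl//; last 2 first.
- by apply/measurable_EFinP; exact: mE.
- by rewrite lee_fin invr_ge0 ltW.
apply: ge0_le_integral => //.
- by apply/measurable_EFinP; exact: measurableT_comp.
- apply/measurable_EFinP; apply: measurable_funM => //; exact: mE.
- move=> w _ /=; rewrite lee_fin -ler_pdivrMl ?invr_gt0// invrK.
  by rewrite (le_trans _ (expR_ge1Dx _))// lerDr.
Qed.

(** An exponential moment bounds the logarithm of the moment generating function
    near zero by its linear part plus a quadratic term; [l0 / 2] leaves the other
    half of the exponent to absorb the remainder of the expansion. *)
Lemma mgf_bound (Y : Om -> R) (l0 M l : R) : 0 < l0 -> 0 <= M ->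
  measurable_fun setT Y -> (\int[P]_w (expR (l0 * `|Y w|))%:E <= M%:E)%E ->
  `|l| <= l0 / 2 ->
  (\int[P]_w (expR (l * Y w))%:E <=
   (expR (l * (\int[P]_w Y w)%R + 16 * M / l0 ^+ 2 * l ^+ 2))%:E)%E.
Proof.
move=> l00 M0 mY h hl.
have iY := expmoment_integrable l00 mY h.
have mE := measurable_expR_comp l0 (measurableT_comp (@normr_measurable R setT) mY).
have iE : P.-integrable setT (EFin \o (fun w => expR (l0 * `|Y w|))).
  apply/integrableP; split; first by apply/measurable_EFinP; exact: mE.
  apply: le_lt_trans (ltry M); apply: le_trans h.
  under eq_integral => w _ do rewrite /= ger0_norm ?expR_ge0//.
  exact: lexx.
pose c := 16 * (l / l0) ^+ 2.
have c0 : 0 <= c by rewrite mulr_ge0// sqr_ge0.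
have i1 : P.-integrable setT (EFin \o (fun w => 1 + l * Y w)).
  apply: (eq_integrable measurableT (fun w => 1%E + l%:E * (EFin \o Y) w)%E) => //.
  apply: integrableD => //; first exact: finite_measure_integrable_cst.
  exact: integrableZl.
have i2 : P.-integrable setT (EFin \o (fun w => c * expR (l0 * `|Y w|))).
  apply: (eq_integrable measurableT (fun w => c%:E * (EFin \o (fun w => expR (l0 * `|Y w|))) w)%E) => //.
  exact: integrableZl.
have i3 : P.-integrable setT (EFin \o (fun w => 1 + l * Y w + c * expR (l0 * `|Y w|))).
  apply: (eq_integrable measurableT ((EFin \o (fun w => 1 + l * Y w)%R) \+
     (EFin \o (fun w => c * expR (l0 * `|Y w|))%R))%E) => //.
  exact: integrableD.
apply: (@le_trans _ _ (\int[P]_w (1 + l * Y w + c * expR (l0 * `|Y w|))%R%:E)%E).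
  apply: ge0_le_integral => //.
  - by apply/measurable_EFinP; exact: measurable_expR_comp.
  - exact: (measurable_int P).
  - by move=> w _; rewrite lee_fin; exact: expR_moment_bound.
have -> : (\int[P]_w (1 + l * Y w + c * expR (l0 * `|Y w|))%:E =
   1 + l%:E * \int[P]_w (Y w)%:E + c%:E * \int[P]_w (expR (l0 * `|Y w|))%:E)%E.
  under eq_integral do rewrite EFinD.
  rewrite integralD//; congr (_ + _)%E.
    under eq_integral do rewrite EFinD EFinM.
    rewrite integralD//; last 2 first.
      exact: finite_measure_integrable_cst.
      exact: integrableZl.
    by rewrite integralZl// integral_cst//= mul1e probability_setT.
  by under eq_integral do rewrite EFinM; rewrite integralZl.
have fY : (\int[P]_w (Y w)%:E = ((\int[P]_w Y w)%R)%:E)%E.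
  by rewrite /Rintegral fineK//; exact: integrable_fin_num.
rewrite fY; apply: (@le_trans _ _ (1 + l%:E * ((\int[P]_w Y w)%R)%:E + c%:E * M%:E)%E).
  by rewrite leeD2l// lee_wpmul2l// lee_fin.
rewrite -!EFinM -!EFinD lee_fin.
rewrite (_ : 16 * M / l0 ^+ 2 * l ^+ 2 = c * M); last by rewrite /c; field; rewrite gt_eqF.
by apply: le_trans (expR_ge1Dx _); rewrite addrA.
Qed.

End ExpectationTools.

Section Chernoff.
Context {R : realType} {dOm : measure_display} {Om : measurableType dOm}.
Variable P : probability Om R.
Context {I : finType} {U : Type}.
Variables (S : set (set U)) (X : I -> Om -> U).
Hypotheses (hX : independent P S X) (ST : S setT) (SI : setI_closed S).
Hypothesis mX : forall i C, S C -> measurable (X i @^-1` C).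

Lemma measurable_obs (psi : U -> R) i : (forall B, measurable B -> S (psi @^-1` B)) ->
  measurable_fun setT (fun w => psi (X i w)).
Proof. by move=> h _ B mB; rewrite setTI; exact: (mX i (h B mB)). Qed.

(** Variables are taken out one at a time, each being integrated against the
    past generated by the remaining ones. *)
Lemma expectation_prod (psi : U -> R) (J : {set I}) :
  (forall B, measurable B -> S (psi @^-1` B)) -> (forall x, 0 <= psi x) ->
  (\int[P]_w (\prod_(i in J) psi (X i w))%:E =
   \prod_(i in J) \int[P]_w (psi (X i w))%:E)%E.
Proof.
move=> hpsi psi0; move: {2}#|J| (erefl #|J|) => k; elim: k J => [|k IH] J hJ.
  move/eqP: hJ; rewrite cards_eq0 => /eqP ->.
  under eq_integral do rewrite big_set0.
  by rewrite big_set0 integral_cst//= mul1e probability_setT.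
have /card_gt0P[j jJ] : (0 < #|J|)%N by rewrite hJ.
set J' := J :\ j; have jJ' : j \notin J' by rewrite !inE eqxx.
have JE : J = j |: J' by rewrite finset.setD1K.
have cJ' : #|J'| = k by have := cardsD1 j J; rewrite jJ hJ add1n => -[].
rewrite JE big_setU1//= -(IH _ cJ').
under eq_integral do rewrite big_setU1//=.
have mY : measurable_fun setT (psi \o X j) by exact: measurable_obs.
have mprod : measurable_fun setT
    (fun w : g_sigma_algebraType (past S X J') => \prod_(i in J') psi (X i w)).
  under eq_fun do rewrite -big_enum/=.
  apply: measurable_prod => i; rewrite mem_enum => iJ'.
  exact: (past_measurable_fun ST iJ' hpsi).
pose f (z : g_sigma_algebraType (past S X J') * R) : \bar R :=
  (\prod_(i in J') psi (X i z.1) * `|z.2|)%:E.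
have mf : measurable_fun setT f.
  apply/measurable_EFinP; apply: measurable_funM.
    exact: measurableT_comp mprod measurable_fst.
  by apply: measurableT_comp measurable_snd; exact: normr_measurable.
have f0 z : (0 <= f z)%E by rewrite lee_fin mulr_ge0// prodr_ge0.
have := past_fubini hX ST SI mX mY jJ' hpsi mf f0; rewrite /f /= => hF.
transitivity (\int[P]_w (\prod_(i in J') psi (X i w) * `|psi (X j w)|)%:E)%E.
  by apply: eq_integral => w _; rewrite ger0_norm// mulrC.
rewrite hF.
have mprod' : measurable_fun setT (fun w : Om => \prod_(i in J') psi (X i w)).
  under eq_fun do rewrite -big_enum/=.
  by apply: measurable_prod => i _; exact: measurable_obs.
transitivity (\int[P]_w ((\prod_(i in J') psi (X i w))%:E * \int[P]_w (psi (X j w))%:E))%E.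
  apply: eq_integral => w _.
  under eq_integral do rewrite EFinM.
  rewrite ge0_integralZl//; last 2 first.
  - by apply/measurable_EFinP; exact: normr_measurable.
  - by rewrite lee_fin prodr_ge0.
  congr (_ * _)%E; rewrite ge0_integral_distribution//.
    by apply: eq_integral => v _; rewrite /= ger0_norm.
  by apply/measurable_EFinP; exact: normr_measurable.
rewrite ge0_integralZr//.
- by rewrite muleC.
- exact/measurable_EFinP.
- by move=> w _; rewrite lee_fin prodr_ge0.
- by apply: integral_ge0 => w _; rewrite lee_fin.
Qed.

(** Markov inequality for [exp (l sum_i psi (X i))]. *)
Lemma chernoff_upper (psi : U -> R) (mu C l s : R) :
  (forall B, measurable B -> S (psi @^-1` B)) -> 0 <= l ->
  (forall i, (\int[P]_w (expR (l * psi (X i w)))%:E <= (expR (l * mu + C * l ^+ 2))%:E)%E) ->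
  (P [set w | (#|I|%:R * (mu + s) <= \sum_i psi (X i w))%R] <=
   (expR (#|I|%:R * (C * l ^+ 2 - l * s)))%:E)%E.
Proof.
move=> hpsi l0 hmgf; set m := #|I|%:R.
pose Z w := \prod_(i in [set: I]%SET) expR (l * psi (X i w)).
have ZE w : Z w = expR (l * \sum_i psi (X i w)).
  by rewrite /Z mulr_sumr expR_sum; apply: eq_bigl => i; rewrite finset.in_setT.
have msum : measurable_fun setT (fun w => \sum_i psi (X i w)).
  by apply: measurable_sum => i; exact: measurable_obs.
have hexp B : measurable B -> S ((fun x => expR (l * psi x)) @^-1` B).
  move=> mB; have mE : measurable_fun setT (fun y : R => expR (l * y)).
    by apply: measurableT_comp => //; exact: measurable_funM.
  have := mE measurableT B mB; rewrite setTI => mB'.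
  exact: (hpsi _ mB').
have hZ : (\int[P]_w (Z w)%:E <= (expR (m * (l * mu + C * l ^+ 2)))%:E)%E.
  rewrite (expectation_prod [set: I]%SET hexp); last by move=> x; exact: expR_ge0.
  apply: (@le_trans _ _ (\prod_(i in [set: I]%SET) (expR (l * mu + C * l ^+ 2))%:E)%E).
    apply: (proj2 (big_ind2 (fun x y : \bar R => (0 <= x)%E /\ (x <= y)%E) _ _ _)).
    - by split=> //; rewrite lee_fin.
    - by move=> a b c e [a0 ab] [c0 ce]; split; [exact: mule_ge0|exact: lee_pmul].
    - move=> i _; split; last exact: hmgf.
      by apply: integral_ge0 => w _; rewrite lee_fin expR_ge0.
  by rewrite prodEFin prodr_const finset.cardsT -expRM_natl.
set A := [set w | _].
have mA : measurable A.
  rewrite (_ : A = (fun w => \sum_i psi (X i w)) @^-1` `[m * (mu + s), +oo[).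
    by rewrite -[X in measurable X]setTI; apply: msum => //; exact: measurable_itv.
  by apply/seteqP; split=> w; rewrite /A /= in_itv/= andbT.
rewrite -[A]setIT -integral_indic//.
apply: (@le_trans _ _ (\int[P]_w ((expR (- (l * (m * (mu + s)))))%:E * (Z w)%:E))%E).
  apply: ge0_le_integral => //.
  - by apply/measurable_EFinP; exact: measurable_indic.
  - apply/measurable_EFinP; apply: measurable_funM => //.
    by rewrite (funext ZE); exact: measurable_expR_comp.
  - move=> w _; rewrite -EFinM lee_fin ZE -expRD indicE.
    case: (boolP (w \in A)) => [|_]; last exact: expR_ge0.
    rewrite inE /A /= => hw; rewrite -[leLHS]expR0 ler_expR addrC subr_ge0.
    by rewrite ler_wpM2l.
rewrite ge0_integralZl//; last 2 first.
- by apply/measurable_EFinP; rewrite (funext ZE); exact: measurable_expR_comp.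
- by move=> w _; rewrite lee_fin ZE expR_ge0.
apply: (@le_trans _ _ ((expR (- (l * (m * (mu + s)))))%:E *
   (expR (m * (l * mu + C * l ^+ 2)))%:E)%E).
  by rewrite lee_wpmul2l// lee_fin expR_ge0.
rewrite -EFinM lee_fin -expRD ler_expR le_eqVlt; apply/orP; left; apply/eqP; ring.
Qed.

(** The optimal [l] is [sqrt (ell / m)], which is admissible once [m] is a
    large multiple of [ell]. *)
Lemma chernoff (psi : U -> R) (mu C l0 kappa ell : R) :
  (forall B, measurable B -> S (psi @^-1` B)) -> (0 < #|I|)%N -> 0 <= ell ->
  (forall l i, `|l| <= l0 -> (\int[P]_w (expR (l * psi (X i w)))%:E <=
     (expR (l * mu + C * l ^+ 2))%:E)%E) ->
  Num.sqrt (ell / #|I|%:R) <= l0 ->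
  (P [set w | ((C + kappa) * Num.sqrt (ell / #|I|%:R) <=
        `|#|I|%:R^-1 * \sum_i psi (X i w) - mu|)%R] <= (2 * expR (- (kappa * ell)))%R%:E)%E.
Proof.
move=> hpsi I0 ell0 hmgf hl; set m := #|I|%:R in hl *; set l := Num.sqrt _ in hl *.
have m0 : 0 < m by rewrite ltr0n.
have l_ge0 : 0 <= l by exact: sqrtr_ge0.
have l2 : l ^+ 2 = ell / m by rewrite sqr_sqrtr// divr_ge0// ltW.
have expo : m * (C * l ^+ 2 - l * ((C + kappa) * l)) = - (kappa * ell).
  rewrite [l * _](_ : _ = (C + kappa) * l ^+ 2); last by ring.
  by rewrite l2; field; rewrite gt_eqF.
have hpsiN B : measurable B -> S ((fun x => - psi x) @^-1` B).
  move=> mB; have mN : measurable_fun setT (fun y : R => - y) by exact: oppr_measurable.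
  by have := mN measurableT B mB; rewrite setTI => mB'; exact: (hpsi _ mB').
have h1 := @chernoff_upper psi mu C l ((C + kappa) * l) hpsi l_ge0 _.
have h2 := @chernoff_upper (fun x => - psi x) (- mu) C l ((C + kappa) * l) hpsiN l_ge0 _.
have {}h1 : (P [set w | (m * (mu + (C + kappa) * l) <= \sum_i psi (X i w))%R] <=
    (expR (- (kappa * ell)))%:E)%E.
  by rewrite -expo; apply: h1 => i; apply: hmgf; rewrite ger0_norm.
have {}h2 : (P [set w | (m * (- mu + (C + kappa) * l) <= \sum_i - psi (X i w))%R] <=
    (expR (- (kappa * ell)))%:E)%E.
  rewrite -expo; apply: h2 => i; have := hmgf (- l) i.
  rewrite normrN ger0_norm// => /(_ hl); rewrite sqrrN mulrN mulNr.
  by under eq_integral do rewrite mulNr -mulrN.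
have msum (ph : U -> R) : (forall B, measurable B -> S (ph @^-1` B)) ->
    forall c, measurable [set w | (c <= \sum_i ph (X i w))%R].
  move=> hph c.
  have ms : measurable_fun setT (fun w => \sum_i ph (X i w)).
    by apply: measurable_sum => i; exact: measurable_obs.
  rewrite (_ : [set w | _] = (fun w => \sum_i ph (X i w)) @^-1` `[c, +oo[).
    by rewrite -[X in measurable X]setTI; apply: ms => //; exact: measurable_itv.
  by apply/seteqP; split=> w; rewrite /= in_itv/= andbT.
have m1 := msum _ hpsi (m * (mu + (C + kappa) * l)).
have m2 := msum _ hpsiN (m * (- mu + (C + kappa) * l)).
apply: (@le_trans _ _ (P ([set w | (m * (mu + (C + kappa) * l) <= \sum_i psi (X i w))%R] `|`
   [set w | (m * (- mu + (C + kappa) * l) <= \sum_i - psi (X i w))%R]))).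
  have ms : measurable_fun setT (fun w => `|m^-1 * \sum_i psi (X i w) - mu|).
    apply: measurableT_comp; first exact: normr_measurable.
    apply: measurable_funB => //; apply: measurable_funM => //.
    by apply: measurable_sum => i; exact: measurable_obs.
  apply: le_measure; rewrite ?inE.
  - rewrite (_ : [set w | _] = (fun w => `|m^-1 * \sum_i psi (X i w) - mu|)
        @^-1` `[(C + kappa) * l, +oo[).
      by rewrite -[X in measurable X]setTI; apply: ms => //; exact: measurable_itv.
    by apply/seteqP; split=> w; rewrite /= in_itv/= andbT.
  - exact: measurableU.
  - move=> w /=; rewrite sumrN; set s := \sum_i _.
    have sE : s = m * (m^-1 * s) by rewrite mulrA divff ?mul1r// gt_eqF.
    have [h|h] := leP 0 (m^-1 * s - mu) => hw.
      by left; rewrite sE ler_pM2l//; rewrite (ger0_norm h) in hw; lra.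
    by right; rewrite sE -mulrN ler_pM2l//; rewrite (ltr0_norm h) in hw; lra.
apply: (le_trans (measureU2 _ _ _)) => //.
set e := expR _ in h1 h2 *.
have -> : (2 * e)%R%:E = (e%:E + e%:E)%E by rewrite -EFinD; congr (_%:E); ring.
exact: leeD.
Qed.

End Chernoff.

(** * Gaussian integrals *)

Section Gaussian.
Context {R : realType}.
Local Notation mu := (@lebesgue_measure R).

Import HBNNSimple.

(** By definition the density gives the measure of sets, hence the integral of
    simple functions; monotone convergence does the rest. *)
Lemma integral_density d (T : measurableType d) (nu mu0 : {measure set T -> \bar R})
  (q : T -> R) (f : T -> \bar R) :
  measurable_fun setT q -> (forall x, 0 <= q x) ->
  (forall A, measurable A -> nu A = (\int[mu0]_(x in A) (q x)%:E)%E) ->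
  measurable_fun setT f -> (forall x, (0 <= f x)%E) ->
  (\int[nu]_x f x = \int[mu0]_x (f x * (q x)%:E))%E.
Proof.
move=> mq q0 hnu mf f0.
have mqE : measurable_fun setT (EFin \o q) by exact/measurable_EFinP.
have hsimple (h : {nnsfun T >-> R}) :
    (\int[nu]_x (h x)%:E = \int[mu0]_x ((h x)%:E * (q x)%:E))%E.
  under eq_integral do rewrite fimfunE -fsumEFin//.
  rewrite ge0_integral_fsum//; last 2 first.
    by move=> r; exact/measurable_EFinP/measurableT_comp.
    by move=> r x _; rewrite EFinM nnfun_muleindic_ge0.
  under [RHS]eq_integral.
    move=> x _; rewrite fimfunE -fsumEFin// ge0_mule_fsuml; last first.
      by move=> r; rewrite EFinM nnfun_muleindic_ge0.
    over.
  rewrite ge0_integral_fsum//; last 2 first.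
    move=> r; apply: emeasurable_funM => //.
    exact/measurable_EFinP/measurableT_comp.
    by move=> r x _; apply: mule_ge0; [rewrite EFinM nnfun_muleindic_ge0|rewrite lee_fin].
  apply: eq_fsbigr => r; rewrite inE => -[x _ hxr].
  have r0 : 0 <= r by rewrite -hxr.
  under eq_integral do rewrite EFinM.
  rewrite ge0_integralZl//; last by apply/measurable_EFinP; exact: measurable_indic.
  under [RHS]eq_integral do rewrite EFinM -muleA.
  rewrite [RHS]ge0_integralZl//; last 2 first.
    apply: emeasurable_funM => //.
    by apply/measurable_EFinP; exact: measurable_indic.
    by move=> y _; rewrite mule_ge0// lee_fin.
  congr (_ * _)%E; rewrite integral_indic// setIT hnu//.
  rewrite integral_mkcond; apply: eq_integral => y _.
  rewrite patchE indicE; case: ifPn => _; first by rewrite mul1e.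
  by rewrite mul0e.
pose g := nnsfun_approx measurableT mf.
have gf x : limn (EFin \o g^~ x) = f x by apply/cvg_lim => //; exact: cvg_nnsfun_approx.
have gnd x : {homo (fun n => (g n x)%:E) : m n / (m <= n)%N >-> (m <= n)%E}.
  by move=> m n mn; rewrite lee_fin; exact/lefP/nd_nnsfun_approx.
transitivity (limn (fun n => \int[nu]_x (g n x)%:E)%E).
  rewrite -monotone_convergence//.
  - by apply: eq_integral => x _; exact/esym/gf.
  - by move=> n; exact/measurable_EFinP.
  - by move=> n x _; rewrite lee_fin.
transitivity (limn (fun n => \int[mu0]_x ((g n x)%:E * (q x)%:E))%E).
  by congr (limn _); apply/funext => n; exact: hsimple.
rewrite -monotone_convergence//.
- apply: eq_integral => x _; apply/cvg_lim => //.
  have [->|q1] := eqVneq (q x) 0.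
    rewrite mule0; under eq_fun do rewrite mule0; exact: cvg_cst.
  under eq_fun do rewrite muleC; rewrite muleC.
  by apply: cvgeZl => //; exact: cvg_nnsfun_approx.
- by move=> n; apply: emeasurable_funM => //; exact/measurable_EFinP.
- by move=> n x _; rewrite mule_ge0// lee_fin.
- by move=> x _ m n mn; rewrite lee_wpmul2r ?lee_fin//; exact/lefP/nd_nnsfun_approx.
Qed.

Lemma integral_normal_prob (m s : R) (f : R -> \bar R) : measurable_fun setT f ->
  (forall x, (0 <= f x)%E) ->
  (\int[normal_prob m s]_x f x = \int[mu]_x (f x * (normal_pdf m s x)%:E))%E.
Proof.
move=> mf f0; apply: integral_density => //.
  exact: measurable_normal_pdf.
by move=> x; exact: normal_pdf_ge0.
Qed.

(** Completing the square turns the weighted density into that of a Gaussian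
    of twice the variance. *)
Lemma normal_exp_square (s : R) : 0 < s ->
  (\int[normal_prob 0 s]_x (expR (x ^+ 2 / (4 * s ^+ 2)))%:E = (Num.sqrt 2)%:E)%E.
Proof.
move=> s0; have sn := lt0r_neq0 s0.
have s2 : 0 < Num.sqrt 2 * s by rewrite mulr_gt0// sqrtr_gt0.
have mE : measurable_fun setT (fun x : R => expR (x ^+ 2 / (4 * s ^+ 2))).
  apply: measurableT_comp => //; apply: measurable_funM => //.

rewrite integral_normal_prob//; last exact/measurable_EFinP.
transitivity (\int[mu]_x ((Num.sqrt 2)%:E * (normal_pdf 0 (Num.sqrt 2 * s) x)%:E))%E;
  last first.
  rewrite ge0_integralZl//; last 2 first.
  - by apply/measurable_EFinP; exact: measurable_normal_pdf.
  - by move=> x _; rewrite lee_fin normal_pdf_ge0.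
  by rewrite integral_normal_pdf mule1.
apply: eq_integral => x _; rewrite -!EFinM; congr (_%:E).
rewrite !normal_pdfE ?lt0r_neq0// /normal_peak /normal_fun !subr0.
have q2 : Num.sqrt 2 ^+ 2 = 2 :> R by rewrite sqr_sqrtr.
have hp : (Num.sqrt (s ^+ 2 * pi *+ 2))^-1 =
    Num.sqrt 2 * (Num.sqrt ((Num.sqrt 2 * s) ^+ 2 * pi *+ 2))^-1.
  have -> : (Num.sqrt 2 * s) ^+ 2 * pi *+ 2 = 2 * (s ^+ 2 * pi *+ 2).
    move: pi (Num.sqrt 2) q2 => p q q2.
    by rewrite exprMn q2; ring.
  by rewrite sqrtrM// invfM mulrA divff ?mul1r// lt0r_neq0// sqrtr_gt0.
rewrite mulrCA -expRD.
have -> : x ^+ 2 / (4 * s ^+ 2) + - x ^+ 2 / (s ^+ 2 *+ 2) =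
    - x ^+ 2 / ((Num.sqrt 2 * s) ^+ 2 *+ 2).
  move: (Num.sqrt 2) q2 => q q2; rewrite exprMn q2; by field.
by rewrite mulrA -hp.
Qed.

(** Completing the square turns the tilted density into that of a Gaussian
    shifted by [a s ^ 2]. *)
Lemma normal_mgf (s a : R) : 0 < s ->
  (\int[normal_prob 0 s]_x (expR (a * x))%:E = (expR (a ^+ 2 * s ^+ 2 / 2))%:E)%E.
Proof.
move=> s0; have sn := lt0r_neq0 s0.
have mE : measurable_fun setT (fun x : R => expR (a * x)).
  by apply: measurableT_comp => //; exact: measurable_funM.
rewrite integral_normal_prob//; last exact/measurable_EFinP.
transitivity (\int[mu]_x ((expR (a ^+ 2 * s ^+ 2 / 2))%:E *
    (normal_pdf (a * s ^+ 2) s x)%:E))%E; last first.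
  rewrite ge0_integralZl//; last 2 first.
  - by apply/measurable_EFinP; exact: measurable_normal_pdf.
  - by move=> x _; rewrite lee_fin normal_pdf_ge0.
  by rewrite integral_normal_pdf mule1.
apply: eq_integral => x _; rewrite -!EFinM; congr (_%:E).
rewrite !normal_pdfE// /normal_fun subr0 mulrCA -expRD [RHS]mulrCA -expRD.
have -> : a * x + - x ^+ 2 / (s ^+ 2 *+ 2) =
    a ^+ 2 * s ^+ 2 / 2 + - (x - a * s ^+ 2) ^+ 2 / (s ^+ 2 *+ 2).
  by field.
by [].
Qed.

End Gaussian.

(** * Expectation and time integration of processes *)

Section PathFubini.
Context {R : realType} {dOm : measure_display} {Om : measurableType dOm}.
Variable P : probability Om R.
Variable T : R.
Hypothesis T0 : 0 < T.
Local Notation mu := (@lebesgue_measure R).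
Implicit Types Y : Om -> R -> R.

Definition clamp (t : R) : R := Num.max 0 (Num.min t T).

Lemma clamp_itv t : 0 <= clamp t <= T.
Proof. by rewrite /clamp le_max lexx/= ge_max (ltW T0)/= ge_min lexx orbT. Qed.

Lemma clamp_id t : 0 <= t <= T -> clamp t = t.
Proof. by move=> /andP[t0 tT]; rewrite /clamp (min_idPl tT) (max_idPr t0). Qed.

Lemma measurable_clamp : measurable_fun setT clamp.
Proof.
by apply: measurable_maxr; [exact: measurable_cst|apply: measurable_minr].
Qed.

(** A process with continuous paths is the pointwise limit of its values at
    the grid points [floor (k t) / k], hence jointly measurable. *)
Lemma measurable_path Y : (forall w, {within `[0, T], continuous (Y w)}) ->
  (forall t, 0 <= t <= T -> measurable_fun setT (Y^~ t)) ->
  measurable_fun setT (fun p : Om * R => Y p.1 (clamp p.2)).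
Proof.
move=> Yc mY.
pose h k (t : R) : R := k.+1%:R * clamp t.
have h0 k t : 0 <= h k t by rewrite mulr_ge0//; case/andP : (clamp_itv t).
pose s k t : R := clamp ((Num.truncn (h k t))%:R / k.+1%:R).
have mh k : measurable_fun setT (h k).
  by apply: measurable_funM; [exact: measurable_cst|exact: measurable_clamp].
apply: (@measurable_fun_cvg _ _ _ _ (fun k (p : Om * R) => Y p.1 (s k p.2))).
- move=> k _ B mB; rewrite setTI.
  pose F j := [set w | B (Y w (clamp (j%:R / k.+1%:R)))] `*`
    (h k @^-1` `[j%:R, j.+1%:R[).
  rewrite (_ : _ @^-1` B = \bigcup_j F j).
    apply: bigcupT_measurable => j; apply: measurableX.
      have := mY _ (clamp_itv (j%:R / k.+1%:R)).
      by move=> /(_ measurableT B mB); rewrite setTI.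
    rewrite -[X in measurable X]setTI; apply: mh => //; exact: measurable_itv.
  apply/seteqP; split=> [[w t]/= hB|[w t] [j _ [/= hB]]].
    exists (Num.truncn (h k t)) => //; split=> //=.
    by rewrite in_itv/=; exact: truncn_itv.
  by rewrite in_itv/= -truncn_eq// => /eqP jE; rewrite /s jE.
- move=> [w t] _ /=.
  have /subspace_continuousP hY := Yc w.
  have ct := clamp_itv t.
  have := hY (clamp t); rewrite /= in_itv/= => /(_ ct)/cvgrPdist_lt hY'.
  apply/cvgrPdist_lt => e e0.
  have := hY' e e0; rewrite near_withinE => /nbhs_ballP[d /= d0 hd].
  near=> k.
  have k0 : 0 < k.+1%:R :> R by rewrite ltr0n.
  have /andP[h1 h2] := truncn_itv (h0 k t).
  pose q : R := (Num.truncn (h k t))%:R / k.+1%:R.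
  have q1 : q <= clamp t by rewrite /q ler_pdivrMr// mulrC.
  have q2 : clamp t < q + k.+1%:R^-1.
    have -> : q + k.+1%:R^-1 = (Num.truncn (h k t)).+1%:R / k.+1%:R.
      by rewrite /q -[in RHS]natr1 mulrDl mul1r.
    by rewrite ltr_pdivlMr// mulrC.
  have q0 : 0 <= q by rewrite /q divr_ge0.
  have sq : s k t = q by apply: clamp_id; rewrite q0 (le_trans q1)//; case/andP : ct.
  apply: hd => /=; last by rewrite in_itv/=; exact: clamp_itv.
  rewrite /ball/= sq ger0_norm ?subr_ge0//.
  have : k.+1%:R^-1 < d by near: k; exact: near_infty_natSinv_lt (PosNum d0).
  by move=> hk; rewrite ltrBlDl (lt_trans q2)// ltrD2l.
Unshelve. all: end_near. Qed.

(** Processes that are measurable in the pair (outcome, time), with bounded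
    paths: the class for which expectation and time integral are exchanged.
    It contains the continuous processes and, being stable under products,
    also their multiples by the discontinuous gains. *)
Definition process Y : Prop :=
  measurable_fun setT (fun p : Om * R => Y p.1 (clamp p.2)) /\
  forall w, bmeas T (Y w).

Lemma process_cont Y : (forall w, {within `[0, T], continuous (Y w)}) ->
  (forall t, 0 <= t <= T -> measurable_fun setT (Y^~ t)) -> process Y.
Proof. by move=> Yc mY; split; [exact: measurable_path|move=> w; exact: bmeas_cont]. Qed.

Lemma process_det f : bmeas T f -> process (fun _ => f).
Proof.
move=> hf; split=> //; case: hf => mf _.
have hc : measurable_fun setT (f \o clamp).
  apply: (@measurable_comp _ _ _ _ _ _ (`[0, T] : set R)) => //.
  - by move=> _ [t _ <-] /=; rewrite in_itv/=; exact: clamp_itv.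
  - exact: measurable_clamp.
exact: (measurableT_comp hc (@measurable_snd _ _ Om R)).
Qed.

Lemma process_rv (V : Om -> R) : measurable_fun setT V -> process (fun w _ => V w).
Proof.
move=> mV; split; last by move=> w; exact: bmeas_cst.
exact: (measurableT_comp mV measurable_fst).
Qed.

Lemma processD Y Z : process Y -> process Z -> process (fun w t => Y w t + Z w t).
Proof.
move=> [mY bY] [mZ bZ]; split; first exact: measurable_funD.
by move=> w; exact: bmeasD.
Qed.

Lemma processM Y Z : process Y -> process Z -> process (fun w t => Y w t * Z w t).
Proof.
move=> [mY bY] [mZ bZ]; split; first exact: measurable_funM.
by move=> w; exact: bmeasM.
Qed.

Lemma process_sum (J : Type) (r : seq J) (Y : J -> Om -> R -> R) :
  (forall j, process (Y j)) -> process (fun w t => \sum_(j <- r) Y j w t).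
Proof.
move=> h; elim: r => [|j r IH].
  rewrite (_ : (fun _ _ => _) = fun _ _ => 0); first exact/process_det/bmeas_cst.
  by apply/funext => w; apply/funext => t; rewrite big_nil.
rewrite (_ : (fun _ _ => _) = fun w t => Y j w t + \sum_(j <- r) Y j w t).
  exact: processD.
by apply/funext => w; apply/funext => t; rewrite big_cons.
Qed.

Lemma process_expR Y : process Y -> process (fun w t => expR (Y w t)).
Proof.
move=> [mY bY]; split; first exact: measurableT_comp.
move=> w; have [mw [c hc]] := bY w; split; first exact: measurableT_comp.
exists (expR c) => t ht; rewrite ger0_norm ?expR_ge0// ler_expR.
by rewrite (le_trans (ler_norm _))// hc.
Qed.

Lemma process_at Y t : process Y -> 0 <= t <= T -> measurable_fun setT (Y^~ t).
Proof.
move=> [mY _] ht.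
have -> : Y^~ t = (fun p : Om * R => Y p.1 (clamp p.2)) \o (pair^~ t).
  by apply/funext => w /=; rewrite clamp_id.
exact: (measurableT_comp mY (pair2_measurable t)).
Qed.

(** Time is clamped to [[0, T]] so that the process is jointly measurable on the
    whole product space, where the theorem of Fubini is available. *)
Lemma path_fubini Y (C : R) : process Y ->
  (forall t, 0 <= t <= T -> (\int[P]_w `|Y w t|%:E <= C%:E)%E) ->
  bmeas T (fun t => (\int[P]_w Y w t)%R) /\
  forall s t, 0 <= s -> s <= t -> t <= T ->
  [/\ measurable_fun setT (fun w => integ (Y w) s t),
      P.-integrable setT (EFin \o (fun w => integ (Y w) s t)) &
      (\int[P]_w integ (Y w) s t)%R = integ (fun r => (\int[P]_w Y w r)%R) s t].
Proof.
move=> pY hC; have mY t := @process_at Y t pY; have [mYc bY] := pY.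
have iY t : 0 <= t <= T -> P.-integrable setT (EFin \o Y^~ t).
  move=> ht; apply/integrableP; split; first by apply/measurable_EFinP; exact: mY.
  exact: le_lt_trans (hC t ht) (ltry _).
have core s t : 0 <= s -> s <= t -> t <= T ->
  [/\ measurable_fun setT (fun w => integ (Y w) s t),
      P.-integrable setT (EFin \o (fun w => integ (Y w) s t)),
      (\int[P]_w integ (Y w) s t)%R = integ (fun r => (\int[P]_w Y w r)%R) s t &
      measurable_fun (`[s, t] : set R) (fun r => (\int[P]_w Y w r)%R)].
  move=> s0 st tT.
  have sub r : s <= r <= t -> 0 <= r <= T.
    by move=> /andP[sr rt]; rewrite (le_trans s0)//= (le_trans rt).
  pose D : set R := `[s, t]%classic.
  have mD : measurable D by exact: measurable_itv.
  pose f (p : Om * R) : \bar R := (Y p.1 (clamp p.2) * \1_D p.2)%:E.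
  have mf : measurable_fun setT f.
    apply/measurable_EFinP; apply: measurable_funM => //.
    by apply: measurableT_comp measurable_snd; exact: measurable_indic.
  have fD w r : D r -> f (w, r) = (Y w r)%:E.
    move=> Dr; rewrite /f /= indicE mem_set// mulr1 clamp_id//.
    by apply: sub; move: Dr; rewrite /D /= in_itv.
  have fDn w r : ~ D r -> f (w, r) = 0%E.
    by move=> Dr; rewrite /f /= indicE memNset// mulr0.
  have imf : (P \x mu)%E.-integrable setT f.
    apply/(integrable21ltyP P mu mf).
    apply: (@le_lt_trans _ _ (\int[mu]_r (`|C| * \1_D r)%:E)%E); last first.
      under eq_integral do rewrite EFinM.
      rewrite ge0_integralZl//; last by apply/measurable_EFinP; exact: measurable_indic.
      rewrite integral_indic// setIT /D /= lebesgue_measure_itv/=.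
      by case: ifP => _; rewrite -?EFinB -?EFinM ?ltry// mule0 ltry.
    apply: ge0_le_integral => //.
    - by move=> r _; apply: integral_ge0.
    - apply: (measurable_fun_fubini_tonelli_G (abse \o f)).
        exact: measurableT_comp.
      by move=> z /=.
    - by apply/measurable_EFinP; apply: measurable_funM => //; exact: measurable_indic.
    - move=> r _; have [Dr|Dr] := pselect (D r); last first.
        rewrite (eq_integral (fun=> 0%E)); last by move=> w _; rewrite fDn// abse0.
        by rewrite integral0 lee_fin mulr_ge0.
      rewrite indicE mem_set// mulr1.
      rewrite (eq_integral (fun w => (`|Y w r|)%:E)); last by move=> w _; rewrite fD.
      have hr : 0 <= r <= T by apply: sub; move: Dr; rewrite /D /= in_itv.
      by apply: (le_trans (hC r hr)); rewrite lee_fin ler_norm.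
  have FE w : fubini_F mu f w = (integ (Y w) s t)%:E.
    have iw := bmeas_integrable (bY w) s0 tT.
    rewrite /Rintegral fineK; last exact: integrable_fin_num.
    rewrite /fubini_F [RHS]integral_mkcond; apply: eq_integral => r _.
    rewrite patchE; case: ifPn => [|/negP] hr; first by rewrite fD//; exact: set_mem.
    by rewrite fDn// => Dr; apply: hr; exact: mem_set.
  have GE r : D r -> fubini_G P f r = ((\int[P]_w Y w r)%R)%:E.
    move=> Dr; have hr : 0 <= r <= T by apply: sub; move: Dr; rewrite /D /= in_itv.
    rewrite /Rintegral fineK; last exact: integrable_fin_num (iY r hr).
    by apply: eq_integral => w _; rewrite fD.
  have GE0 r : ~ D r -> fubini_G P f r = 0%E.
    move=> Dr; rewrite /fubini_G (eq_integral (fun=> 0%E)) ?integral0//.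
    by move=> w _; rewrite fDn.
  have mF := measurable_fubini_F imf; have iF := integrable_fubini_F imf.
  have mG := measurable_fubini_G imf.
  have FE' : fubini_F mu f = EFin \o (fun w => integ (Y w) s t) by exact/funext.
  rewrite FE' in mF iF; split=> //.
  - exact/measurable_EFinP.
  - rewrite /Rintegral; congr fine.
    have e1 := integral12_prod_meas1 imf; have e2 := integral21_prod_meas1 imf.
    rewrite FE' in e1; rewrite [LHS]e1 -e2 [RHS]integral_mkcond.
    apply: eq_integral => r _; rewrite patchE.
    case: ifPn => [/set_mem Dr|/negP hr]; first exact: (etrans (GE r Dr)).
    by apply: (etrans (GE0 r _)) => // Dr; apply: hr; exact: mem_set.
  - apply/measurable_EFinP.
    apply: (eq_measurable_fun (fubini_G P f)); first by move=> r /set_mem Dr; exact: GE.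
    exact: measurable_funTS.
split; last by move=> s t s0 st tT; have [] := core s t s0 st tT.
split; first by have [] := core 0 T (lexx _) (ltW T0) (lexx _).
exists C => t ht; have := hC t ht; have := iY t ht => it h.
rewrite -lee_fin; apply: le_trans h.
rewrite /Rintegral -abse_EFin fineK; last exact: integrable_fin_num.
by apply: le_abse_integral => //; apply/measurable_EFinP; exact: mY.
Qed.

Lemma process_integ_mean_le Y (C : R) s t : process Y -> (forall w r, 0 <= Y w r) ->
  (forall r, 0 <= r <= T -> (\int[P]_w (Y w r)%:E <= C%:E)%E) ->
  0 <= s -> s <= t -> t <= T ->
  measurable_fun setT (fun w => integ (Y w) s t) /\
  (\int[P]_w (integ (Y w) s t)%:E <= (C * (t - s))%:E)%E.
Proof.
move=> pY Y0 hC s0 st tT.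
have hC' r : 0 <= r <= T -> (\int[P]_w `|Y w r|%:E <= C%:E)%E.
  by move=> hr; under eq_integral do rewrite ger0_norm//; exact: hC.
have [bE hE] := path_fubini pY hC'; have [mI iI EI] := hE s t s0 st tT.
split=> //.
rewrite -(@fineK _ (\int[P]_w (integ (Y w) s t)%:E)%E); last first.
  by apply: (integrable_fin_num _ iI).
rewrite lee_fin -[fine _]/(\int[P]_w integ (Y w) s t)%R EI -integ_cst//.
apply: (le_integ bE (bmeas_cst T C)) => // r /andP[sr rt].
have hr : 0 <= r <= T by rewrite (le_trans s0)//= (le_trans rt).
rewrite -lee_fin; apply: le_trans (hC r hr).
rewrite /Rintegral fineK//; apply: integrable_fin_num => //; apply/integrableP; split.
  by apply/measurable_EFinP; exact: (process_at pY).
exact: le_lt_trans (hC' r hr) (ltry _).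
Qed.

End PathFubini.

(** * Generated sigma-algebras and inequalities for expectations *)

Section GeneratedMeasurability.

(** The sets with measurable preimage form a sigma-algebra. *)
Lemma preimage_generated d (Om : measurableType d) (U : Type) (G : set (set U))
  (f : Om -> U) : (forall C, G C -> measurable (f @^-1` C)) ->
  forall C, <<s G >> C -> measurable (f @^-1` C).
Proof.
move=> h C hC.
have : <<s G >> `<=` [set C | measurable (f @^-1` C)].
  apply: smallest_sub => //; split.
  - by rewrite /= preimage_set0.
  - by move=> A /= mA; rewrite setTD preimage_setC; exact: measurableC.
  - by move=> F /= mF; rewrite preimage_bigcup; exact: bigcupT_measurable.
exact.
Qed.

Context {R : realType}.

Lemma vec_sigma_coord n (c : 'I_n) (B : set R) : measurable B ->
  vec_sigma (p := n) ((fun v : 'cV[R]_n => v c 0) @^-1` B).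
Proof. by move=> mB; apply: sub_sigma_algebra; exists c, B. Qed.

Lemma gen_setT (U : Type) (G : set (set U)) : <<s G >> setT.
Proof.
move=> H [[H0 HD HU] _]; have := HD _ H0; rewrite setTD setC0; exact.
Qed.

Lemma gen_setC (U : Type) (G : set (set U)) A : <<s G >> A -> <<s G >> (~` A).
Proof. by move=> hA H HG; have [[_ HD _] _] := HG; rewrite -setTD; apply: HD; exact: hA. Qed.

Lemma gen_setI (U : Type) (G : set (set U)) : setI_closed <<s G >>.
Proof.
move=> A B hA hB; rewrite -[A `&` B]setCK setCI.
apply: gen_setC; move=> H HG; have [[_ HD HU] _] := HG.
rewrite -bigcup2E; apply: HU => i; rewrite /bigcup2.
case: ifP => _; first by apply: (gen_setC hA).
by case: ifP => _; [apply: (gen_setC hB)|have [[H0 _ _] _] := HG].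
Qed.

End GeneratedMeasurability.

Section ExpectationInequalities.
Context {R : realType} {dOm : measure_display} {Om : measurableType dOm}.
Variable P : probability Om R.

(** Jensen's inequality, from the tangent of the exponential at the mean. *)
Lemma expR_mean_le (N : nat) (x : 'I_N -> R) : (0 < N)%N ->
  expR (N%:R^-1 * \sum_i x i) <= N%:R^-1 * \sum_i expR (x i).
Proof.
move=> N0; have N0' : 0 < N%:R :> R by rewrite ltr0n.
set m := N%:R^-1 * _.
have h i : expR m * (1 + (x i - m)) <= expR (x i).
  have -> : expR (x i) = expR m * expR (x i - m) by rewrite -expRD addrC subrK.
  by rewrite ler_wpM2l ?expR_ge0// expR_ge1Dx.
apply: (@le_trans _ _ (N%:R^-1 * \sum_i expR m * (1 + (x i - m)))).
  rewrite -mulr_sumr big_split/= sumr_const card_ord sumrB sumr_const card_ord.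
  rewrite -mulr_natl mulr1 -(mulr_natl m).
  have -> : \sum_i x i = N%:R * m by rewrite /m mulrA divff ?mul1r// gt_eqF.
  by rewrite subrr addr0 mulrCA mulVf ?mulr1// gt_eqF.
apply: ler_wpM2l; first by rewrite invr_ge0 ltW.
by apply: ler_sum => i _; exact: h.
Qed.

Lemma int_sum (J : Type) (r : seq J) (f : J -> Om -> R) (c : R) :
  (forall j, measurable_fun setT (f j)) -> (forall j w, 0 <= f j w) ->
  (forall j, (\int[P]_w (f j w)%:E <= c%:E)%E) ->
  (\int[P]_w (\sum_(j <- r) f j w)%:E <= ((size r)%:R * c)%:E)%E.
Proof.
move=> mf f0 hf; under eq_integral do rewrite -sumEFin.
rewrite ge0_integral_sum//; last 2 first.
- by move=> j; exact/measurable_EFinP.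
- by move=> j w _; rewrite lee_fin.
elim: r => [|j r IH]; first by rewrite big_nil mul0r.
by rewrite big_cons /= -natr1 mulrDl mul1r addrC EFinD leeD.
Qed.

Lemma int_scale (k c : R) (f : Om -> R) : 0 <= k -> measurable_fun setT f ->
  (forall w, 0 <= f w) -> (\int[P]_w (f w)%:E <= c%:E)%E ->
  (\int[P]_w (k * f w)%:E <= (k * c)%:E)%E.
Proof.
move=> k0 mf f0 h; under eq_integral do rewrite EFinM.
rewrite ge0_integralZl//; last 2 first.
- exact/measurable_EFinP.
- by move=> w _; rewrite lee_fin.
by rewrite EFinM lee_wpmul2l.
Qed.

Lemma int_expR_mean (N : nat) (x : 'I_N -> Om -> R) (c : R) : (0 < N)%N ->
  (forall i, measurable_fun setT (x i)) ->
  (forall i, (\int[P]_w (expR (x i w))%:E <= c%:E)%E) ->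
  (\int[P]_w (expR (N%:R^-1 * \sum_i x i w))%:E <= c%:E)%E.
Proof.
move=> N0 mx h.
have mE i : measurable_fun setT (fun w => expR (x i w)) by exact: measurableT_comp.
have ms : measurable_fun setT (fun w => \sum_i expR (x i w)) by exact: measurable_sum.
apply: (@le_trans _ _ (\int[P]_w (N%:R^-1 * \sum_i expR (x i w))%:E)%E).
  apply: ge0_le_int => //.
  - apply: measurableT_comp => //; apply: measurable_funM => //.
    exact: measurable_sum.
  - exact: measurable_funM.
  - by move=> w; exact: expR_mean_le.
have -> : c = N%:R^-1 * (N%:R * c) by rewrite mulrA mulVf ?mul1r// pnatr_eq0 -lt0n.
apply: int_scale => //; first by move=> w; apply: sumr_ge0 => i _; exact: expR_ge0.
have := @int_sum 'I_N (index_enum _) (fun i w => expR (x i w)) c mE _ h.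
rewrite (_ : size _ = N); last first.
  by rewrite -sum1_size big_const_ord iter_addn_0 mul1n.
by apply=> i w; exact: expR_ge0.
Qed.

(** Splits the exponential moment of a sum of dependent variables into those of
    the summands, at the price of a factor two in the exponents. *)
Lemma int_expR_half (x y : Om -> R) (a b : R) :
  measurable_fun setT x -> measurable_fun setT y ->
  (\int[P]_w (expR (2 * x w))%:E <= a%:E)%E ->
  (\int[P]_w (expR (2 * y w))%:E <= b%:E)%E ->
  (\int[P]_w (expR (x w + y w))%:E <= ((a + b) / 2)%:E)%E.
Proof.
move=> mx my ha hb.
have m2x := measurable_expR_comp 2 mx; have m2y := measurable_expR_comp 2 my.
have hc w : expR (x w + y w) <= 2^-1 * (expR (2 * x w) + expR (2 * y w)).
  have -> : x w + y w = 2^-1 * \sum_(i < 2) (if i == ord0 then 2 * x w else 2 * y w).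
    by rewrite big_ord_recl big_ord1 /=; field.
  have := @expR_mean_le 2 (fun i => if i == ord0 then 2 * x w else 2 * y w) isT.
  by rewrite [\sum_(i < 2) expR _]big_ord_recl big_ord1.
apply: (@le_trans _ _ (\int[P]_w (2^-1 * (expR (2 * x w) + expR (2 * y w)))%:E)%E).
  apply: ge0_le_int => //.
  - by apply: measurableT_comp => //; exact: measurable_funD.
  - by apply: measurable_funM => //; exact: measurable_funD.
rewrite mulrC; apply: int_scale => //.
- exact: measurable_funD.
under eq_integral do rewrite EFinD.
rewrite ge0_integralD//; try (by move=> w _; rewrite lee_fin expR_ge0);
  try exact/measurable_EFinP.
by rewrite EFinD leeD.
Qed.

Lemma int_le_ae (f g : Om -> R) : measurable_fun setT f -> measurable_fun setT g ->
  (forall w, 0 <= f w) -> (forall w, 0 <= g w) -> {ae P, forall w, f w <= g w} ->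
  (\int[P]_w (f w)%:E <= \int[P]_w (g w)%:E)%E.
Proof.
move=> mf mg f0 g0 fg; apply: ae_ge0_le_integral => //.
- by move=> w _; rewrite lee_fin.
- exact/measurable_EFinP.
- by move=> w _; rewrite lee_fin.
- exact/measurable_EFinP.
- by apply: filterS fg => w h _; rewrite lee_fin.
Qed.

(** Cauchy-Schwarz with a free weight [k]. *)
Lemma int_prod_le (f g : Om -> R) (a b k : R) : 0 < k ->
  measurable_fun setT f -> measurable_fun setT g ->
  (\int[P]_w (f w ^+ 2)%:E <= a%:E)%E -> (\int[P]_w (g w ^+ 2)%:E <= b%:E)%E ->
  (\int[P]_w `|f w * g w|%:E <= ((k * a + k^-1 * b) / 2)%:E)%E.
Proof.
move=> k0 mf mg ha hb.
have mf2 : measurable_fun setT (fun w => f w ^+ 2) by exact: measurable_funX.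
have mg2 : measurable_fun setT (fun w => g w ^+ 2) by exact: measurable_funX.
apply: (@le_trans _ _ (\int[P]_w (2^-1 * (k * f w ^+ 2 + k^-1 * g w ^+ 2))%:E)%E).
  apply: ge0_le_int => //.
  - by apply: measurableT_comp => //; exact: measurable_funM.
  - by apply: measurable_funM => //; apply: measurable_funD; exact: measurable_funM.
  - move=> w; rewrite normrM; set x := `|f w|; set y := `|g w|.
    rewrite -[f w ^+ 2]real_normK ?num_real// -[g w ^+ 2]real_normK ?num_real//.
    rewrite -/x -/y -subr_ge0.
    have -> : 2^-1 * (k * x ^+ 2 + k^-1 * y ^+ 2) - x * y =
        (2 * k)^-1 * (k * x - y) ^+ 2 by field; rewrite gt_eqF.
    by rewrite mulr_ge0 ?sqr_ge0// invr_ge0 mulr_ge0// ltW.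
have k1 : 0 <= k^-1 by rewrite invr_ge0 ltW.
rewrite mulrC; apply: int_scale => //.
- by apply: measurable_funD; exact: measurable_funM.
- by move=> w; rewrite addr_ge0// mulr_ge0 ?sqr_ge0// ltW.
under eq_integral do rewrite EFinD.
rewrite ge0_integralD//.
- by rewrite EFinD leeD// int_scale// ?(ltW k0)// => w; exact: sqr_ge0.
- by move=> w _; rewrite lee_fin mulr_ge0 ?sqr_ge0// ltW.
- by apply/measurable_EFinP; exact: measurable_funM.
- by move=> w _; rewrite lee_fin mulr_ge0 ?sqr_ge0.
- by apply/measurable_EFinP; exact: measurable_funM.
Qed.

Lemma abs_mean_le (f : Om -> R) (a : R) : measurable_fun setT f ->
  (\int[P]_w `|f w|%:E <= a%:E)%E ->
  P.-integrable setT (EFin \o f) /\ `|(\int[P]_w f w)%R| <= a.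
Proof.
move=> mf h.
have i : P.-integrable setT (EFin \o f).
  apply/integrableP; split; first exact/measurable_EFinP.
  exact: le_lt_trans h (ltry _).
split=> //; rewrite -lee_fin; apply: le_trans h.
rewrite /Rintegral -abse_EFin fineK; last exact: integrable_fin_num.
by apply: le_abse_integral => //; exact/measurable_EFinP.
Qed.

Lemma ae_eq_int (f g : Om -> R) : measurable_fun setT f -> measurable_fun setT g ->
  {ae P, forall w, f w = g w} ->
  (\int[P]_w (f w)%:E = \int[P]_w (g w)%:E)%E.
Proof.
move=> mf mg fg; apply: ae_eq_integral => //; try exact/measurable_EFinP.
by apply: filterS fg => w -> _.
Qed.

End ExpectationInequalities.

(** * Brownian increments *)

(** The Gaussian law lives on the Borel sets given as a generated sigma-algebra;
    the identity transports it to the canonical measurable space of reals. *)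
Lemma integral_normal_law {R : realType} (m s : R) (nu : {measure set R -> \bar R})
  (g : R -> \bar R) : (forall B, measurable B -> nu B = normal_prob m s B) ->
  measurable_fun setT g -> (forall y, (0 <= g y)%E) ->
  (\int[nu]_y g y = \int[normal_prob m s]_y g y)%E.
Proof.
move=> h mg g0.
have mid : measurable_fun setT (idfun : measurableTypeR R -> R).
  by move=> _ B mB; rewrite setTI; exact: mB.
transitivity (\int[distribution (normal_prob m s) (mfun_of mid)]_y g y)%E.
  by apply: eq_measure_integral => B mB _; rewrite h.
by rewrite ge0_integral_distribution.
Qed.

Section Brownian.
Context {R : realType} {dOm : measure_display} {Om : measurableType dOm}.
Variable P : probability Om R.
Context {n : nat}.
Variables (W : Om -> R -> 'cV[R]_n) (hW : brownian_motion P W).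

Definition incr (s t : R) (w : Om) : 'cV[R]_n := W w t - W w s.

Lemma measurable_W t i : 0 <= t -> measurable_fun setT (fun w => W w t i 0).
Proof. by move=> t0; case: hW => h _ _ _; apply: h; rewrite /= in_itv/= andbT. Qed.

Lemma measurable_incr s t i : 0 <= s -> 0 <= t ->
  measurable_fun setT (fun w => incr s t w i 0).
Proof.
move=> s0 t0; under eq_fun do rewrite /incr !mxE.
by apply: measurable_funB; exact: measurable_W.
Qed.

Lemma measurable_incr_vec s t C : 0 <= s -> 0 <= t -> vec_sigma (p := n) C ->
  measurable (incr s t @^-1` C).
Proof.
move=> s0 t0; apply: preimage_generated => _ [i [E [mE ->]]].
by have := measurable_incr i s0 t0 measurableT mE; rewrite setTI.
Qed.

Lemma int_incr s t i (g : R -> \bar R) : 0 <= s -> s < t ->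
  measurable_fun setT g -> (forall y, (0 <= g y)%E) ->
  (\int[P]_w g (incr s t w i 0%R) = \int[normal_prob 0%R (Num.sqrt (t - s)%R)]_y g y)%E.
Proof.
move=> s0 st mg g0; have t0 : 0 <= t by rewrite ltW// (le_lt_trans s0).
have mY := measurable_incr i s0 t0.
transitivity (\int[distribution P (mfun_of mY)]_y g y)%E.
  by rewrite ge0_integral_distribution.
apply: integral_normal_law => // B mB; case: hW => _ _ _ h.
by have [_ h'] := h s t s0 st; exact: (h' i B mB).
Qed.

(** The condition on [k] compares with the exponent [1 / (4 s ^ 2)] for which the
    Gaussian integral is explicit. *)
Lemma incr_exp_square s t i (k : R) : 0 <= s -> s < t -> 0 <= k -> k * (4 * (t - s)) <= 1 ->
  (\int[P]_w (expR (k * incr s t w i 0 ^+ 2))%:E <= 2%:E)%E.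
Proof.
move=> s0 st k0 hk; have ts : 0 < t - s by rewrite subr_gt0.
have mE : measurable_fun setT (fun y : R => expR (k * y ^+ 2)).
  by apply: measurableT_comp => //; apply: measurable_funM.
rewrite (int_incr i (g := fun y => (expR (k * y ^+ 2))%:E) s0 st)//; last exact/measurable_EFinP.
have s1 : 0 < Num.sqrt (t - s) by rewrite sqrtr_gt0.
apply: (@le_trans _ _ (Num.sqrt 2)%:E); last first.
  rewrite lee_fin -[leRHS]ger0_norm// -sqrtr_sqr ler_wsqrtr//; lra.
rewrite -(normal_exp_square s1) sqr_sqrtr ?(ltW ts)//.
apply: ge0_le_integral => //.
- exact/measurable_EFinP.
- apply/measurable_EFinP; apply: measurableT_comp => //.
  by apply: measurable_funM.
- move=> y _; rewrite lee_fin ler_expR mulrC ler_wpM2l ?sqr_ge0//.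
  by rewrite -[leRHS]mul1r ler_pdivlMr// mulr_gt0.
Qed.

(** Elementary inequality [y <= exp y] below the exponential moment, whence the
    constant [8] instead of the exact value [1]. *)
Lemma incr_sqr s t i : 0 <= s -> s <= t ->
  (\int[P]_w (incr s t w i 0 ^+ 2)%:E <= (8 * (t - s))%:E)%E.
Proof.
move=> s0; rewrite le_eqVlt => /predU1P[<-|st].
  rewrite subrr mulr0 (eq_integral (fun=> 0%E)) ?integral0//.
  by move=> w _; rewrite /incr subrr mxE expr0n.
have ts : 0 < t - s by rewrite subr_gt0.
have t0 : 0 <= t by rewrite ltW// (le_lt_trans s0).
have k0 : 0 <= (4 * (t - s))^-1 by rewrite invr_ge0 mulr_ge0// ltW.
have hk : (4 * (t - s))^-1 * (4 * (t - s)) <= 1.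
  by rewrite mulVf// gt_eqF// mulr_gt0.
have := incr_exp_square i s0 st k0 hk; set k := _^-1 in k0 hk *.
have mI := measurable_incr i s0 t0.
have mE : measurable_fun setT (fun w => expR (k * incr s t w i 0 ^+ 2)).
  by apply: measurable_expR_comp; exact: measurable_funX.
move=> h; apply: (@le_trans _ _ (\int[P]_w (4 * (t - s) * expR (k * incr s t w i 0 ^+ 2))%:E)%E).
  apply: ge0_le_int => //.
  - exact: measurable_funX.
  - exact: measurable_funM.
  - by move=> w; exact: sqr_ge0.
  - move=> w; rewrite -ler_pdivrMl ?mulr_gt0// -/k.
    by rewrite (le_trans _ (expR_ge1Dx _))// lerDr.
rewrite [8 * _](_ : _ = 4 * (t - s) * 2); last by ring.
by apply: int_scale => //; rewrite mulr_ge0// ltW.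
Qed.

(** The increments over a grid form an independent family. The past consists of
    the events generated by the increments whose indices lie in a set [J]. *)
Section Grid.
Variables (k : nat) (t : nat -> R).
Hypotheses (t0 : 0 <= t 0%N) (tS : {homo t : i j / (i <= j)%N >-> i <= j}).

Definition grid_incr (i : 'I_k) (w : Om) : 'cV[R]_n := incr (t i) (t i.+1) w.

Lemma grid_ge0 i : 0 <= t i.
Proof. by rewrite (le_trans t0)// tS. Qed.

Lemma grid_indep : independent P (vec_sigma (p := n)) grid_incr.
Proof. by case: hW => _ _ h _; exact: h. Qed.

Lemma grid_measurable i C : vec_sigma (p := n) C -> measurable (grid_incr i @^-1` C).
Proof. by apply: measurable_incr_vec; exact: grid_ge0. Qed.

Definition grid_past (J : {set 'I_k}) := past (vec_sigma (p := n)) grid_incr J.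

Lemma grid_past_coord (J : {set 'I_k}) j c : j \in J ->
  measurable_fun setT (fun w : g_sigma_algebraType (grid_past J) => grid_incr j w c 0).
Proof.
move=> jJ; exact: (past_measurable_fun (X := grid_incr) (@gen_setT _ _) jJ
  (fun B (mB : measurable B) => vec_sigma_coord c mB)).
Qed.

Lemma grid_fubini (J : {set 'I_k}) j c (f : g_sigma_algebraType (grid_past J) * R -> \bar R) :
  j \notin J -> t j < t j.+1 -> measurable_fun setT f -> (forall z, (0 <= f z)%E) ->
  (\int[P]_w f (w, grid_incr j w c 0%R) =
   \int[P]_w \int[normal_prob 0%R (Num.sqrt (t j.+1 - t j)%R)]_y f (w, y))%E.
Proof.
move=> jJ tj mf f0.
have mY : measurable_fun setT ((fun v : 'cV[R]_n => v c 0) \o grid_incr j).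
  by apply: measurable_incr; exact: grid_ge0.
have hpsi (B : set R) : measurable B ->
  vec_sigma (p := n) ((fun v : 'cV[R]_n => v c 0) @^-1` B) by exact: vec_sigma_coord.
rewrite (past_fubini grid_indep (@gen_setT _ _) (@gen_setI _ _) grid_measurable
  mY jJ hpsi mf f0).
apply: eq_integral => w _; apply: integral_normal_law => // [B mB|].
  case: hW => _ _ _ h; have [_ h'] := h _ _ (grid_ge0 j) tj.
  exact: (h' c B mB).
apply: (measurableT_comp mf).
exact: (@measurable_fun_pair _ _ _ _ _ _ (fun=> w : g_sigma_algebraType (grid_past J)) id).
Qed.

(** The conditional expectation of the exponential factor given the past is one,
    by the formula for the Gaussian moment generating function at the value of
    [a]. *)
Lemma grid_exp_step (J : {set 'I_k}) j c (Z a : Om -> R) : j \notin J -> t j < t j.+1 ->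
  measurable_fun setT (Z : g_sigma_algebraType (grid_past J) -> R) ->
  measurable_fun setT (a : g_sigma_algebraType (grid_past J) -> R) ->
  (forall w, 0 <= Z w) ->
  (\int[P]_w (Z w * expR (a w * grid_incr j w c 0 - a w ^+ 2 * (t j.+1 - t j) / 2))%:E =
   \int[P]_w (Z w)%:E)%E.
Proof.
move=> jJ tj mZ ma Z0; set h := t j.+1 - t j.
have h0 : 0 < h by rewrite subr_gt0.
pose f (z : g_sigma_algebraType (grid_past J) * R) : \bar R :=
  (Z z.1 * expR (a z.1 * z.2 - a z.1 ^+ 2 * h / 2))%:E.
have ma1 : measurable_fun setT
    (fun z : g_sigma_algebraType (grid_past J) * R => a z.1).
  exact: measurableT_comp ma measurable_fst.
have mf : measurable_fun setT f.
  apply/measurable_EFinP; apply: measurable_funM.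
    exact: measurableT_comp mZ measurable_fst.
  apply: measurableT_comp => //; apply: measurable_funB.
    by apply: measurable_funM => //; exact: measurable_snd.
  by apply: measurable_funM => //; apply: measurable_funM => //; exact: measurable_funX.
have f0 z : (0 <= f z)%E by rewrite lee_fin mulr_ge0 ?expR_ge0.
rewrite (grid_fubini c jJ tj mf f0) /f /=.
apply: eq_integral => w _.
under eq_integral.
  move=> y _; rewrite expRD mulrCA mulrC EFinM; over.
have mE : measurable_fun setT (fun y : R => expR (a w * y)).
  by apply: measurableT_comp => //; exact: measurable_funM.
rewrite ge0_integralZl//; last 2 first.
- exact/measurable_EFinP.
- by rewrite lee_fin mulr_ge0 ?expR_ge0.
rewrite normal_mgf ?sqrtr_gt0// sqr_sqrtr ?(ltW h0)// -EFinM; congr (_%:E).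
by rewrite -/h -[LHS]mulrA -expRD addNr expR0 mulr1.
Qed.

End Grid.

End Brownian.

(** * Continuous modifications and moments of the motion *)

Section Modification.
Context {R : realType} {dOm : measure_display} {Om : measurableType dOm}.
Variable P : probability Om R.

Lemma ae_eq_prob (E F : set Om) : measurable E -> measurable F ->
  {ae P, forall w, E w <-> F w} -> P E = P F.
Proof.
move=> mE mF h; rewrite -[E]setIT -[F]setIT -!integral_indic//.
apply: ae_eq_int; [exact: measurable_indic|exact: measurable_indic|].
apply: filterS h => w hw; rewrite !indicE.
by congr (_%:R); congr nat_of_bool; apply/idP/idP => /set_mem/hw/mem_set.
Qed.

(** A process with almost surely good paths is replaced by a process all of
    whose paths are good or zero; the exceptional set is enlarged to a
    measurable one, which keeps the coordinates measurable. *)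
Lemma modification p (D : set R) (Q : Om -> Prop) (Y : Om -> R -> 'cV[R]_p) :
  {ae P, forall w, Q w} -> stochastic_process D Y ->
  exists Y', [/\ stochastic_process D Y',
    forall w, (Q w /\ Y' w = Y w) \/ Y' w = (fun=> 0) &
    {ae P, forall w, Q w /\ Y' w = Y w}].
Proof.
move=> [N [mN N0 QN]] mY.
exists (fun w => if w \in N then (fun=> 0) else Y w); split.
- move=> t Dt i.
  rewrite (_ : (fun w => _) = fun w => \1_(~` N) w * Y w t i 0).
    apply: measurable_funM; last exact: mY.
    by apply: measurable_indic; exact: measurableC.
  apply/funext => w; rewrite indicE in_setC; case: ifP => _ /=; last by rewrite mul1r.
  by rewrite mxE mul0r.
- move=> w; case: ifPn => [_|wN]; [by right|left; split=> //].
  by apply: contrapT => nQ; move/negP: wN; apply; apply/mem_set/QN.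
- exists N; split=> // w /= h; apply: contrapT => wN; apply: h.
  rewrite memNset//; split=> //.
  by apply: contrapT => nQ; apply: wN; exact: QN.
Qed.

(** Independence is a statement on probabilities of events, which a null set does
    not change. *)
Lemma independent_ae (I : finType) U (S : set (set U)) (X X' : I -> Om -> U) :
  independent P S X ->
  (forall i C, S C -> measurable (X i @^-1` C)) ->
  (forall i C, S C -> measurable (X' i @^-1` C)) ->
  {ae P, forall w, forall i, X' i w = X i w} -> independent P S X'.
Proof.
move=> hX mX mX' h J C SC.
rewrite (_ : P (\bigcap_(i in [set` J]) (X' i @^-1` C i)) =
   P (\bigcap_(i in [set` J]) (X i @^-1` C i))).
  rewrite hX//; apply: eq_bigr => i iJ; apply: ae_eq_prob.
  - by apply: mX; exact: SC.
  - by apply: mX'; exact: SC.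
  - by apply: filterS h => w hw; rewrite /preimage/= hw.
apply: ae_eq_prob.
- by apply: fin_bigcap_measurable => // i iJ; apply: mX'; exact: SC.
- by apply: fin_bigcap_measurable => // i iJ; apply: mX; exact: SC.
- apply: filterS h => w hw.
  by split=> h i iJ; have := h i iJ; rewrite /preimage/= hw.
Qed.

Lemma brownian_modification n (W : Om -> R -> 'cV[R]_n) : brownian_motion P W ->
  exists W', [/\ brownian_motion P W',
    forall w, W' w 0 = 0 /\ {within `[0, +oo[, continuous (W' w)} &
    {ae P, forall w, W' w = W w}].
Proof.
move=> hW; have [mW Wc inc law] := hW.
have [W' [mW' W'E W'ae]] := modification Wc mW.
have hW'ae : {ae P, forall w, W' w = W w} by apply: filterS W'ae => w [].
have W'c w : W' w 0 = 0 /\ {within `[0, +oo[, continuous (W' w)}.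
  case: (W'E w) => [[[h1 h2] ->]//|->]; split=> //.
  exact/continuous_subspaceT/cst_continuous.
have mI (V : Om -> R -> 'cV[R]_n) s t i : stochastic_process (`[0, +oo[ : set R) V -> 0 <= s -> 0 <= t ->
    measurable_fun setT (fun w => (V w t - V w s) i 0 : R).
  move=> mV s0 t0; under eq_fun do rewrite !mxE.
  by apply: measurable_funB; apply: mV; rewrite /= in_itv/= andbT.
have mIv (V : Om -> R -> 'cV[R]_n) s t C : stochastic_process (`[0, +oo[ : set R) V -> 0 <= s -> 0 <= t ->
    vec_sigma (p := n) C -> measurable ((fun w => V w t - V w s) @^-1` C).
  move=> mV s0 t0; apply: preimage_generated => _ [i [E [mE ->]]].
  by have := mI V s t i mV s0 t0 measurableT E mE; rewrite setTI.
exists W'; split=> //; split=> //.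
- by apply: filterS W'ae => w _; exact: W'c.
- move=> k t t0 tS; have tp i : 0 <= t i by rewrite (le_trans t0)// tS.
  apply: (independent_ae (inc k t t0 tS)).
  + by move=> i C; exact: mIv.
  + by move=> i C; exact: mIv.
  + by apply: filterS hW'ae => w -> i.
- move=> s t s0 st; have t0 : 0 <= t by rewrite ltW// (le_lt_trans s0).
  have [h1 h2] := law s t s0 st; split=> [|c E mE].
    apply: (independent_ae h1) => [c E mE|c E mE|].
    + by have := mI _ s t c mW s0 t0 measurableT E mE; rewrite setTI.
    + by have := mI _ s t c mW' s0 t0 measurableT E mE; rewrite setTI.
    + by apply: filterS hW'ae => w -> c.
  rewrite -(h2 c E mE); apply: ae_eq_prob.
  + by have := mI _ s t c mW' s0 t0 measurableT E mE; rewrite setTI.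
  + by have := mI _ s t c mW s0 t0 measurableT E mE; rewrite setTI.
  + by apply: filterS hW'ae => w /= ->.
Qed.

End Modification.

Section NoiseMoments.
Context {R : realType} {dOm : measure_display} {Om : measurableType dOm}.
Variable P : probability Om R.
Variables (n : nat) (n0 : (0 < n)%N) (T : R) (T0 : 0 < T).
Variables (W : Om -> R -> 'cV[R]_n) (hW : brownian_motion P W).
Hypothesis hWc : forall w, W w 0 = 0 /\ {within `[0, +oo[, continuous (W w)}.

Lemma noise_incr t w : W w t = incr W 0 t w.
Proof. by rewrite /incr (hWc w).1 subr0. Qed.

Lemma noise_cont w : {within `[0, T], continuous (W w)}.
Proof.
apply: continuous_subspaceW (hWc w).2 => x /=.
by rewrite !in_itv/= andbT => /andP[].
Qed.

Lemma noise_measurable t i : 0 <= t -> measurable_fun setT (fun w => W w t i 0).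
Proof. exact: (measurable_W hW). Qed.

Lemma noise_process i : process T (fun w t => W w t i 0).
Proof.
apply: (process_cont T0) => [w|t /andP[t0 _]]; last exact: noise_measurable.
by apply: cont_entry; exact: noise_cont.
Qed.

Lemma noise_sqnorm_process : process T (fun w t => sqnorm (W w t)).
Proof.
apply: (process_sum T0) => i.
rewrite (_ : (fun _ _ => _) = fun w t => W w t i 0 * W w t i 0).
  by apply: processM; exact: noise_process.
by apply/funext => w; apply/funext => t; rewrite expr2.
Qed.

Lemma noise_sqnorm_measurable t : 0 <= t <= T -> measurable_fun setT (fun w => sqnorm (W w t)).
Proof. exact: (process_at noise_sqnorm_process). Qed.

(** Jensen's inequality over the [n] coordinates, whence the factor [n] in the
    condition on [k]. *)
Lemma noise_exp_sqnorm t (k : R) : 0 <= t <= T -> 0 <= k -> k * n%:R * (4 * T) <= 1 ->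
  (\int[P]_w (expR (k * sqnorm (W w t)))%:E <= 2%:E)%E.
Proof.
move=> /andP[t0 tT] k0 hk.
have nn : n%:R != 0 :> R by rewrite pnatr_eq0 -lt0n.
have h i : (\int[P]_w (expR (k * n%:R * W w t i 0 ^+ 2))%:E <= 2%:E)%E.
  move: t0; rewrite le_eqVlt => /predU1P[<-|t0].
    under eq_integral do rewrite (hWc _).1 mxE expr0n mulr0 expR0.
    by rewrite integral_cst//= mul1e probability_setT lee_fin ler1n.
  under eq_integral do rewrite noise_incr.
  apply: (incr_exp_square hW) => //; first by rewrite mulr_ge0.
  apply: le_trans hk; rewrite subr0 ler_wpM2l ?mulr_ge0// ler_wpM2l//.
have mk i : measurable_fun setT (fun w => k * n%:R * W w t i 0 ^+ 2).
  by apply: measurable_funM => //; apply: measurable_funX; exact: noise_measurable.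
have e w : k * sqnorm (W w t) = n%:R^-1 * \sum_i k * n%:R * W w t i 0 ^+ 2.
  by rewrite -mulr_sumr -/(sqnorm (W w t)) [k * n%:R]mulrC -mulrA mulKf.
under eq_integral do rewrite e.
exact: int_expR_mean.
Qed.

(** Jensen for the uniform law on [[0, T]], from the tangent at the mean. *)
Lemma expR_integ_le (y : R -> R) : bmeas T y -> bmeas T (fun t => expR (T * y t)) ->
  expR (integ y 0 T) <= T^-1 * integ (fun t => expR (T * y t)) 0 T.
Proof.
move=> by_ be; set m := integ y 0 T.
have b1 : bmeas T (fun t => expR m * T * y t) by exact: (bmeasM (bmeas_cst T (expR m * T))).
have b2 : bmeas T (fun t => expR m * (1 - m) + expR m * T * y t).
  by apply: bmeasD => //; exact: bmeas_cst.
have : integ (fun t => expR m * (1 - m) + expR m * T * y t) 0 T <=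
    integ (fun t => expR (T * y t)) 0 T.
  apply: (le_integ b2 be) => // x _.
  have -> : expR (T * y x) = expR m * expR (T * y x - m) by rewrite -expRD addrC subrK.
  rewrite -mulrA -mulrDr ler_wpM2l ?expR_ge0//.
  by apply: le_trans (expR_ge1Dx _); rewrite -addrA [- m + _]addrC.
have -> := integD (bmeas_cst T (expR m * (1 - m))) b1 (lexx 0) (lexx T).
have -> := integZ (expR m * T) by_ (lexx 0) (lexx T).
rewrite integ_cst ?(ltW T0)//.
rewrite -/m => h.
rewrite ler_pdivlMl//; apply: le_trans h.
by rewrite subr0 [leRHS](_ : _ = T * expR m)//; ring.
Qed.

Lemma noise_sqnorm_mean t : 0 <= t <= T ->
  (\int[P]_w (sqnorm (W w t))%:E <= (n%:R * (8 * T))%:E)%E.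
Proof.
move=> ht; have /andP[t0 tT] := ht.
have := @int_sum _ _ _ P _ (index_enum 'I_n) (fun i w => W w t i 0 ^+ 2) (8 * T).
rewrite [size _](_ : _ = n); last by rewrite -[RHS]card_ord cardT enumT.
apply=> [i|i w|i]; [|exact: sqr_ge0|].
  by apply: measurable_funX; exact: noise_measurable.
under eq_integral do rewrite noise_incr.
apply: (le_trans (incr_sqr hW i (lexx _) t0)).
by rewrite lee_fin subr0 ler_wpM2l.
Qed.

Lemma noise_sqnorm_integ s t : 0 <= s -> s <= t -> t <= T ->
  measurable_fun setT (fun w => integ (fun r => sqnorm (W w r)) s t) /\
  (\int[P]_w (integ (fun r => sqnorm (W w r)) s t)%:E <= (n%:R * (8 * T) * (t - s))%:E)%E.
Proof.
move=> s0 st tT.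
apply: (process_integ_mean_le T0 noise_sqnorm_process _ _ s0 st tT).
  by move=> w r; exact: sqnorm_ge0.
exact: noise_sqnorm_mean.
Qed.

(** Jensen's inequality in time reduces the functional of the whole path to its
    values at single times. *)
Lemma sqnorm_integ_exp (k : R) : 0 <= k -> k * T * n%:R * (4 * T) <= 1 ->
  (\int[P]_w (expR (k * integ (fun s => sqnorm (W w s)) 0 T))%:E <= 2%:E)%E.
Proof.
move=> k0 hk.
pose Y w s := expR (T * (k * sqnorm (W w s))).
have Y0 w s : 0 <= Y w s by exact: expR_ge0.
have pS := noise_sqnorm_process.
have pY : process T Y.
  apply: process_expR; apply: processM; first exact: (process_det _ (bmeas_cst T T)).
  by apply: processM => //; exact: (process_det _ (bmeas_cst T k)).
have hC t : 0 <= t <= T -> (\int[P]_w (Y w t)%:E <= 2%:E)%E.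
  move=> ht; rewrite /Y; under eq_integral do rewrite mulrA [T * k]mulrC.
  by apply: noise_exp_sqnorm => //; rewrite mulr_ge0// ltW.
have [mI EI] := process_integ_mean_le T0 pY Y0 hC (lexx _) (ltW T0) (lexx _).
have [mS _] := noise_sqnorm_integ (lexx _) (ltW T0) (lexx _).
apply: (@le_trans _ _ (\int[P]_w (T^-1 * integ (Y w) 0 T)%:E)%E).
  apply: ge0_le_int.
  - exact: measurable_expR_comp.
  - exact: measurable_funM.
  - by move=> w; exact: expR_ge0.
  - move=> w; rewrite -(integZ (T := T))//; last by case: pS.
    apply: expR_integ_le; last by case: pY => _ h; exact: h.
    by apply: (bmeasM (bmeas_cst T k)); case: pS.
have -> : 2%:E = (T^-1 * (2 * (T - 0)))%:E :> \bar R.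
  by rewrite subr0 mulrCA mulVf ?mulr1// gt_eqF.
apply: int_scale => //; first by rewrite invr_ge0 ltW.
by move=> w; apply: integ_ge0.
Qed.

End NoiseMoments.

(** * Exponential moments of discrete sums of the motion *)

Section NoiseSums.
Context {R : realType} {dOm : measure_display} {Om : measurableType dOm}.
Variable P : probability Om R.
Variables (n : nat) (n0 : (0 < n)%N) (T : R) (T0 : 0 < T).
Variables (W : Om -> R -> 'cV[R]_n) (hW : brownian_motion P W).
Hypothesis hWc : forall w, W w 0 = 0 /\ {within `[0, +oo[, continuous (W w)}.

(** Both the time integral and its Riemann sum are needed, the latter because the
    regression samples the motion at the grid points; the end point comes from
    the boundary term of a summation by parts. *)
Definition grid_energy (N : nat) (x : R -> 'cV[R]_n) : R :=
  energy T x + (sqnorm (x T) + N%:R^-1 * \sum_(i < N) sqnorm (x (i%:R * (T / N%:R)))).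

Lemma grid_time N i : (i <= N)%N -> (0 < N)%N -> 0 <= i%:R * (T / N%:R) <= T.
Proof.
move=> iN N0; have N0' : 0 < N%:R :> R by rewrite ltr0n.
rewrite mulr_ge0 ?divr_ge0 ?(ltW T0)// ?(ltW N0')//= mulrCA -[leRHS]mulr1 ler_wpM2l ?(ltW T0)//.
by rewrite ler_pdivrMr// mul1r ler_nat.
Qed.

Lemma grid_mean_exp N (k : R) : (0 < N)%N -> 0 <= k -> k * n%:R * (4 * T) <= 1 ->
  measurable_fun setT (fun w => N%:R^-1 * \sum_(i < N) sqnorm (W w (i%:R * (T / N%:R)))) /\
  (\int[P]_w (expR (k * (N%:R^-1 * \sum_(i < N) sqnorm (W w (i%:R * (T / N%:R))))))%:E <= 2%:E)%E.
Proof.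
move=> N0 k0 hk.
have mS (i : 'I_N) : measurable_fun setT (fun w => sqnorm (W w (i%:R * (T / N%:R)))).
  by apply: (noise_sqnorm_measurable T0 hW hWc); apply: grid_time => //; exact: ltnW.
split; first by apply: measurable_funM => //; exact: measurable_sum.
under eq_integral do rewrite mulrCA mulr_sumr.
apply: int_expR_mean => // i; first exact: measurable_funM.
apply: (noise_exp_sqnorm (T := T) n0 hW hWc) => //.
by apply: grid_time => //; exact: ltnW.
Qed.

(** The three parts have exponential moments but are dependent; [int_expR_half]
    separates them, and [k] is small enough for the doubled exponents. *)
Lemma grid_energy_exp : exists k M, [/\ 0 < k, 0 <= M & forall N, (0 < N)%N ->
  measurable_fun setT (fun w => grid_energy N (W w)) /\
  (\int[P]_w (expR (k * grid_energy N (W w)))%:E <= M%:E)%E].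
Proof.
pose k := (16 * n%:R * T * (1 + T))^-1.
have n0' : 1 <= n%:R :> R by rewrite ler1n.
have nT : 0 < 16 * n%:R * T * (1 + T) by rewrite !mulr_gt0// ?addr_gt0// (lt_le_trans _ n0').
have k0 : 0 < k by rewrite invr_gt0.
have kE : k * (16 * n%:R * T * (1 + T)) = 1 by rewrite mulVf// gt_eqF.
have p1 : 0 < k * n%:R * T by rewrite !mulr_gt0// (lt_le_trans _ n0').
have p2 : 0 < k * n%:R * T * T by rewrite mulr_gt0.
have h1 : 4 * k * n%:R * (4 * T) <= 1 by nra.
have h2 : 2 * k * T * n%:R * (4 * T) <= 1 by nra.
exists k, (expR (2 * k) * 2 + (2 + 2) / 2 : R); split=> //.
move=> N N0; have k4 : 0 <= 4 * k by rewrite mulr_ge0// ltW.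
have [mM hM] := grid_mean_exp N0 k4 h1.
have TT : 0 <= T <= T by rewrite ltW//=.
have mS := noise_sqnorm_measurable T0 hW hWc TT.
have hS := noise_exp_sqnorm n0 hW hWc TT k4 h1.
have [mI _] := noise_sqnorm_integ T0 hW hWc (lexx 0) (ltW T0) (lexx T).
have k2 : 0 <= 2 * k by rewrite mulr_ge0// ltW.
have hI := sqnorm_integ_exp n0 T0 hW hWc k2 h2.
have mE : measurable_fun setT (fun w => energy T (W w)) by exact: measurable_funD.
have mR : measurable_fun setT (fun w => sqnorm (W w T) +
    N%:R^-1 * \sum_(i < N) sqnorm (W w (i%:R * (T / N%:R)))) by exact: measurable_funD.
split; first exact: measurable_funD.
rewrite /grid_energy; under eq_integral do rewrite mulrDr.
apply: (@le_trans _ _ (((expR (2 * k) * 2 + (2 + 2) / 2) / 2)%:E)); last first.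
  have := expR_ge0 (2 * k); rewrite lee_fin; lra.
apply: int_expR_half; [exact: measurable_funM|exact: measurable_funM| |].
- rewrite /energy; under eq_integral do rewrite mulrDr mulr1 mulrDr expRD mulrA.
  by apply: int_scale => //; exact: measurable_expR_comp.
- under eq_integral do rewrite mulrA mulrDr.
  apply: int_expR_half; [exact: measurable_funM|exact: measurable_funM| |].
  + by under eq_integral do rewrite !mulrA -natrM.
  + by under eq_integral do rewrite mulrA (mulrA 2 2 k) -natrM.
Qed.

Section Sum.
Variables (N : nat) (N0 : (0 < N)%N) (h : nat -> 'I_n -> R) (b : 'I_n).
Let tau := T / N%:R.
Let t (i : nat) : R := i%:R * tau.
Let a (l : nat) (w : Om) : R := \sum_c h l c * W w (t l) c 0.
Let xi (l : nat) (w : Om) : R := incr W (t l) (t l.+1) w b 0.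

Definition noise_sum (x : R -> 'cV[R]_n) : R :=
  \sum_(l < N) (\sum_c h l c * x (t l) c 0) * (x (t l.+1) - x (t l)) b 0.

Let tau0 : 0 < tau. Proof. by rewrite divr_gt0// ltr0n. Qed.

Let tS : {homo t : i j / (i <= j)%N >-> i <= j}.
Proof. by move=> i j ij; rewrite /t ler_wpM2r ?ler_nat// ltW. Qed.

Let t0 : 0 <= t 0%N. Proof. by rewrite /t mul0r. Qed.

Let tlt i : t i < t i.+1.
Proof. by rewrite /t ltr_pM2r// ltr_nat. Qed.

Let tstep i : t i.+1 - t i = tau.
Proof. by rewrite /t -natr1 mulrDl mul1r addrAC subrr add0r. Qed.

Let before (j : nat) : {set 'I_N} := [set i : 'I_N | (i < j)%N]%SET.

Let measurable_xi (j l : nat) c : (l < j)%N -> (j <= N)%N -> measurable_fun setT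
  ((fun w => incr W (t l) (t l.+1) w c 0) :
     g_sigma_algebraType (grid_past W t (before j)) -> R).
Proof.
move=> lj jN; have lN := leq_trans lj jN.
have := @grid_past_coord _ _ _ _ W _ t (before j) (Ordinal lN) c.
by rewrite inE; exact.
Qed.

Let noise_telescope l w : W w (t l) = \sum_(i < l) incr W (t i) (t i.+1) w.
Proof.
elim: l => [|l IH]; first by rewrite big_ord0 /t mul0r; exact: (hWc w).1.
by rewrite big_ord_recr /= -IH /incr addrC subrK.
Qed.

Let measurable_a (j l : nat) : (l <= j)%N -> (j <= N)%N -> measurable_fun setT
  (a l : g_sigma_algebraType (grid_past W t (before j)) -> R).
Proof.
move=> lj jN; apply: measurable_sum => c; apply: measurable_funM => //.
rewrite (_ : (fun w => W w (t l) c 0) =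
  fun w => \sum_(i < l) incr W (t i) (t i.+1) w c 0); last first.
  by apply/funext => w; rewrite noise_telescope summxE.
by apply: measurable_sum => i; apply: measurable_xi => //; exact: leq_trans lj.
Qed.

(** The exponential martingale of the discrete stochastic integral. *)
Let expmart (mu : R) (j : nat) (w : Om) : R :=
  expR (\sum_(l < j) (mu * a l w * xi l w - (mu * a l w) ^+ 2 * tau / 2)).

Let expmart_mean mu j : (j <= N)%N -> (\int[P]_w (expmart mu j w)%:E = 1)%E.
Proof.
elim: j => [_|j IH jN].
  rewrite /expmart; under eq_integral do rewrite big_ord0 expR0.
  by rewrite integral_cst//= mul1e probability_setT.
rewrite -(IH (ltnW jN)).
rewrite -(@grid_exp_step _ _ _ P _ _ hW N t t0 tS (before j) (Ordinal jN) b
  (expmart mu j) (fun w => mu * a j w))//=; first last.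
- by move=> w; exact: expR_ge0.
- by apply: measurable_funM => //; apply: measurable_a => //; exact: ltnW.
- apply: measurableT_comp => //; apply: measurable_sum => l.
  apply: measurable_funB.
    apply: measurable_funM.
      by apply: measurable_funM => //; apply: measurable_a; exact: ltnW.
    by apply: measurable_xi; [exact: ltn_ord|exact: ltnW].
  do 2 apply: measurable_funM => //; apply: measurable_funX.
  by apply: measurable_funM => //; apply: measurable_a; exact: ltnW.
- by rewrite inE ltnn.
apply: eq_integral => w _; rewrite /expmart big_ord_recr /= expRD.
by rewrite tstep.
Qed.

Lemma noise_sum_measurable : measurable_fun setT (fun w => noise_sum (W w)).
Proof.
apply: measurable_sum => l; apply: measurable_funM.
  apply: measurable_sum => c; apply: measurable_funM => //.
  by apply: (noise_measurable hW); rewrite mulr_ge0// ltW.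
by apply: (measurable_incr hW); rewrite mulr_ge0// ltW.
Qed.

(** With [y = l ^ 2 tau sum_i a_i ^ 2], [exp (2 (l S - y))] is the exponential
    martingale at [2 l], of mean one, while [2 y] is at most a multiple of the
    Riemann sum of the squared motion, which has an exponential moment when [l] is
    small. The two are separated by [int_expR_half]. *)
Lemma noise_sum_exp_le (k l : R) : 0 <= k -> (forall i c, (i < N)%N -> `|h i c| <= k) ->
  l ^+ 2 * (8 * n%:R ^+ 3 * k ^+ 2 * T ^+ 2) <= 1 ->
  (\int[P]_w (expR (l * noise_sum (W w)))%:E <= 2%:E)%E.
Proof.
move=> k0 hk hl.
pose y w := l ^+ 2 * tau * \sum_(i < N) a i w ^+ 2.
pose x w := l * noise_sum (W w) - y w.
have ma i : measurable_fun setT (a i).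
  apply: measurable_sum => c; apply: measurable_funM => //.
  by apply: (noise_measurable hW); rewrite mulr_ge0// ltW.
have my : measurable_fun setT y.
  by apply: measurable_funM => //; apply: measurable_sum => i; exact: measurable_funX.
have mx : measurable_fun setT x.
  by apply: measurable_funB => //; apply: measurable_funM => //; exact: noise_sum_measurable.
under eq_integral => w _ do rewrite -[l * _](subrK (y w)) -/(x w).
apply: (@le_trans _ _ (((1 + 2) / 2)%:E)); last by rewrite lee_fin; lra.
apply: int_expR_half => //.
  rewrite -(expmart_mean (2 * l) (leqnn N)) le_eqVlt; apply/orP; left; apply/eqP.
  apply: eq_integral => w _; rewrite /expmart; do 2 congr (_ _).
  rewrite /x /y /noise_sum !mulr_sumr -sumrB mulr_sumr; apply: eq_bigr => i _.
  by rewrite /xi /incr -/(a i w); field.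
pose kap := 2 * l ^+ 2 * (n%:R * k) ^+ 2 * T.
have kap0 : 0 <= kap.
  by rewrite /kap mulr_ge0// ?(ltW T0)//; apply: mulr_ge0; [apply: mulr_ge0 => //|]; exact: sqr_ge0.
have hkap : kap * n%:R * (4 * T) <= 1.
  by apply: le_trans hl; rewrite le_eqVlt /kap; apply/orP; left; apply/eqP; ring.
have [mM hM] := grid_mean_exp N0 kap0 hkap.
apply: le_trans hM; apply: ge0_le_int.
- exact: measurable_expR_comp.
- exact: measurable_expR_comp.
- by move=> w; exact: expR_ge0.
move=> w; rewrite ler_expR /y /kap -/tau.
have -> : 2 * (l ^+ 2 * tau * \sum_(i < N) a i w ^+ 2) =
  2 * l ^+ 2 * tau * \sum_(i < N) a i w ^+ 2 by ring.
have -> : 2 * l ^+ 2 * (n%:R * k) ^+ 2 * T *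
  (N%:R^-1 * \sum_(i < N) sqnorm (W w (i%:R * tau))) =
  2 * l ^+ 2 * tau * \sum_(i < N) (n%:R * k) ^+ 2 * sqnorm (W w (i%:R * tau)).
  by rewrite -mulr_sumr /tau; ring.
rewrite ler_wpM2l//.
  by apply: mulr_ge0; [apply: mulr_ge0 => //; exact: sqr_ge0|exact: ltW].
apply: ler_sum => i _.
apply: (@le_trans _ _ ((n%:R * k * `|W w (t i)|) ^+ 2)); last first.
  rewrite exprMn ler_wpM2l ?sqr_ge0//; exact: sqr_mxnorm.
rewrite -ler_sqrt ?sqr_ge0// !sqrtr_sqr [leRHS]ger0_norm ?mulr_ge0//.
apply: (le_trans (ler_norm_sum _ _ _)).
rewrite -mulrA mulr_natl -[X in _ *+ X]card_ord -sumr_const; apply: ler_sum => c _.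
by rewrite normrM ler_pM// ?hk// mx_norm_entry.
Qed.

End Sum.

Lemma noise_sum_exp (k : R) : 0 <= k -> exists2 l, 0 < l & forall N h b, (0 < N)%N ->
  (forall i c, (i < N)%N -> `|h i c| <= k) ->
  (\int[P]_w (expR (l * `|noise_sum N h b (W w)|))%:E <= 4%:E)%E.
Proof.
move=> k0; pose q := 8 * n%:R ^+ 3 * k ^+ 2 * T ^+ 2.
have q0 : 0 <= q by rewrite /q !mulr_ge0// ?exprn_ge0// ltW.
have q1 : 0 < 1 + q by rewrite ltr_wpDr.
have hl : (1 + q)^-1 ^+ 2 * q <= 1.
  rewrite exprVn mulrC ler_pdivrMr ?exprn_gt0// mul1r; nra.
exists (1 + q)^-1; first by rewrite invr_gt0.
move=> N h b N0 hk; set l := _^-1 in hl *.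
have l0 : 0 <= l by rewrite invr_ge0 ltW.
have hp := @noise_sum_exp_le N N0 h b _ _ k0 hk hl.
have hm : (\int[P]_w (expR (- l * noise_sum N h b (W w)))%:E <= 2%:E)%E.
  by apply: (@noise_sum_exp_le N N0 h b _ _ k0 hk); rewrite sqrrN.
have mS := noise_sum_measurable N0 h b.
apply: (@le_trans _ _ (\int[P]_w ((expR (l * noise_sum N h b (W w)))%:E +
   (expR (- l * noise_sum N h b (W w)))%:E))%E).
  apply: ge0_le_int.
  - by apply: measurable_expR_comp; exact: measurableT_comp.
  - by apply: measurable_funD; exact: measurable_expR_comp.
  - by move=> w; exact: expR_ge0.
  - move=> w; have := expR_ge0 (l * noise_sum N h b (W w)).
    have := expR_ge0 (- l * noise_sum N h b (W w)).
    by case: (ger0P (noise_sum N h b (W w))) => _; rewrite ?mulrN ?mulNr; lra.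
rewrite ge0_integralD//; first last.
- by apply/measurable_EFinP; exact: measurable_expR_comp.
- by apply/measurable_EFinP; exact: measurable_expR_comp.
by apply: (le_trans (leeD hp hm)); rewrite -EFinD lee_fin -natrD.
Qed.

End NoiseSums.

(** * Orthogonality of the increments to the past motion *)

(** Dividing by a small [l] of the sign of [s] would make [|s|] smaller than any
    positive number. *)
Lemma small_quadratic_zero {R : realType} (z s c : R) : 0 <= z -> 0 < c ->
  (forall l, l * s <= z * (expR (c * l ^+ 2) - 1)) -> s = 0.
Proof.
move=> z0 c0 h.
have key (r : R) : (forall l, l * r <= z * (expR (c * l ^+ 2) - 1)) -> r <= 0.
  move=> hr; rewrite leNgt; apply/negP => r0.
  pose D := 2 * c + 2 * z * c + r + 1.
  have zc : 0 <= z * c by rewrite mulr_ge0// ltW.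
  have D0 : 0 < D by rewrite /D; nra.
  pose l := Num.min 1 r / D.
  have m0 : 0 < Num.min 1 r by rewrite lt_min ltr01.
  have l0 : 0 < l by rewrite divr_gt0.
  have lD : l * D = Num.min 1 r by rewrite divfK// gt_eqF.
  have m1 : l * D <= 1 by rewrite lD ge_min lexx.
  have m2 : l * D <= r by rewrite lD ge_min lexx orbT.
  have lc : 0 < l * c by rewrite mulr_gt0.
  have lr : 0 < l * r by rewrite mulr_gt0.
  have lzc : 0 <= l * (z * c) by rewrite mulr_ge0// ltW.
  have l1 : l <= 1 by rewrite /D in m1; nra.
  have x0 : 0 <= c * l ^+ 2 by rewrite mulr_ge0 ?sqr_ge0// ltW.
  have hx : c * l ^+ 2 <= 1 / 2 by rewrite /D in m1; nra.
  have hex : expR (c * l ^+ 2) - 1 <= 2 * (c * l ^+ 2).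
    have h1 := expR_ge1Dx (- (c * l ^+ 2)); have h2 := expR_gt0 (c * l ^+ 2).
    have h3 : expR (c * l ^+ 2) * expR (- (c * l ^+ 2)) = 1 by rewrite -expRD subrr expR0.
    set e := expR _ in h2 h3 *; set x := c * l ^+ 2 in h1 hx x0 *.
    have h4 : e * (1 - x) <= 1 by rewrite -[leRHS]h3 ler_wpM2l// ltW.
    nra.
  have h5 := le_trans (hr l) (ler_wpM2l z0 hex).
  have h6 : r <= 2 * (z * c) * l.
    have : l * r <= l * (2 * (z * c) * l) by rewrite (le_trans h5)//; lra.
    by rewrite ler_pM2l.
  have h7 : l * (2 * c + r + 1) > 0 by rewrite mulr_gt0//; lra.
  by rewrite /D in m2; lra.
apply/eqP; rewrite eq_le key//= -oppr_le0 key// => l.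
by have := h (- l); rewrite sqrrN mulrN mulNr.
Qed.

Section NoiseOrth.
Context {R : realType} {dOm : measure_display} {Om : measurableType dOm}.
Variable P : probability Om R.
Variables (n : nat) (n0 : (0 < n)%N) (T : R) (T0 : 0 < T).
Variables (W : Om -> R -> 'cV[R]_n) (hW : brownian_motion P W).
Hypothesis hWc : forall w, W w 0 = 0 /\ {within `[0, +oo[, continuous (W w)}.

Lemma noise_coord_sqr t a : 0 <= t ->
  (\int[P]_w (W w t a 0 ^+ 2)%:E <= (8 * t)%:E)%E.
Proof.
move=> t0; under eq_integral do rewrite (noise_incr hWc).
by rewrite (le_trans (incr_sqr hW a (lexx 0) t0))// subr0.
Qed.

(** Increments have mean zero given the past: the mean of [Z exp (l Y)] does
    not exceed that of [Z] by more than a quadratic term in [l], while it is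
    at least [E Z + l E (Z Y)]. *)
Lemma noise_orth u v t a b : 0 <= u -> u <= v -> v <= t ->
  (\int[P]_w (W w u a 0 * incr W v t w b 0))%R = 0 /\ (\int[P]_w incr W v t w b 0)%R = 0.
Proof.
move=> u0 uv vt; have v0 := le_trans u0 uv; have t0 := le_trans v0 vt.
have mU := noise_measurable hW a u0; have mY := measurable_incr hW b v0 t0.
have hU := noise_coord_sqr a u0; have hY := incr_sqr hW b v0 vt.
have mUY : measurable_fun setT (fun w => W w u a 0 * incr W v t w b 0) by exact: measurable_funM.
have [iUY _] := abs_mean_le mUY (int_prod_le ltr01 mU mY hU hY).
move: vt; rewrite le_eqVlt => /predU1P[vt|vt].
  by split; rewrite /Rintegral integral0_eq// => w _; rewrite vt /incr subrr mxE ?mulr0.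
pose g (i : nat) : R := match i with 0%N => 0 | 1%N => u | 2%N => v | _ => t end.
have gS : {homo g : i j / (i <= j)%N >-> i <= j}.
  by case=> [|[|[|i]]] [|[|[|j]]]//= _; rewrite ?lexx// ?(le_trans uv) ?ltW//.
pose J : {set 'I_3} := [set ord0]%SET.
have oJ : (ord_max : 'I_3) \notin J by rewrite inE.
have mG : measurable_fun setT
   ((fun w => W w u a 0) : g_sigma_algebraType (grid_past W g J) -> R).
  rewrite (_ : (fun w => _) = fun w => grid_incr W g (ord0 : 'I_3) w a 0).
    by apply: grid_past_coord; rewrite inE.
  by apply/funext => w; rewrite (noise_incr hWc).
have core (Z : Om -> R) q : (forall w, 0 <= Z w) -> 
    measurable_fun setT (Z : g_sigma_algebraType (grid_past W g J) -> R) ->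
    measurable_fun setT Z -> (\int[P]_w (Z w ^+ 2)%:E <= q%:E)%E ->
    P.-integrable setT (EFin \o (fun w => Z w * incr W v t w b 0)) /\
    (\int[P]_w (Z w * incr W v t w b 0))%R = 0.
  move=> Z0 mZG mZ hZ.
  have mZY : measurable_fun setT (fun w => Z w * incr W v t w b 0) by exact: measurable_funM.
  have [iZY _] := abs_mean_le mZY (int_prod_le ltr01 mZ mY hZ hY).
  have h1 : (\int[P]_w (1 ^+ 2)%:E <= 1%:E :> \bar R)%E.
    by rewrite expr1n integral_cst//= mul1e probability_setT.
  have [iZ _] : P.-integrable setT (EFin \o Z) /\ `|(\int[P]_w Z w)%R| <= (1 * q + 1^-1 * 1) / 2.
    apply: abs_mean_le => //.
    have := int_prod_le ltr01 mZ (@measurable_cst _ _ Om R setT 1) hZ h1.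
    by under eq_integral do rewrite mulr1.
  split=> //.
  have tv : 0 < (t - v) / 2 by rewrite divr_gt0// subr_gt0.
  have z0 : 0 <= (\int[P]_w Z w)%R by apply: Rintegral_ge0.
  apply: (small_quadratic_zero z0 tv) => l.
  have e1 : (\int[P]_w (Z w * expR (l * incr W v t w b 0))%:E =
     ((\int[P]_w Z w)%R * expR ((t - v) / 2 * l ^+ 2))%:E)%E.
    have := @grid_exp_step _ _ _ P _ _ hW 3 g (lexx _) gS J ord_max b Z (fun=> l) oJ vt
      mZG (@measurable_cst _ _ _ _ _ _) Z0.
    under eq_integral => w _.
      rewrite /grid_incr /= expRD mulrA mulrC EFinM; over.
    rewrite ge0_integralZl//; first last.
    - by move=> w _; rewrite lee_fin mulr_ge0// expR_ge0.
    - by apply/measurable_EFinP; apply: measurable_funM => //; exact: measurable_expR_comp.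
    rewrite -[in RHS](@fineK _ (\int[P]_w (Z w)%:E)%E); last exact: integrable_fin_num.
    move=> /(congr1 (fun x => (expR (l ^+ 2 * (t - v) / 2))%:E * x)%E).
    rewrite muleA -EFinM -expRD subrr expR0 mul1e => ->.
    rewrite -EFinM mulrC; congr (_ * expR _)%:E; ring.
  have iE : P.-integrable setT (EFin \o (fun w => Z w * expR (l * incr W v t w b 0))).
    apply/integrableP; split.
      by apply/measurable_EFinP; apply: measurable_funM => //; exact: measurable_expR_comp.
    under eq_integral do rewrite /= ger0_norm ?mulr_ge0 ?expR_ge0//.
    by rewrite e1 ltry.
  have e2 : (\int[P]_w (Z w * expR (l * incr W v t w b 0)))%R =
      (\int[P]_w Z w)%R * expR ((t - v) / 2 * l ^+ 2) by rewrite /Rintegral e1.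
  have il : P.-integrable setT (EFin \o (fun w => l * (Z w * incr W v t w b 0))).
    exact: (integrableZl measurableT l iZY).
  rewrite mulrBr mulr1 -e2 lerBrDl -RintegralZl// -RintegralD//.
  apply: le_Rintegral => //.
    exact: (integrableD measurableT iZ il).
  move=> w _; rewrite /= [l * _]mulrCA -{1}[Z w]mulr1 -mulrDr ler_wpM2l//.
  exact: expR_ge1Dx.
have mA : measurable_fun setT
   ((fun w => `|W w u a 0|) : g_sigma_algebraType (grid_past W g J) -> R).
  exact: measurableT_comp.
have mA' : measurable_fun setT (fun w => `|W w u a 0|) by exact: measurableT_comp.
have h4 : (\int[P]_w (4 * W w u a 0 ^+ 2)%:E <= (4 * (8 * u))%:E)%E.
  by apply: int_scale => //; [exact: measurable_funX|move=> w; exact: sqr_ge0].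
have mU2 : measurable_fun setT (fun w => 4 * W w u a 0 ^+ 2).
  by apply: measurable_funM => //; exact: measurable_funX.
have hA : (\int[P]_w (`|W w u a 0| ^+ 2)%:E <= (4 * (8 * u))%:E)%E.
  apply: le_trans h4; apply: ge0_le_int => //; first exact: measurable_funX.
  by move=> w; rewrite real_normK ?num_real//; have := sqr_ge0 (W w u a 0); lra.
have hB : (\int[P]_w ((`|W w u a 0| + W w u a 0) ^+ 2)%:E <= (4 * (8 * u))%:E)%E.
  apply: le_trans h4; apply: ge0_le_int => //.
  - by apply: measurable_funX; exact: measurable_funD.
  - by move=> w; exact: sqr_ge0.
  - move=> w; have := sqr_ge0 (W w u a 0).
    by case: (ger0P (W w u a 0)) => _ h; lra.
have [i1 z1] := core (fun w => `|W w u a 0|) _ (fun w => normr_ge0 _) mA mA' hA.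
have B0 w : 0 <= `|W w u a 0| + W w u a 0 by have := lerNnormlW (lexx `|W w u a 0|); lra.
have [i2 z2] := core (fun w => `|W w u a 0| + W w u a 0) _ B0
  (measurable_funD mA mG) (measurable_funD mA' mU) hB.
have h1 : (\int[P]_w (1 ^+ 2)%:E <= 1%:E :> \bar R)%E.
  by rewrite expr1n integral_cst//= mul1e probability_setT.
have m1 D : measurable_fun D ((fun=> 1) : g_sigma_algebraType (grid_past W g J) -> R) by [].
have [_ z3] := core (fun=> 1) 1 (fun _ => ler01) (m1 setT) (@measurable_cst _ _ Om R setT 1) h1.
split; last by under eq_Rintegral do rewrite -[incr W v t _ b 0]mul1r.
have -> : (fun w => W w u a 0 * incr W v t w b 0) = (fun w =>
   (`|W w u a 0| + W w u a 0) * incr W v t w b 0 - `|W w u a 0| * incr W v t w b 0).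
  by apply/funext => w; rewrite mulrDl addrAC subrr add0r.
by rewrite RintegralB// z1 z2 subrr.
Qed.

End NoiseOrth.

(** * The regression sums along a path *)

Lemma abel_sum {R : comPzRingType} (g w : nat -> R) N :
  \sum_(i < N) g i * (w i.+1 - w i) =
  g N * w N - g 0%N * w 0%N - \sum_(i < N) (g i.+1 - g i) * w i.+1.
Proof.
elim: N => [|N IH]; first by rewrite !big_ord0 subrr subr0.
rewrite !big_ord_recr /= IH; ring.
Qed.

Ltac nonneg := repeat first
  [ assumption | exact: ler01 | exact: ler0n | exact: sqr_ge0 | exact: normr_ge0
  | exact: sqrtr_ge0 | exact: sqnorm_ge0 | exact: expR_ge0 | apply: ltW; assumption
  | (apply: addr_ge0) | (apply: mulr_ge0) | rewrite invr_ge0 | apply: exprn_ge0 ].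

Section StepSums.
Context {R : realType} {n d : nat}.
Variables (T : R) (A : 'M[R]_n) (B : 'M[R]_(n, d)) (x0 : 'cV[R]_n) (k : R).
Hypotheses (T0 : 0 < T) (k0 : 0 <= k).
Implicit Types (K : R -> 'M[R]_(d, n)) (W X : R -> 'cV[R]_n).

Definition lift_gain (H : 'M[R]_(d, n)) : 'M[R]_(n + d, n) := col_mx 1%:M H.

Definition state_vec K X (t : R) : 'cV[R]_(n + d) := col_mx (X t) (K t *m X t).

Lemma state_vecE K X t : state_vec K X t = lift_gain (K t) *m X t.
Proof. by rewrite /lift_gain mul_col_mx mul1mx. Qed.

Lemma lift_gain_le (H : 'M[R]_(d, n)) h : `|H| <= h -> `|lift_gain H| <= 1 + h.
Proof.
move=> hH; have h0 := le_trans (normr_ge0 _) hH.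
apply: ler_mx_normP => [|i j]; first by rewrite addr_ge0.
rewrite mxE; case: splitP => l _.
  by apply: le_trans (_ : 1 <= _); rewrite ?lerDl// mxE; case: eqP => _; rewrite ?normr1 ?normr0.
by rewrite (le_trans (mx_norm_entry _ _ _))// (le_trans hH)// lerDr.
Qed.

Lemma lift_gain_diff (H H' : 'M[R]_(d, n)) : `|lift_gain H - lift_gain H'| <= `|H - H'|.
Proof.
rewrite /lift_gain opp_col_mx add_col_mx subrr.
apply: ler_mx_normP => // i j; rewrite mxE; case: splitP => l _.
  by rewrite mxE normr0.
exact: mx_norm_entry.
Qed.

(** The piecewise constant gains jump at the grid points. The right end is
    included in each cell so that consecutive grid values are compared too, as
    the summation by parts requires. *)
Definition grid_gain N K : Prop := admissible T k K /\
  forall i s, (i < N)%N -> i%:R * (T / N%:R) <= s <= i.+1%:R * (T / N%:R) ->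
    `|K s - K (i%:R * (T / N%:R))| <= k * (T / N%:R).

(** The increments are compared with the drift at the left end of the cell, as in
    the regression; the error of the estimator depends on the observations
    through these two sums alone. *)
Definition residual_sum N K X (a : 'I_(n + d)) (b : 'I_n) : R :=
  let tau := T / N%:R in let t (i : nat) := i%:R * tau in
  \sum_(i < N) state_vec K X (t i) a 0 *
    (X (t i.+1) - X (t i) - tau *: drift A B K X (t i)) b 0.

Definition gram_sum N K X (a b : 'I_(n + d)) : R :=
  let tau := T / N%:R in let t (i : nat) := i%:R * tau in
  \sum_(i < N) tau * (state_vec K X (t i) a 0 * state_vec K X (t i) b 0).

Section Grid.
Variables (N : nat) (N0 : (0 < N)%N).
Let tau := T / N%:R.
Let t (i : nat) : R := i%:R * tau.

Let tau0 : 0 < tau. Proof. by rewrite divr_gt0// ltr0n. Qed.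
Let tauN : N%:R * tau = T.
Proof. by rewrite /tau mulrC divfK// pnatr_eq0 -lt0n. Qed.
Let tauT : tau <= T.
Proof. by rewrite -[leRHS]tauN ler_peMl ?ler1n// ltW. Qed.
Let t_itv i : (i <= N)%N -> 0 <= t i <= T.
Proof. by move=> iN; apply: (grid_time T0). Qed.
Let tlt i : t i <= t i.+1.
Proof. by rewrite /t ler_pM2r// ler_nat. Qed.
Let tstep i : t i.+1 - t i = tau.
Proof. by rewrite /t -natr1 mulrDl mul1r addrAC subrr add0r. Qed.

(** The part of the energy spent on one cell: it dominates every product of size
    [tau] that appears in the sums, and adds up to at most a multiple of
    [grid_energy]. *)
Definition cell_energy W (i : nat) : R :=
  tau * energy T W + (tau * sqnorm (W (t i)) + (tau * sqnorm (W (t i.+1)) +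
  integ (fun r => sqnorm (W r)) (t i) (t i.+1))).

Let sum_integ f j : bmeas T f -> (j <= N)%N ->
  \sum_(i < j) integ f (t i) (t i.+1) = integ f 0 (t j).
Proof.
move=> bf; elim: j => [|j IH] jN.
  by rewrite big_ord0 /t mul0r set_itv1 Rintegral_set1.
rewrite big_ord_recr /= IH ?(ltnW jN)//; symmetry.
have /andP[h1 h2] := t_itv (ltnW jN); have /andP[h3 h4] := t_itv jN.
exact: (integ_chasles bf h1 (tlt j) h4).
Qed.

Lemma cell_energy_sum W : {within `[0, T], continuous W} ->
  \sum_(i < N) cell_energy W i <= (3 * T + 1) * grid_energy T N W.
Proof.
move=> Wc; have bS := bmeas_sqnorm Wc.
rewrite big_split/= big_split/= big_split/= sum_integ// /t tauN.
rewrite sumr_const card_ord -[tau * _ *+ N]mulr_natl mulrA tauN -!mulr_sumr.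
have -> : \sum_(i < N) sqnorm (W (i.+1%:R * tau)) =
   \sum_(i < N) sqnorm (W (i%:R * tau)) + (sqnorm (W T) - sqnorm (W 0)).
  have h := telescope_sumr (fun i : nat => sqnorm (W (i%:R * tau))) (leq0n N).
  rewrite big_mkord tauN mul0r in h.
  by rewrite -h -big_split/=; apply: eq_bigr => i _; rewrite addrC subrK.
rewrite /grid_energy -/tau; set S := \sum_(i < N) _.
have S0 : 0 <= S by apply: sumr_ge0 => i _; exact: sqnorm_ge0.
have tS : tau * S = T * (N%:R^-1 * S) by rewrite mulrA.
have W0 := sqnorm_ge0 (W 0); have WT := sqnorm_ge0 (W T).
rewrite (mulrDr tau) (mulrBr tau) tS; set M := N%:R^-1 * S.
have M0 : 0 <= M by rewrite mulr_ge0// invr_ge0.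
have E1 := energy_ge1 T W.
have -> : integ (fun r => sqnorm (W r)) 0 T = energy T W - 1.
  by rewrite /energy addrC addKr.
have h1 : tau * sqnorm (W T) <= T * sqnorm (W T) by rewrite ler_wpM2r.
have h2 : 0 <= tau * sqnorm (W 0) by rewrite mulr_ge0// ltW.
have h3 : 0 <= T * sqnorm (W T) by rewrite mulr_ge0// ltW.
have h4 : 0 <= T * M by rewrite mulr_ge0// ltW.
have h5 : 0 <= T * energy T W by rewrite mulr_ge0 ?(ltW T0)// (le_trans _ E1).
nra.
Qed.

End Grid.

(** With [D = X - W], the residual splits into the smooth increments of [D] and
    those of [W], and the regressor into a part in [D] and a part in [W]. The
    product of the two noise parts is the stochastic integral, which has no
    pathwise bound. The product of the smooth regressor and the increments of [W]
    is summed by parts, which puts the difference on the smooth factor. *)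
Lemma path_sums : exists2 C, 0 <= C & forall N K W X a, (0 < N)%N ->
  grid_gain N K -> path_sol T A B x0 K W X -> W 0 = 0 ->
  (forall b, `|residual_sum N K X a b| <= C * grid_energy T N W +
    `|noise_sum T N (fun l c => lift_gain (K (l%:R * (T / N%:R))) a c) b W|) /\
  (forall b, `|gram_sum N K X a b| <= C * grid_energy T N W).
Proof.
have [C1 C10 hD] := path_bound A B x0 T0 k0.
have [C2 C20 hI] := path_increment A B x0 T0 k0.
pose q := 1 + k; have q0 : 0 <= q by rewrite addr_ge0.
pose l := @drift_const _ n d A B k; have l0 : 0 <= l by exact: drift_const_ge0.
pose C := (2 * C1 ^+ 2 + 2) + C2 * (4 + 2 * C1 ^+ 2).
pose C' := n%:R * q * C + n%:R * q * (l * C) + (n%:R * k * C + n%:R * q * C).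
have n0 : 0 <= n%:R :> R by [].
have C11 := sqr_ge0 C1.
have C0 : 0 <= C by rewrite /C addr_ge0 ?mulr_ge0 ?addr_ge0 ?mulr_ge0.
have C'0 : 0 <= C' by rewrite /C'; nonneg.
exists ((C' + (n%:R * q) * (n%:R * q) * C) * (3 * T + 1) + n%:R * q * (C1 ^+ 2 + 1)).
  by nonneg.
move=> N K W X a N0 [hK jK] hs W0; have [Xc Wc hX] := hs.
set tau := T / N%:R in jK *; pose t (i : nat) := i%:R * tau.
have tau0 : 0 < tau by rewrite divr_gt0// ltr0n.
have tT i : (i <= N)%N -> 0 <= t i <= T by move=> iN; apply: (grid_time T0).
have tN : t N = T by rewrite /t /tau mulrC divfK// pnatr_eq0 -lt0n.
have tS i : t i <= t i.+1 by rewrite /t ler_pM2r// ler_nat.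
have tE i : t i.+1 - t i = tau by rewrite /t -natr1 mulrDl mul1r addrAC subrr add0r.
pose D i := X (t i) - W (t i).
set E := energy T W; have E1 : 1 <= E := energy_ge1 T W.
have E0 : 0 <= E by rewrite (le_trans _ E1).
have [_ sE _] := sqrt_energy T W.
have D2 i : (i <= N)%N -> `|D i| ^+ 2 <= C1 ^+ 2 * E.
  move=> iN; rewrite /E -sE -exprMn lerXn2r ?nnegrE ?mulr_ge0 ?sqrtr_ge0//.
  exact: (hD _ _ _ hK hs _ (tT i iN)).
have W2 i : `|W (t i)| ^+ 2 <= sqnorm (W (t i)) by exact: sqr_mxnorm.
have X2 i : (i <= N)%N -> `|X (t i)| ^+ 2 <= 2 * (C1 ^+ 2 * E) + 2 * sqnorm (W (t i)).
  move=> iN; have := D2 i iN; have := W2 i.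
  have : `|X (t i)| <= `|D i| + `|W (t i)|.
    by rewrite -{1}[X (t i)](subrK (W (t i))) ler_normD.
  have := normr_ge0 (X (t i)); have := normr_ge0 (D i); have := normr_ge0 (W (t i)).
  move: `|X (t i)| `|D i| `|W (t i)| => x y z z0 y0 x0' h h1 h2.
  have h3 : x ^+ 2 <= (y + z) ^+ 2 by rewrite lerXn2r// nnegrE// addr_ge0.
  by have := sqr_ge0 (y - z); nra.
(* Every term below is at most a constant multiple of [r i], and the [r i] are
   summed once at the end. *)
pose r i := cell_energy N W i.
have I0 i : 0 <= integ (fun s => sqnorm (W s)) (t i) (t i.+1).
  by apply: integ_ge0 => s _; exact: sqnorm_ge0.
have S0 i : 0 <= sqnorm (W (t i)) by exact: sqnorm_ge0.
have tE0 : 0 <= tau * E by rewrite mulr_ge0// ltW.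
have tS0 i : 0 <= tau * sqnorm (W (t i)) by rewrite mulr_ge0// ltW.
have r0 i : 0 <= r i.
  have := I0 i; have := tS0 i; have := tS0 i.+1.
  by rewrite /r /cell_energy -/tau -/(t i) -/(t i.+1) -/E => h1 h2 h3; lra.
have CT : 0 <= C2 * C1 ^+ 2 by rewrite mulr_ge0.
have rE i : [/\ tau * E <= r i, tau * sqnorm (W (t i)) <= r i,
   tau * sqnorm (W (t i.+1)) <= r i & integ (fun s => sqnorm (W s)) (t i) (t i.+1) <= r i].
  have := I0 i; have := tS0 i; have := tS0 i.+1.
  by rewrite /r /cell_energy -/tau -/(t i) -/(t i.+1) -/E => h1 h2 h3; split; lra.
have ha i : (i < N)%N -> tau * `|X (t i)| ^+ 2 <= (2 * C1 ^+ 2 + 2) * r i.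
  move=> iN; apply: (le_trans (ler_wpM2l (ltW tau0) (X2 i (ltnW iN)))).
  have [h1 h2 _ _] := rE i.
  have := ler_wpM2l C11 h1; rewrite mulrDl; lra.
have hr0 i : 0 <= (2 * C1 ^+ 2 + 2) * r i by have h := r0 i; nonneg.
have hr1 i : 0 <= C2 * (4 + 2 * C1 ^+ 2) * r i.
  by have h := r0 i; nonneg.
have haC i : (i < N)%N -> tau * `|X (t i)| ^+ 2 <= C * r i.
  by move=> iN; have := ha i iN; have := hr1 i; rewrite /C mulrDl; lra.
have hDS i x : (i < N)%N -> 0 <= x -> tau * x ^+ 2 <= (2 * C1 ^+ 2 + 2) * r i ->
    x * `|D i.+1 - D i| <= C * r i.
  move=> iN x0' hx; have /andP[h1 h2] := tT i (ltnW iN); have /andP[h3 h4] := tT _ iN.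
  have := hI _ _ _ hK hs x (t i) (t i.+1) x0' h1 (tS i) h4; rewrite tE => h.
  apply: (le_trans h); have [g1 _ _ g4] := rE i.
  apply: (@le_trans _ _ (C2 * ((4 + 2 * C1 ^+ 2) * r i))).
    by rewrite ler_wpM2l// mulrDr -/E; lra.
  by rewrite mulrA /C [leRHS]mulrDl lerDr.
have hb i : (i < N)%N -> `|X (t i)| * `|D i.+1 - D i| <= C * r i.
  by move=> iN; apply: hDS => //; exact: ha.
have hc i : (i < N)%N -> `|W (t i.+1)| * `|D i.+1 - D i| <= C * r i.
  move=> iN; apply: hDS => //; have [_ _ g3 _] := rE i.
  apply: (le_trans (ler_wpM2l (ltW tau0) (W2 _))); apply: (le_trans g3).
  by have h1 := mulr_ge0 C11 (r0 i); have h2 := r0 i; lra.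
have hDW i : (i <= N)%N -> `|D i| * `|W (t i)| <= C1 ^+ 2 * E + sqnorm (W (t i)).
  move=> iN; have := D2 i iN; have := W2 i.
  have := sqr_ge0 (`|D i| - `|W (t i)|).
  have := sqr_ge0 `|D i|; have := sqr_ge0 `|W (t i)|; nra.
have hd i : (i < N)%N -> tau * (`|D i.+1| * `|W (t i.+1)|) <= C * r i.
  move=> iN; apply: (le_trans (ler_wpM2l (ltW tau0) (hDW _ iN))).
  have [h1 _ h2 _] := rE i.
  have := ler_wpM2l C11 h1; have := hr1 i; have := mulr_ge0 C11 (r0 i).
  by rewrite /C => g1 g2 g3; have := r0 i; lra.
pose H i := lift_gain (K (t i)).
have hH i : (i <= N)%N -> `|H i| <= q.
  by move=> iN; apply: lift_gain_le; exact: (hK.2 _ (tT i iN)).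
have hH' i : (i < N)%N -> `|H i.+1 - H i| <= k * tau.
  move=> iN; apply: (le_trans (lift_gain_diff _ _)); apply: jK => //.
  by rewrite -/(t i) -/(t i.+1) tS lexx.
have zle i c : (i <= N)%N -> `|state_vec K X (t i) c 0| <= n%:R * q * `|X (t i)|.
  move=> iN; rewrite (le_trans (mx_norm_entry _ _ _))// state_vecE.
  exact: (mx_norm_mulmx_le (hH i iN) (lexx _)).
have sumG : \sum_(i < N) r i <= (3 * T + 1) * grid_energy T N W by exact: cell_energy_sum.
have G1 : E <= grid_energy T N W.
  rewrite lerDl addr_ge0 ?sqnorm_ge0// mulr_ge0 ?invr_ge0//.
  by apply: sumr_ge0 => i _; exact: sqnorm_ge0.
have G2 : sqnorm (W T) + E <= grid_energy T N W.
  rewrite /grid_energy -/E addrC lerD2l lerDl mulr_ge0 ?invr_ge0//.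
  by apply: sumr_ge0 => i _; exact: sqnorm_ge0.
have G0 := le_trans E0 G1.
split=> b; last first.
  apply: (le_trans (ler_norm_sum _ _ _)).
  apply: (@le_trans _ _ (\sum_(i < N) n%:R * q * (n%:R * q) * C * r i)).
    apply: ler_sum => i _; rewrite normrM (gtr0_norm tau0) normrM.
    have h1 := zle i a (ltnW (ltn_ord i)); have h2 := zle i b (ltnW (ltn_ord i)).
    have h := ler_pM (normr_ge0 _) (normr_ge0 _) h1 h2.
    apply: (le_trans (ler_wpM2l (ltW tau0) h)).
    have -> : tau * (n%:R * q * `|X (t i)| * (n%:R * q * `|X (t i)|)) =
      n%:R * q * (n%:R * q) * (tau * `|X (t i)| ^+ 2) by ring.
    rewrite -[leRHS]mulrA ler_wpM2l ?haC//; nonneg.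
  rewrite -mulr_sumr; apply: (le_trans (ler_wpM2l _ sumG)); first by nonneg.
  have h0 : 0 <= C' * (3 * T + 1) * grid_energy T N W by nonneg.
  have h1 : 0 <= n%:R * q * (C1 ^+ 2 + 1) * grid_energy T N W by nonneg.
  rewrite [leRHS](_ : _ = C' * (3 * T + 1) * grid_energy T N W +
    (n%:R * q * (n%:R * q) * C * ((3 * T + 1) * grid_energy T N W) +
     n%:R * q * (C1 ^+ 2 + 1) * grid_energy T N W)); last by ring.
  lra.
have hdr i : (i < N)%N -> `|drift A B K X (t i)| <= l * `|X (t i)|.
  move=> iN; apply: drift_le hK => //.
  by apply: tT; exact: ltnW.
pose S1 := \sum_(i < N) state_vec K X (t i) a 0 *
    (D i.+1 - D i - tau *: drift A B K X (t i)) b 0.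
(* The part of the regressor that does not come directly from the noise. *)
pose g i := (H i *m D i) a 0.
pose wb i := W (t i) b 0.
have -> : residual_sum N K X a b = S1 + \sum_(i < N) g i * (wb i.+1 - wb i) +
    noise_sum T N (fun m c => lift_gain (K (m%:R * tau)) a c) b W.
  rewrite /S1 /noise_sum -!big_split/=; apply: eq_bigr => i _.
  rewrite -/tau -/(t i) -/(t i.+1).
  have -> : X (t i.+1) - X (t i) - tau *: drift A B K X (t i) =
     (D i.+1 - D i - tau *: drift A B K X (t i)) + (W (t i.+1) - W (t i)).
    apply/matrixP => a' b'; rewrite /D !mxE; ring.
  rewrite mxeD mulrDr -addrA; congr (_ + _).
  have -> : state_vec K X (t i) a 0 = g i + \sum_c lift_gain (K (t i)) a c * W (t i) c 0.
    rewrite state_vecE -{1}[X (t i)](subrK (W (t i))) mulmxDr mxeD; congr (_ + _).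
    by rewrite mxE.
  rewrite mulrDl; congr (_ * _ + _); by rewrite /wb !mxE.
apply: (le_trans (ler_normD _ _)); rewrite lerD2r.
have hS1 : `|S1| <= \sum_(i < N) (n%:R * q * C + n%:R * q * (l * C)) * r i.
  apply: (le_trans (ler_norm_sum _ _ _)); apply: ler_sum => i _.
  have iN := ltn_ord i.
  rewrite normrM.
  have h1 : `|(D i.+1 - D i - tau *: drift A B K X (t i)) b 0| <=
      `|D i.+1 - D i| + tau * (l * `|X (t i)|).
    apply: (le_trans (mx_norm_entry _ _ _)); apply: (le_trans (ler_normB _ _)).
    by rewrite lerD2l normrZ (gtr0_norm tau0) ler_wpM2l// ?(ltW tau0)// hdr.
  have h := ler_pM (normr_ge0 _) (normr_ge0 _) (zle i a (ltnW iN)) h1.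
  apply: (le_trans h).
  have -> : n%:R * q * `|X (t i)| * (`|D i.+1 - D i| + tau * (l * `|X (t i)|)) =
    n%:R * q * (`|X (t i)| * `|D i.+1 - D i|) + n%:R * q * l * (tau * `|X (t i)| ^+ 2) by ring.
  rewrite [leRHS]mulrDl; apply: lerD.
    by rewrite -[leRHS]mulrA ler_wpM2l ?hb//; nonneg.
  rewrite [leRHS](_ : _ = n%:R * q * l * (C * r i)); last by ring.
  by rewrite ler_wpM2l ?haC//; nonneg.
have hS2 : `|\sum_(i < N) (g i.+1 - g i) * wb i.+1| <=
    \sum_(i < N) (n%:R * k * C + n%:R * q * C) * r i.
  apply: (le_trans (ler_norm_sum _ _ _)); apply: ler_sum => i _.
  have iN := ltn_ord i.
  have -> : g i.+1 - g i = ((H i.+1 - H i) *m D i.+1) a 0 + (H i *m (D i.+1 - D i)) a 0.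
    by rewrite mulmxBl (mulmxBr (H i) (D i.+1) (D i)) !mxeD !mxeN addrA subrK.
  rewrite normrM.
  have h1 : `|((H i.+1 - H i) *m D i.+1) a 0 + (H i *m (D i.+1 - D i)) a 0| <=
     n%:R * (k * tau) * `|D i.+1| + n%:R * q * `|D i.+1 - D i|.
    apply: (le_trans (ler_normD _ _)); apply: lerD; apply: (le_trans (mx_norm_entry _ _ _)).
      by apply: mx_norm_mulmx_le => //; exact: hH'.
    by apply: mx_norm_mulmx_le => //; exact: (hH _ (ltnW iN)).
  have h := ler_pM (normr_ge0 _) (normr_ge0 _) h1 (mx_norm_entry (W (t i.+1)) b 0).
  apply: (le_trans h).
  have -> : (n%:R * (k * tau) * `|D i.+1| + n%:R * q * `|D i.+1 - D i|) * `|W (t i.+1)| =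
    n%:R * k * (tau * (`|D i.+1| * `|W (t i.+1)|)) +
    n%:R * q * (`|W (t i.+1)| * `|D i.+1 - D i|) by ring.
  rewrite [leRHS]mulrDl; apply: lerD.
    by rewrite -[leRHS]mulrA ler_wpM2l ?hd//; nonneg.
  by rewrite -[leRHS]mulrA ler_wpM2l ?hc//; nonneg.
have hN : `|g N * wb N| <= n%:R * q * (C1 ^+ 2 + 1) * grid_energy T N W.
  rewrite normrM.
  have h1 : `|g N| <= n%:R * q * `|D N|.
    by apply: (le_trans (mx_norm_entry _ _ _)); apply: mx_norm_mulmx_le => //; exact: hH.
  have h := ler_pM (normr_ge0 _) (normr_ge0 _) h1 (mx_norm_entry (W (t N)) b 0).
  apply: (le_trans h); rewrite -[leLHS]mulrA -[leRHS]mulrA ler_wpM2l//; first by nonneg.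
  apply: (le_trans (hDW _ (leqnn N))); rewrite tN.
  have := ler_wpM2l C11 G1; rewrite mulrDl mul1r; lra.
have w0 : wb 0%N = 0 by rewrite /wb /t mul0r W0 mxE.
rewrite abel_sum w0 mulr0 subr0.
have hC' : \sum_(i < N) (n%:R * q * C + n%:R * q * (l * C)) * r i +
   \sum_(i < N) (n%:R * k * C + n%:R * q * C) * r i <= C' * (3 * T + 1) * grid_energy T N W.
  rewrite -!mulr_sumr -mulrDl -/C' -[leRHS]mulrA ler_wpM2l//.
have h3 : 0 <= (n%:R * q) * (n%:R * q) * C * (3 * T + 1) * grid_energy T N W by nonneg.
apply: (le_trans (ler_normD _ _)).
have h4 := ler_normB (g N * wb N) (\sum_(i < N) (g i.+1 - g i) * wb i.+1).
rewrite [leRHS](_ : _ = C' * (3 * T + 1) * grid_energy T N W +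
  (n%:R * q * (n%:R * q) * C * (3 * T + 1) * grid_energy T N W +
  n%:R * q * (C1 ^+ 2 + 1) * grid_energy T N W)); last by ring.
lra.
Qed.

End StepSums.

(** * Second moments and correlations of the state *)

Section MeanTools.
Context {R : realType} {dOm : measure_display} {Om : measurableType dOm}.
Variable P : probability Om R.

Lemma int_add_le (f g : Om -> R) (a b : R) : measurable_fun setT f -> measurable_fun setT g ->
  (forall w, 0 <= f w) -> (forall w, 0 <= g w) ->
  (\int[P]_w (f w)%:E <= a%:E)%E -> (\int[P]_w (g w)%:E <= b%:E)%E ->
  (\int[P]_w (f w + g w)%:E <= (a + b)%:E)%E.
Proof.
move=> mf mg f0 g0 ha hb; under eq_integral do rewrite EFinD.
rewrite ge0_integralD//; first by rewrite EFinD; exact: leeD.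
- by move=> w _; rewrite lee_fin.
- exact/measurable_EFinP.
- by move=> w _; rewrite lee_fin.
- exact/measurable_EFinP.
Qed.

Lemma integrable_of_sqr (f : Om -> R) (c : R) : measurable_fun setT f ->
  (\int[P]_w (f w ^+ 2)%:E <= c%:E)%E -> P.-integrable setT (EFin \o f).
Proof.
move=> mf hf.
have h1 : (\int[P]_w (1 ^+ 2)%:E <= 1%:E :> \bar R)%E.
  by rewrite expr1n integral_cst//= mul1e probability_setT.
have := int_prod_le ltr01 mf (@measurable_cst _ _ Om R setT 1) hf h1.
by under eq_integral do rewrite mulr1; move=> /(abs_mean_le mf)[].
Qed.

Lemma Rint_sum (J : Type) (r : seq J) (f : J -> Om -> R) :
  (forall j, P.-integrable setT (EFin \o f j)) ->
  P.-integrable setT (EFin \o (fun w => \sum_(j <- r) f j w)) /\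
  (\int[P]_w (\sum_(j <- r) f j w))%R = \sum_(j <- r) (\int[P]_w f j w)%R.
Proof.
move=> hf; elim: r => [|j r [IH1 IH2]].
  rewrite big_nil; split.
    rewrite (_ : _ \o _ = cst 0%E); first exact: integrable0.
    by apply/funext => w; rewrite /= big_nil.
  by rewrite /Rintegral integral0_eq// => w _; rewrite big_nil.
have -> : (fun w => \sum_(i <- j :: r) f i w) = (fun w => f j w + \sum_(i <- r) f i w).
  by apply/funext => w; rewrite big_cons.
split; last by rewrite RintegralD// IH2 big_cons.
exact: (integrableD measurableT (hf j) IH1).
Qed.

Lemma ae_eq_Rint (f g : Om -> R) : measurable_fun setT f -> measurable_fun setT g ->
  {ae P, forall w, f w = g w} -> (\int[P]_w f w)%R = (\int[P]_w g w)%R.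
Proof. by move=> mf mg h; rewrite /Rintegral (ae_eq_int mf mg h). Qed.

Lemma integ_sum (T : R) (J : Type) (r : seq J) (f : J -> R -> R) s t :
  (forall j, bmeas T (f j)) -> 0 <= s -> t <= T ->
  integ (fun x => \sum_(j <- r) f j x) s t = \sum_(j <- r) integ (f j) s t.
Proof.
move=> hf s0 tT; elim: r => [|j r IH].
  by rewrite big_nil /Rintegral integral0_eq// => x _; rewrite big_nil.
rewrite big_cons -IH -(integD (hf j) (bmeas_sum r hf))//.
by apply: eq_integ => x _; rewrite big_cons.
Qed.

End MeanTools.

Section StateMeans.
Context {R : realType} {dOm : measure_display} {Om : measurableType dOm}.
Variable P : probability Om R.
Variables (n d : nat) (n0 : (0 < n)%N) (T : R) (T0 : 0 < T).
Variables (A : 'M[R]_n) (B : 'M[R]_(n, d)) (x0 : 'cV[R]_n) (k : R) (k0 : 0 <= k).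
Variables (W : Om -> R -> 'cV[R]_n) (hW : brownian_motion P W).
Hypothesis hWc : forall w, W w 0 = 0 /\ {within `[0, +oo[, continuous (W w)}.
Implicit Types (K : R -> 'M[R]_(d, n)) (X : Om -> R -> 'cV[R]_n).

Definition solves K X : Prop :=
  [/\ forall t i, 0 <= t <= T -> measurable_fun setT (fun w => X w t i 0),
      forall w, {within `[0, T], continuous (X w)} &
      {ae P, forall w, path_sol T A B x0 K (W w) (X w)}].

Lemma solves_process K X i : solves K X -> process T (fun w t => X w t i 0).
Proof.
case=> mX Xc _; apply: (process_cont T0) => [w|t ht]; last exact: mX.
exact: cont_entry.
Qed.

Lemma energy_mean : measurable_fun setT (fun w => energy T (W w)) /\
  (\int[P]_w (energy T (W w))%:E <= (1 + n%:R * (8 * T) * T)%:E)%E.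
Proof.
have [mI hI] := noise_sqnorm_integ T0 hW hWc (lexx 0) (ltW T0) (lexx T).
rewrite subr0 in hI; split; first exact: measurable_funD.
rewrite /energy; apply: int_add_le => //.
- by move=> w; apply: integ_ge0 => s _; exact: sqnorm_ge0.
- by rewrite integral_cst//= mul1e probability_setT.
Qed.

Let energy_ge0 w : 0 <= energy T (W w).
Proof. by rewrite (le_trans _ (energy_ge1 _ _)). Qed.

Lemma state_sqr_mean : exists2 C, 0 <= C & forall K X, admissible T k K -> solves K X ->
  forall t i, 0 <= t <= T -> (\int[P]_w (X w t i 0 ^+ 2)%:E <= C%:E)%E.
Proof.
have [C1 C10 hD] := path_bound A B x0 T0 k0; have [mE hE] := energy_mean.
exists (2 * C1 ^+ 2 * (1 + n%:R * (8 * T) * T) + 2 * (n%:R * (8 * T))); first by nonneg.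
move=> K X hK [mX Xc aeX] t i ht.
have mS := noise_sqnorm_measurable T0 hW hWc ht.
have c0 : 0 <= 2 * C1 ^+ 2 by nonneg.
have m1 : measurable_fun setT (fun w => 2 * C1 ^+ 2 * energy T (W w)) by exact: measurable_funM.
have m2 : measurable_fun setT (fun w => 2 * sqnorm (W w t)) by exact: measurable_funM.
apply: (@le_trans _ _ (\int[P]_w (2 * C1 ^+ 2 * energy T (W w) + 2 * sqnorm (W w t))%:E)%E).
  apply: int_le_ae.
  - by apply: measurable_funX; exact: mX.
  - exact: measurable_funD.
  - by move=> w; exact: sqr_ge0.
  - by move=> w; rewrite addr_ge0// mulr_ge0// sqnorm_ge0.
  - apply: filterS aeX => w hs; have h := hD _ _ _ hK hs t ht.
    have [_ sE _] := sqrt_energy T (W w); rewrite -sE.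
    have hd := le_trans (mx_norm_entry _ i 0) h.
    have hw := sqr_entry_le_sqnorm (W w t) i; rewrite !mxE in hd.
    have g0 := sqrtr_ge0 (energy T (W w)).
    move: (Num.sqrt _) g0 hd => g g0 hd; move: hw.
    have h2 : (X w t i 0 - W w t i 0) ^+ 2 <= (C1 * g) ^+ 2.
      by rewrite -real_normK ?num_real// lerXn2r// nnegrE// mulr_ge0.
    move: h2; move: (X w t i 0) (W w t i 0) (sqnorm _) => x y s h2 hw.
    by have := sqr_ge0 (x - y - y); nra.
apply: int_add_le => //.
- by move=> w; rewrite mulr_ge0.
- by move=> w; rewrite mulr_ge0// sqnorm_ge0.
- exact: int_scale.
- apply: int_scale => //; first by move=> w; exact: sqnorm_ge0.
  exact: (noise_sqnorm_mean hW hWc).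
Qed.

(** The mean square of a noise increment is [O(t - s)]; the drift part, Lipschitz
    up to the noise, is of no larger order. *)
Lemma state_incr_mean : exists2 C, 0 <= C & forall K X, admissible T k K -> solves K X ->
  forall s t i, 0 <= s -> s <= t -> t <= T ->
  (\int[P]_w ((X w t i 0 - X w s i 0) ^+ 2)%:E <= (C * (t - s))%:E)%E.
Proof.
have [C1 C10 hD] := path_bound A B x0 T0 k0; have [mE hE] := energy_mean.
have [C2 C20 hI] := path_increment A B x0 T0 k0.
pose CE := 1 + n%:R * (8 * T) * T.
exists (2 * C2 * (1 + 4 * C1 ^+ 2) * CE + 2 * C2 * (n%:R * (8 * T)) + 2 * 8).
  by rewrite /CE; nonneg.
move=> K X hK [mX Xc aeX] s t i s0 st tT; have t0 := le_trans s0 st.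
have hs : 0 <= s <= T by rewrite s0 (le_trans st).
have ht : 0 <= t <= T by rewrite t0.
have ts : 0 <= t - s by rewrite subr_ge0.
have [mS hS] := noise_sqnorm_integ T0 hW hWc s0 st tT.
have mY := measurable_incr hW i s0 t0; have hY := incr_sqr hW i s0 st.
pose c1 := 2 * C2 * (1 + 4 * C1 ^+ 2) * (t - s).
have c10 : 0 <= c1 by rewrite /c1; nonneg.
have c20 : 0 <= 2 * C2 by nonneg.
have m1 : measurable_fun setT (fun w => c1 * energy T (W w)) by exact: measurable_funM.
have m2 : measurable_fun setT (fun w => 2 * C2 * integ (fun r => sqnorm (W w r)) s t).
  exact: measurable_funM.
have mY2 : measurable_fun setT (fun w => incr W s t w i 0 ^+ 2) by exact: measurable_funX.
have m3 : measurable_fun setT (fun w => 2 * incr W s t w i 0 ^+ 2) by exact: measurable_funM.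
have I0 w : 0 <= integ (fun r => sqnorm (W w r)) s t.
  by apply: integ_ge0 => r _; exact: sqnorm_ge0.
apply: (@le_trans _ _ (\int[P]_w (c1 * energy T (W w) +
    2 * C2 * integ (fun r => sqnorm (W w r)) s t + 2 * incr W s t w i 0 ^+ 2)%:E)%E).
  apply: int_le_ae.
  - by apply: measurable_funX; apply: measurable_funB; exact: mX.
  - by apply: measurable_funD => //; exact: measurable_funD.
  - by move=> w; exact: sqr_ge0.
  - move=> w; have h1 := sqr_ge0 (incr W s t w i 0).
    have h2 := mulr_ge0 c10 (energy_ge0 w); have h3 := mulr_ge0 c20 (I0 w); lra.
  - apply: filterS aeX => w hsol.
    have hs1 := hD _ _ _ hK hsol s hs; have ht1 := hD _ _ _ hK hsol t ht.
    have [_ sE _] := sqrt_energy T (W w); have g0 := sqrtr_ge0 (energy T (W w)).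
    set D := X w t - W w t - (X w s - W w s).
    have hD1 : `|D| <= 2 * (C1 * Num.sqrt (energy T (W w))).
      by rewrite (le_trans (ler_normB _ _))//; lra.
    have hD2 := hI _ _ _ hK hsol `|D| s t (normr_ge0 _) s0 st tT; rewrite -/D -expr2 in hD2.
    have hD3 : `|D| ^+ 2 <= 4 * C1 ^+ 2 * energy T (W w).
      rewrite -[energy T (W w)]sE; apply: (@le_trans _ _ ((2 * (C1 * Num.sqrt (energy T (W w)))) ^+ 2)).
        by rewrite lerXn2r// nnegrE// !mulr_ge0.
      by rewrite le_eqVlt; apply/orP; left; apply/eqP; ring.
    have hD4 : D i 0 ^+ 2 <= `|D| ^+ 2.
      by rewrite -[leLHS]real_normK ?num_real// lerXn2r ?nnegrE// mx_norm_entry.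
    have -> : X w t i 0 - X w s i 0 = D i 0 + incr W s t w i 0.
      by rewrite /D /incr !mxE; ring.
    have h5 : D i 0 ^+ 2 <= C2 * ((t - s) * ((1 + 4 * C1 ^+ 2) * energy T (W w)) +
        integ (fun r => sqnorm (W w r)) s t).
      apply: (le_trans hD4); apply: (le_trans hD2); rewrite ler_wpM2l// lerD2r ler_wpM2l//.
      by rewrite mulrDl mul1r lerD2l.
    have h6 := sqr_ge0 (D i 0 - incr W s t w i 0); rewrite /c1; nra.
have -> : (2 * C2 * (1 + 4 * C1 ^+ 2) * CE + 2 * C2 * (n%:R * (8 * T)) + 2 * 8) * (t - s) =
  c1 * CE + 2 * C2 * (n%:R * (8 * T) * (t - s)) + 2 * (8 * (t - s)) by rewrite /c1; ring.
apply: int_add_le => //.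
- exact: measurable_funD.
- by move=> w; have h2 := mulr_ge0 c10 (energy_ge0 w); have h3 := mulr_ge0 c20 (I0 w); lra.
- by move=> w; rewrite mulr_ge0// sqr_ge0.
- apply: int_add_le => //.
  + by move=> w; exact: mulr_ge0.
  + by move=> w; exact: mulr_ge0.
  + exact: int_scale.
  + exact: int_scale.
- by apply: int_scale => // w; exact: sqr_ge0.
Qed.

(** The pathwise bound is linear in the distance of the gains, with a random
    factor that is square integrable. *)
Lemma state_diff_mean : exists2 C, 0 <= C & forall K K' X X' eps,
  admissible T k K -> admissible T k K' -> solves K X -> solves K' X' -> 0 <= eps ->
  (forall s, 0 <= s <= T -> `|K s - K' s| <= eps) ->
  forall t i, 0 <= t <= T ->
  (\int[P]_w ((X w t i 0 - X' w t i 0) ^+ 2)%:E <= (C * eps ^+ 2)%:E)%E.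
Proof.
have [C C0 hC] := path_diff A B x0 T0 k0; have [mE hE] := energy_mean.
exists (C ^+ 2 * (1 + n%:R * (8 * T) * T)); first by nonneg.
move=> K K' X X' eps hK hK' [mX _ aeX] [mX' _ aeX'] e0 hKK t i ht.
have c0 : 0 <= (C * eps) ^+ 2 by exact: sqr_ge0.
apply: (@le_trans _ _ (\int[P]_w ((C * eps) ^+ 2 * energy T (W w))%:E)%E).
  apply: int_le_ae.
  - by apply: measurable_funX; apply: measurable_funB; [exact: mX|exact: mX'].
  - exact: measurable_funM.
  - by move=> w; exact: sqr_ge0.
  - by move=> w; exact: mulr_ge0.
  - move: aeX'; apply: filterS2 aeX => w h h'.
    have hh := le_trans (mx_norm_entry _ i 0) (hC _ _ _ _ _ _ hK hK' h h' e0 hKK t ht).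
    have [_ sE _] := sqrt_energy T (W w); rewrite -[energy T (W w)]sE -exprMn.
    rewrite !mxE in hh; rewrite -real_normK ?num_real// lerXn2r ?nnegrE//.
    by rewrite !mulr_ge0// sqrtr_ge0.
rewrite [C ^+ 2 * _ * _](_ : _ = (C * eps) ^+ 2 * (1 + n%:R * (8 * T) * T)); last by ring.
exact: int_scale.
Qed.

Definition loop_matrix K (r : R) : 'M[R]_n := A + B *m K r.

Definition loop_const : R := `|A| + d%:R * `|B| * k.

Lemma loop_const_ge0 : 0 <= loop_const.
Proof. by rewrite /loop_const; nonneg. Qed.

Lemma loop_matrix_le K r l m : admissible T k K -> 0 <= r <= T -> `|loop_matrix K r l m| <= loop_const.
Proof.
move=> [_ hK] hr; rewrite (le_trans (mx_norm_entry _ _ _))//; apply: bndD => //.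
exact: (mx_norm_mulmx_le (lexx _) (hK r hr)).
Qed.

Lemma drift_loop K (x : R -> 'cV[R]_n) r l :
  drift A B K x r l 0 = \sum_m loop_matrix K r l m * x r m 0.
Proof. by rewrite /drift /loop_matrix mulmxA -mulmxDl mxE. Qed.

Lemma bmeas_loop K l m : admissible T k K -> bmeas T (fun r => loop_matrix K r l m).
Proof.
move=> hK; rewrite (_ : (fun r => _) = fun r => A l m + \sum_j B l j * K r j m).
  apply: bmeasD; first exact: bmeas_cst.
  by apply: bmeas_sum => j; apply: (bmeasM (bmeas_cst T _)); exact: bmeas_gain hK.
by apply/funext => r; rewrite /loop_matrix mxeD !mxE.
Qed.

(** The equation of the state is linear, so multiplying it by a fixed random
    variable [V] and exchanging expectation and time integral gives a linear
    deterministic equation, forced by the correlation of [V] with the noise. *)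
Lemma mean_drift : exists2 C, 0 <= C & forall K X (V : Om -> R) c, admissible T k K -> solves K X ->
  measurable_fun setT V -> (\int[P]_w (V w ^+ 2)%:E <= c%:E)%E ->
  let f m r := (\int[P]_w (V w * X w r m 0))%R in
  [/\ forall m, bmeas T (f m),
      forall m r, 0 <= r <= T -> P.-integrable setT (EFin \o (fun w => V w * X w r m 0)) /\
        `|f m r| <= (c + C) / 2 &
      forall l s t, 0 <= s -> s <= t -> t <= T -> f l t - f l s =
        \sum_m integ (fun r => loop_matrix K r l m * f m r) s t +
        (\int[P]_w (V w * incr W s t w l 0))%R].
Proof.
have [C C0 hC] := state_sqr_mean; exists C => // K X V c hK hX mV hV f.
have [mX Xc aeX] := hX.
have mVX r m : 0 <= r <= T -> measurable_fun setT (fun w => V w * X w r m 0).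
  by move=> hr; apply: measurable_funM => //; exact: mX.
have hVX r m : 0 <= r <= T -> (\int[P]_w `|V w * X w r m 0|%:E <= ((c + C) / 2)%:E)%E.
  move=> hr; have := int_prod_le ltr01 mV (mX r m hr) hV (hC K X hK hX r m hr).
  by rewrite invr1 !mul1r.
have pX m : process T (fun w r => V w * X w r m 0).
  by apply: processM; [exact: process_rv|exact: solves_process hX].
have hf m : bmeas T (f m) by have [] := path_fubini T0 (pX m) (hVX ^~ m).
have hi m r : 0 <= r <= T -> P.-integrable setT (EFin \o (fun w => V w * X w r m 0)) /\
    `|f m r| <= (c + C) / 2.
  by move=> hr; apply: abs_mean_le; [exact: mVX|exact: hVX].
split=> // l s t s0 st tT.
have t0 := le_trans s0 st.
have hs : 0 <= s <= T by rewrite s0 (le_trans st).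
have ht : 0 <= t <= T by rewrite t0.
pose Y m w r := loop_matrix K r l m * (V w * X w r m 0).
have pY m : process T (Y m).
  apply: processM (pX m); apply: (process_det T0).
  exact: bmeas_loop hK.
have hY m r : 0 <= r <= T -> (\int[P]_w `|Y m w r|%:E <= (loop_const * ((c + C) / 2))%:E)%E.
  move=> hr; have mN : measurable_fun setT (fun w => `|V w * X w r m 0|).
    by apply: measurableT_comp => //; exact: mVX.
  apply: le_trans (int_scale loop_const_ge0 mN _ (hVX r m hr)) => //.
  apply: ge0_le_int => //.
  - by apply: measurableT_comp => //; exact: (process_at (pY m)).
  - exact: measurable_funM.
  - by move=> w; rewrite normrM ler_wpM2r// loop_matrix_le.
have hI m := (path_fubini T0 (pY m) (hY m)).2 s t s0 st tT.
have mI m : measurable_fun setT (fun w => integ (Y m w) s t) by case: (hI m).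
have iI m : P.-integrable setT (EFin \o (fun w => integ (Y m w) s t)) by case: (hI m).
have EI m : (\int[P]_w integ (Y m w) s t)%R = integ (fun r => loop_matrix K r l m * f m r) s t.
  have [_ _ ->] := hI m; apply: eq_integ => r /andP[sr rt].
  have hr : 0 <= r <= T by rewrite (le_trans s0)//= (le_trans rt).
  by rewrite /Y RintegralZl//; case: (hi m r hr).
have mY := measurable_incr hW l s0 t0.
have [iN _] := abs_mean_le (measurable_funM mV mY)
  (int_prod_le ltr01 mV mY hV (incr_sqr hW l s0 st)).
have [iS ES] := Rint_sum (index_enum 'I_n) iI.
have iSN := integrableD measurableT iS iN.
rewrite -(eq_bigr _ (fun m _ => EI m)) -ES.
rewrite -RintegralD//.
apply/eqP; rewrite subr_eq addrC; apply/eqP.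
rewrite /f -RintegralD//; [|by case: (hi l s hs)].
apply: ae_eq_Rint.
- exact: mVX.
- apply: measurable_funD; first exact: mVX.
  by apply: measurable_funD; [exact: measurable_sum|exact: measurable_funM].
apply: filterS aeX => w hsol.
have hXs := path_sol_entry l hsol hs; have hXt := path_sol_entry l hsol ht.
have bd := bmeas_drift A B l (Xc w) hK.
rewrite (integ_chasles bd s0 st tT) in hXt.
have -> : X w t l 0 = X w s l 0 + (integ (fun r => drift A B K (X w) r l 0) s t + incr W s t w l 0).
  rewrite [incr _ _ _ _ _ _](_ : _ = W w t l 0 - W w s l 0); last by rewrite /incr !mxE.
  lra.
rewrite !mulrDr; congr (_ + (_ + _)).
rewrite -(integZ (V w) bd s0 tT) -(@integ_sum _ T)//; last by move=> m; case: (pY m).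
apply: eq_integ => r _; rewrite drift_loop mulr_sumr; apply: eq_bigr => m _.
by rewrite /Y mulrCA.
Qed.

Lemma bmeas_sub (f : R -> R) v : v <= T -> bmeas T f -> bmeas v f.
Proof.
move=> vT [mf [B' hB]]; split; last first.
  by exists B' => s /andP[s0 st]; apply: hB; rewrite s0 (le_trans st).
apply: measurable_funS mf; first exact: measurable_itv.
by apply: subset_itvl; rewrite bnd_simp.
Qed.

(** The state is not written as a function of the past noise. Instead, its
    correlations with the future increment solve a linear homogeneous integral
    equation, by [mean_drift] and the orthogonality of the noise, hence vanish. *)
Lemma state_orth K X u v t a b : admissible T k K -> solves K X ->
  0 <= u -> u <= v -> v <= t -> t <= T ->
  (\int[P]_w (X w u a 0 * incr W v t w b 0))%R = 0.
Proof.
move=> hK hX u0 uv vt tT; have [mX Xc aeX] := hX.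
have v0 := le_trans u0 uv; have t0 := le_trans v0 vt; have vT := le_trans vt tT.
have mV := measurable_incr hW b v0 t0; have hV := incr_sqr hW b v0 vt.
have [C C0 hC] := mean_drift.
have := hC K X _ _ hK hX mV hV; set f := (fun m r => (\int[P]_w _)%R) => -[bf _ hf].
suff key : forall c r, 0 <= r <= v -> f c r = 0.
  by have := key a u; rewrite u0 uv => /(_ isT) <-; apply: eq_Rintegral => w _; rewrite mulrC.
pose g r := \sum_c `|f c r|.
pose q := n%:R * loop_const + 1.
have lc0 := loop_const_ge0.
have q0 : 0 < q by rewrite /q ltr_wpDl// mulr_ge0.
have bg : bmeas T g by apply: bmeas_sum => c; exact: bmeas_norm.
have g0 r : 0 <= g r by apply: sumr_ge0 => c _.
have f0 c : f c 0 = 0.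
  have T00 : (0 : R) <= 0 <= T by rewrite lexx ltW.
  transitivity (\int[P]_w (x0 c 0 * incr W v t w b 0))%R.
    apply: ae_eq_Rint.
    - by apply: measurable_funM => //; exact: mX.
    - exact: measurable_funM.
    apply: filterS aeX => w hsol.
    have := path_sol_entry c hsol T00.
    rewrite set_itv1 Rintegral_set1 addr0 (hWc w).1 mxE subr0 => ->.
    by rewrite mulrC.
  have [_ h] := noise_orth hW hWc b b u0 uv vt.
  rewrite RintegralZl// ?h ?mulr0//.
  exact: integrable_of_sqr mV hV.
have fE c r : 0 <= r <= v -> f c r = \sum_m integ (fun s => loop_matrix K s c m * f m s) 0 r.
  move=> /andP[r0 rv]; have := hf c 0 r (lexx _) r0 (le_trans rv vT).
  rewrite f0 subr0 => ->.
  have [h _] := noise_orth hW hWc c b r0 rv vt.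
  rewrite [X in _ + X](_ : _ = 0) ?addr0//.
  by rewrite -[RHS]h; apply: eq_Rintegral => w _; rewrite (noise_incr hWc) mulrC.
have gE r : 0 <= r <= v -> g r <= q * integ g 0 r.
  move=> hr; have /andP[r0 rv] := hr; have rT := le_trans rv vT.
  apply: (@le_trans _ _ (\sum_(c < n) \sum_m loop_const * integ (fun s => `|f m s|) 0 r)).
    apply: ler_sum => c _; rewrite fE//; apply: (le_trans (ler_norm_sum _ _ _)).
    apply: ler_sum => m _.
    have bm : bmeas T (fun s => loop_matrix K s c m * f m s).
      by apply: bmeasM => //; exact: bmeas_loop.
    apply: (le_trans (norm_integ bm (lexx 0) rT)).
    have bfm := bmeas_norm (bf m).
    rewrite -(integZ _ bfm)//; apply: (le_integ (bmeas_norm bm) _ (lexx 0) rT).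
      exact: (bmeasM (bmeas_cst T _)).
    move=> s /andP[s0 sr]; rewrite normrM ler_wpM2r// loop_matrix_le//.
    by rewrite s0 (le_trans sr).
  have bN m : bmeas T (fun s => `|f m s|) by exact: bmeas_norm.
  rewrite sumr_const card_ord -mulr_sumr -(@integ_sum _ T)// -/(integ g 0 r).
  rewrite -mulr_natl mulrA ler_wpM2r ?lerDl//.
  by apply: integ_ge0 => x _; exact: g0.
suff gv r : 0 <= r <= v -> g r = 0.
  move=> c r hr; have h := gv r hr; apply/eqP; rewrite -normr_le0 -[leRHS]h.
  rewrite /g (bigD1 c)//= lerDl; exact: sumr_ge0.
move: v0; rewrite le_eqVlt => /predU1P[<-|v0] hr.
  have {hr} -> : r = 0 by apply/eqP; rewrite eq_le andbC.
  by rewrite /g big1// => c' _; rewrite f0 normr0.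
apply/eqP; rewrite eq_le g0 andbT.
have bz : bmeas v (fun=> 0 : R) by exact: bmeas_cst.
have := gronwall v0 (u := fun=> 0) q0 (lexx 0) (bmeas_sub vT bg) bz _ _ _ hr.
rewrite !integ_cst ?(ltW v0)// !mul0r addr0 mulr0; apply=> // s hs.
rewrite integ_cst ?mul0r; last by case/andP: hs.
by rewrite add0r addr0 gE.
Qed.

End StateMeans.

(** * Exponential moments and means of the regression sums *)

Section SquareMeans.
Context {R : realType} {dOm : measure_display} {Om : measurableType dOm}.
Variable P : probability Om R.

Lemma sqr_sum_le (J : Type) (r : seq J) (y : J -> R) :
  (\sum_(j <- r) y j) ^+ 2 <= 2 ^+ size r * \sum_(j <- r) y j ^+ 2.
Proof.
elim: r => [|j r IH]; first by rewrite !big_nil expr0n mulr0.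
rewrite !big_cons /= [2 ^+ _.+1]exprS; set S := \sum_(i <- r) y i in IH *.
set Q := \sum_(i <- r) _ in IH *; set c := 2 ^+ size r in IH *.
have c1 : 1 <= c by rewrite exprn_ege1// ler1n.
have := sqr_ge0 (y j - S); have := sqr_ge0 (y j); nra.
Qed.

Lemma int_sqr_lin n (u : 'I_n -> R) (x : 'I_n -> Om -> R) (e M : R) :
  (forall c, `|u c| <= e) -> (forall c, measurable_fun setT (x c)) ->
  (forall c, (\int[P]_w (x c w ^+ 2)%:E <= M%:E)%E) ->
  (\int[P]_w ((\sum_c u c * x c w) ^+ 2)%:E <= (2 ^+ n * (n%:R * (e ^+ 2 * M)))%:E)%E.
Proof.
move=> hu mx hx.
have sz : size (index_enum 'I_n) = n by rewrite -[RHS]card_ord cardT enumT.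
have m2 c : measurable_fun setT (fun w => e ^+ 2 * x c w ^+ 2).
  by apply: measurable_funM => //; exact: measurable_funX.
have p2 c w : 0 <= e ^+ 2 * x c w ^+ 2 by rewrite mulr_ge0// sqr_ge0.
have mS : measurable_fun setT (fun w => \sum_c e ^+ 2 * x c w ^+ 2) by exact: measurable_sum.
apply: (@le_trans _ _ (\int[P]_w (2 ^+ n * \sum_c e ^+ 2 * x c w ^+ 2)%:E)%E).
  apply: ge0_le_int.
  - by apply: measurable_funX; apply: measurable_sum => c; exact: measurable_funM.
  - exact: measurable_funM.
  - by move=> w; exact: sqr_ge0.
  - move=> w; apply: (le_trans (sqr_sum_le _ _)); rewrite sz ler_wpM2l ?exprn_ge0//.
    apply: ler_sum => c _; rewrite exprMn ler_wpM2r ?sqr_ge0//.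
    rewrite -real_normK ?num_real// lerXn2r ?nnegrE//.
    exact: le_trans (normr_ge0 _) (hu c).
apply: int_scale => //; first by move=> w; apply: sumr_ge0.
rewrite -[X in X%:R]sz; apply: int_sum => // c.
by apply: int_scale => //; [exact: sqr_ge0|exact: measurable_funX|move=> w; exact: sqr_ge0].
Qed.

(** Write [x y - x' y' = (x - x') y + x' (y - y')]. The weight in [int_prod_le]
    balances the small factor of each product against the bounded one. *)
Lemma mean_prod_diff (x y x' y' : Om -> R) (s M : R) : 0 < s ->
  measurable_fun setT x -> measurable_fun setT y ->
  measurable_fun setT x' -> measurable_fun setT y' ->
  (\int[P]_w (x' w ^+ 2)%:E <= M%:E)%E -> (\int[P]_w (y w ^+ 2)%:E <= M%:E)%E ->
  (\int[P]_w ((x w - x' w) ^+ 2)%:E <= (M * s ^+ 2)%:E)%E ->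
  (\int[P]_w ((y w - y' w) ^+ 2)%:E <= (M * s ^+ 2)%:E)%E ->
  P.-integrable setT (EFin \o (fun w => x w * y w)) ->
  P.-integrable setT (EFin \o (fun w => x' w * y' w)) ->
  `|(\int[P]_w (x w * y w))%R - (\int[P]_w (x' w * y' w))%R| <= 2 * M * s.
Proof.
move=> s0 mx my mx' my' hx' hy hxx hyy ixy ixy'.
have si : 0 < s^-1 by rewrite invr_gt0.
have mdx : measurable_fun setT (fun w => x w - x' w) by exact: measurable_funB.
have mdy : measurable_fun setT (fun w => y w - y' w) by exact: measurable_funB.
have [i1 h1] := abs_mean_le (measurable_funM mdx my) (int_prod_le si mdx my hxx hy).
have [i2 h2] := abs_mean_le (measurable_funM mx' mdy) (int_prod_le s0 mx' mdy hx' hyy).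
rewrite -RintegralB//.
have -> : (\int[P]_w (x w * y w - x' w * y' w))%R =
    (\int[P]_w ((x w - x' w) * y w))%R + (\int[P]_w (x' w * (y w - y' w)))%R.
  by rewrite -RintegralD//; apply: eq_Rintegral => w _; ring.
apply: (le_trans (ler_normD _ _)); apply: (le_trans (lerD h1 h2)).
by rewrite le_eqVlt; apply/orP; left; apply/eqP; field; exact: lt0r_neq0.
Qed.

End SquareMeans.

Section Observables.
Context {R : realType} {dOm : measure_display} {Om : measurableType dOm}.
Variable P : probability Om R.
Variables (n d : nat) (n0 : (0 < n)%N) (T : R) (T0 : 0 < T).
Variables (A : 'M[R]_n) (B : 'M[R]_(n, d)) (x0 : 'cV[R]_n) (k : R) (k0 : 0 <= k).
Variables (W : Om -> R -> 'cV[R]_n) (hW : brownian_motion P W).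
Hypothesis hWc : forall w, W w 0 = 0 /\ {within `[0, +oo[, continuous (W w)}.
Implicit Types (K : R -> 'M[R]_(d, n)) (X : Om -> R -> 'cV[R]_n).
Local Notation solves := (solves P T A B x0 W).

Lemma state_vec_sum K (x : R -> 'cV[R]_n) t a :
  state_vec K x t a 0 = \sum_c lift_gain (K t) a c * x t c 0.
Proof. by rewrite state_vecE mxE. Qed.

Lemma bmeas_lift K a c : admissible T k K -> bmeas T (fun t => lift_gain (K t) a c).
Proof.
move=> hK; rewrite /lift_gain; case: (split_ordP a) => i ->.
  by under eq_fun do rewrite col_mxEu; exact: bmeas_cst.
by under eq_fun do rewrite col_mxEd; exact: bmeas_gain hK.
Qed.

Lemma state_vec_process K X a : admissible T k K -> solves K X ->
  process T (fun w t => state_vec K (X w) t a 0).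
Proof.
move=> hK hX.
rewrite (_ : (fun _ _ => _) = fun w t => \sum_c lift_gain (K t) a c * X w t c 0).
  apply: (process_sum T0) => c; apply: processM; last exact: (solves_process T0 _ hX).
  apply: (process_det T0); exact: bmeas_lift.
by apply/funext => w; apply/funext => t; rewrite state_vec_sum.
Qed.

Lemma state_vec_measurable K X a t : admissible T k K -> solves K X -> 0 <= t <= T ->
  measurable_fun setT (fun w => state_vec K (X w) t a 0).
Proof. by move=> hK hX; exact: (process_at (state_vec_process a hK hX)). Qed.

Lemma residual_measurable N K X a b : (0 < N)%N -> admissible T k K -> solves K X ->
  measurable_fun setT (fun w => residual_sum T A B N K (X w) a b).
Proof.
move=> N0 hK hX; have [mX _ _] := hX.
have tT i : (i <= N)%N -> 0 <= i%:R * (T / N%:R) <= T by move=> iN; exact: grid_time.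
apply: measurable_sum => i; have iN := ltn_ord i; apply: measurable_funM.
  by apply: state_vec_measurable => //; apply: tT; exact: ltnW.
under eq_fun do rewrite mxeD mxeD !mxeN mxeZ drift_loop.
apply: measurable_funB.
  by apply: measurable_funB; apply: mX; apply: tT => //; exact: ltnW.
apply: measurable_funM => //; apply: measurable_sum => m; apply: measurable_funM => //.
by apply: mX; apply: tT; exact: ltnW.
Qed.

Lemma gram_measurable N K X a b : (0 < N)%N -> admissible T k K -> solves K X ->
  measurable_fun setT (fun w => gram_sum T N K (X w) a b).
Proof.
move=> N0 hK hX; apply: measurable_sum => i; apply: measurable_funM => //.
by apply: measurable_funM; apply: state_vec_measurable => //;
  apply: (grid_time T0) => //; exact: ltnW.
Qed.

(** The exponent given by [path_sums] is shared equally between the energy and the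
    stochastic integral. *)
Lemma observables_exp : exists l M, [/\ 0 < l, 0 <= M & forall N K X a, (0 < N)%N ->
  grid_gain T k N K -> solves K X ->
  (forall b, (\int[P]_w (expR (l * `|residual_sum T A B N K (X w) a b|))%:E <= M%:E)%E) /\
  (forall b, (\int[P]_w (expR (l * `|gram_sum T N K (X w) a b|))%:E <= M%:E)%E)].
Proof.
have [C C0 hC] := path_sums A B x0 T0 k0.
have [kap [M0 [kap0 M00 hE]]] := grid_energy_exp n0 T0 hW hWc.
have k1 : 0 <= 1 + k by rewrite addr_ge0.
have [l' l'0 hS] := noise_sum_exp n0 T0 hW hWc k1.
have C1 : 0 < 2 * C + 1 by rewrite ltr_wpDl// mulr_ge0.
pose l := Num.min (kap / (2 * C + 1)) l' / 2.
have l0 : 0 < l by rewrite /l divr_gt0// lt_min l'0 divr_gt0.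
have l1 : 2 * l * C <= kap.
  have h : 2 * l <= kap / (2 * C + 1) by rewrite /l mulrC divfK// ge_min lexx.
  apply: (le_trans (ler_wpM2r C0 h)); rewrite mulrAC ler_pdivrMr// ler_wpM2l ?(ltW kap0)//; lra.
have l2 : 2 * l <= l' by rewrite /l mulrC divfK// ge_min lexx orbT.
exists l, ((M0 + 4) / 2); split=> //; first by rewrite divr_ge0// addr_ge0.
move=> N K X a N0 hK hX; have [hadm _] := hK; have [_ _ aeX] := hX.
have [mE hE'] := hE N N0.
have E0 w : 0 <= grid_energy T N (W w).
  have := energy_ge1 T (W w); have := sqnorm_ge0 (W w T).
  have : 0 <= N%:R^-1 * \sum_(i < N) sqnorm (W w (i%:R * (T / N%:R))).
    by rewrite mulr_ge0 ?invr_ge0//; apply: sumr_ge0 => i _; exact: sqnorm_ge0.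
  by rewrite /grid_energy; lra.
have hE2 : (\int[P]_w (expR (2 * (l * (C * grid_energy T N (W w)))))%:E <= M0%:E)%E.
  apply: le_trans hE'; apply: ge0_le_int.
  - by apply: measurable_expR_comp; do 2 apply: measurable_funM => //.
  - exact: measurable_expR_comp.
  - by move=> w; exact: expR_ge0.
  - move=> w; rewrite ler_expR; apply: le_trans (ler_wpM2r (E0 w) l1).
    by rewrite le_eqVlt; apply/orP; left; apply/eqP; rewrite !mulrA.
pose h m c := lift_gain (K (m%:R * (T / N%:R))) a c.
have hh i c : (i < N)%N -> `|h i c| <= 1 + k.
  move=> iN; rewrite (le_trans (mx_norm_entry _ _ _))//; apply: lift_gain_le.
  by apply: hadm.2; apply: (grid_time T0) => //; exact: ltnW.
have mN b : measurable_fun setT (fun w => `|noise_sum T N h b (W w)|).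
  by apply: measurableT_comp => //; exact: (noise_sum_measurable T0 hW).
have hS2 b : (\int[P]_w (expR (2 * (l * `|noise_sum T N h b (W w)|)))%:E <= 4%:E)%E.
  apply: le_trans (hS N h b N0 hh); apply: ge0_le_int.
  - by apply: measurable_expR_comp; exact: measurable_funM.
  - exact: measurable_expR_comp.
  - by move=> w; exact: expR_ge0.
  - by move=> w; rewrite ler_expR mulrA ler_wpM2r.
have m1 : measurable_fun setT (fun w => l * (C * grid_energy T N (W w))).
  by do 2 apply: measurable_funM => //.
have m2 b : measurable_fun setT (fun w => l * `|noise_sum T N h b (W w)|).
  exact: measurable_funM.
have main b := int_expR_half m1 (m2 b) hE2 (hS2 b).
have nb : exists b : 'I_n, true by exists (Ordinal n0).
split=> b.
  apply: le_trans (main b); apply: int_le_ae.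
  - by apply: measurable_expR_comp; apply: measurableT_comp => //; exact: residual_measurable.
  - by apply: measurableT_comp => //; exact: measurable_funD.
  - by move=> w; exact: expR_ge0.
  - by move=> w; exact: expR_ge0.
  - apply: filterS aeX => w hsol; have [hr _] := hC N K (W w) (X w) a N0 hK hsol (hWc w).1.
    by rewrite ler_expR -mulrDr ler_wpM2l ?(ltW l0)//; exact: hr.
apply: le_trans (main (Ordinal n0)); apply: int_le_ae.
- by apply: measurable_expR_comp; apply: measurableT_comp => //; exact: gram_measurable.
- by apply: measurableT_comp => //; exact: measurable_funD.
- by move=> w; exact: expR_ge0.
- by move=> w; exact: expR_ge0.
- apply: filterS aeX => w hsol; have [_ hg] := hC N K (W w) (X w) a N0 hK hsol (hWc w).1.
  rewrite ler_expR -mulrDr ler_wpM2l ?(ltW l0)//; apply: (le_trans (hg b)).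
  by rewrite lerDl.
Qed.

(** Given the orthogonality of the increment, only the drift contributes. Its
    correlation with the state at the left end is [loop_matrix * f], and both
    factors vary by [O(tau)] over the cell. *)
Lemma cell_residual_mean : exists2 C, 0 <= C & forall N K X i c b, (i < N)%N ->
  grid_gain T k N K -> solves K X ->
  let tau := T / N%:R in let t := i%:R * tau in let t' := i.+1%:R * tau in
  P.-integrable setT (EFin \o (fun w => X w t c 0 *
    (X w t' - X w t - tau *: drift A B K (X w) t) b 0)) /\
  `|(\int[P]_w (X w t c 0 * (X w t' - X w t - tau *: drift A B K (X w) t) b 0))%R| <= C * tau ^+ 2.
Proof.
have [CX CX0 hCX] := state_sqr_mean T0 A B x0 k0 hW hWc.
have [CD CD0 hCD] := mean_drift T0 A B x0 k0 hW hWc.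
pose lc := loop_const A B k; have lc0 : 0 <= lc by exact: loop_const_ge0.
pose Cf := (CX + CD) / 2; have Cf0 : 0 <= Cf by rewrite divr_ge0// addr_ge0.
pose D := d%:R * `|B| * k * Cf + lc * (n%:R * (lc * Cf)).
have D0 : 0 <= D by rewrite /D; nonneg.
exists (n%:R * D); first by rewrite mulr_ge0.
move=> N K X i c b iN [hK jK] hX tau t t'; have [mX _ _] := hX.
have N0 : (0 < N)%N by exact: leq_ltn_trans iN.
have tau0 : 0 < tau by rewrite divr_gt0// ltr0n.
have ht : 0 <= t <= T by apply: (grid_time T0) => //; exact: ltnW.
have ht' : 0 <= t' <= T by exact: (grid_time T0).
have /andP[t0 tT] := ht; have /andP[t'0 t'T] := ht'.
have tt' : t <= t' by rewrite /t /t' ler_pM2r// ler_nat.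
have tE : t' - t = tau by rewrite /t' /t -natr1 mulrDl mul1r addrAC subrr add0r.
have mV := mX t c ht; have hV := hCX K X hK hX t c ht.
have := hCD K X _ _ hK hX mV hV.
set f := (fun m r => (\int[P]_w _)%R) => -[bf hf hdf].
have orth l r : t <= r -> r <= T -> (\int[P]_w (X w t c 0 * incr W t r w l 0))%R = 0.
  by move=> tr rT; apply: (state_orth T0 k0 hW hWc c l hK hX) => //.
have bLf l m : bmeas T (fun r => loop_matrix A B K r l m * f m r).
  by apply: bmeasM => //; exact: bmeas_loop hK.
have hLf l m r : 0 <= r <= T -> `|loop_matrix A B K r l m * f m r| <= lc * Cf.
  move=> hr; rewrite normrM ler_pM//; first by apply: loop_matrix_le hK hr.
  by case: (hf m r hr).
have hfr m r : t <= r -> r <= t' -> `|f m r - f m t| <= n%:R * (lc * Cf) * tau.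
  move=> tr rt'; have rT := le_trans rt' t'T.
  rewrite hdf// orth// addr0; apply: (le_trans (ler_norm_sum _ _ _)).
  apply: (@le_trans _ _ (\sum_(j < n) lc * Cf * tau)).
    apply: ler_sum => j _; apply: (le_trans (norm_integ (bLf m j) t0 rT)).
    apply: (@le_trans _ _ (integ (fun=> lc * Cf) t r)).
      apply: (le_integ (bmeas_norm (bLf m j)) (bmeas_cst T _) t0 rT) => x /andP[tx xr].
      by apply: hLf; rewrite (le_trans t0)//= (le_trans xr).
    have hrt : r - t <= tau by rewrite -[leRHS]tE lerD2r.
    by rewrite integ_cst// ler_wpM2l// mulr_ge0.
  rewrite sumr_const card_ord -[leLHS]mulr_natl.
  by rewrite le_eqVlt; apply/orP; left; apply/eqP; ring.
have i1 := (hf b t' ht').1; have i2 := (hf b t ht).1.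
have iZ m : P.-integrable setT
    (EFin \o (fun w => tau * loop_matrix A B K t b m * (X w t c 0 * X w t m 0))).
  exact: (integrableZl measurableT _ (hf m t ht).1).
have [iS ES] := Rint_sum (index_enum 'I_n) iZ.
have i12 := integrableB measurableT i1 i2.
have YE : (fun w => X w t c 0 * (X w t' - X w t - tau *: drift A B K (X w) t) b 0) =
  (fun w => X w t c 0 * X w t' b 0 - X w t c 0 * X w t b 0 -
     \sum_m tau * loop_matrix A B K t b m * (X w t c 0 * X w t m 0)).
  apply/funext => w; rewrite mxeD mxeD !mxeN mxeZ drift_loop !mulrBr; congr (_ - _).
  rewrite !mulr_sumr; apply: eq_bigr => m _; ring.
rewrite YE; split; first exact: (integrableB measurableT i12 iS).
rewrite (RintegralB measurableT i12 iS) (RintegralB measurableT i1 i2) ES.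
rewrite -[X in X - _]/(f b t' - f b t) hdf// orth// addr0 -sumrB.
apply: (le_trans (ler_norm_sum _ _ _)).
apply: (@le_trans _ _ (\sum_(m < n) D * tau ^+ 2)); last first.
  rewrite sumr_const card_ord -[leLHS]mulr_natl.
  by rewrite le_eqVlt; apply/orP; left; apply/eqP; ring.
apply: ler_sum => m _.
rewrite RintegralZl//; last exact: (hf m t ht).1.
rewrite -/(f m t); set L0 := loop_matrix A B K t b m.
have bm := bLf b m; have bc := bmeas_cst T (- (L0 * f m t)).
have -> : integ (fun r => loop_matrix A B K r b m * f m r) t t' - tau * L0 * f m t =
    integ (fun r => loop_matrix A B K r b m * f m r + - (L0 * f m t)) t t'.
  rewrite (integD bm bc)// integ_cst// tE; ring.
apply: (le_trans (norm_integ (bmeasD bm bc) t0 t'T)).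
apply: (@le_trans _ _ (integ (fun=> D * tau) t t')); last first.
  rewrite integ_cst// tE; have -> : D * tau ^+ 2 = D * tau * tau by ring.
  by [].
apply: (le_integ (bmeas_norm (bmeasD bm bc)) (bmeas_cst T _) t0 t'T) => r /andP[tr rt'].
have hr : 0 <= r <= T by rewrite (le_trans t0)//= (le_trans rt').
have -> : loop_matrix A B K r b m * f m r + - (L0 * f m t) =
  (loop_matrix A B K r b m - L0) * f m r + L0 * (f m r - f m t) by ring.
apply: (le_trans (ler_normD _ _)); rewrite /D [leRHS]mulrDl; apply: lerD; rewrite normrM.
  rewrite [leRHS](_ : _ = d%:R * `|B| * (k * tau) * Cf); last by ring.
  apply: ler_pM => //; last by case: (hf m r hr).
  rewrite /L0 /loop_matrix -mxeN -mxeD opprD addrACA subrr add0r -mulmxBr.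
  rewrite (le_trans (mx_norm_entry _ _ _))//; apply: mx_norm_mulmx_le => //.
  by apply: jK => //; rewrite tr.
rewrite -mulrA; apply: ler_pM => //; first by apply: loop_matrix_le hK ht.
by apply: hfr.
Qed.

(** The [N] cells contribute [O(tau ^ 2)] each. *)
Lemma residual_mean : exists2 C, 0 <= C & forall N K X a b, (0 < N)%N ->
  grid_gain T k N K -> solves K X ->
  `|(\int[P]_w residual_sum T A B N K (X w) a b)%R| <= C / N%:R.
Proof.
have [C C0 hC] := cell_residual_mean.
exists (n%:R * (1 + k) * C * T ^+ 2).
  by rewrite mulr_ge0 ?sqr_ge0// mulr_ge0// mulr_ge0// addr_ge0.
move=> N K X a b N0 hK hX; have [hadm _] := hK.
set tau := T / N%:R.
have tau0 : 0 < tau by rewrite divr_gt0// ltr0n.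
pose Y (i : 'I_N) (c : 'I_n) w := X w (i%:R * tau) c 0 *
  (X w (i.+1%:R * tau) - X w (i%:R * tau) - tau *: drift A B K (X w) (i%:R * tau)) b 0.
pose h (i : 'I_N) c := lift_gain (K (i%:R * tau)) a c.
have hY i c : P.-integrable setT (EFin \o Y i c) /\ `|(\int[P]_w Y i c w)%R| <= C * tau ^+ 2.
  exact: (hC N K X i c b (ltn_ord i) hK hX).
have iZ i c : P.-integrable setT (EFin \o (fun w => h i c * Y i c w)).
  exact: (integrableZl measurableT _ (hY i c).1).
have iS i := Rint_sum (index_enum 'I_n) (iZ i).
have iT := Rint_sum (index_enum 'I_N) (fun i => (iS i).1).
have -> : (fun w => residual_sum T A B N K (X w) a b) =
    (fun w => \sum_(i < N) \sum_c h i c * Y i c w).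
  apply/funext => w; apply: eq_bigr => i _; rewrite state_vec_sum mulr_suml.
  by apply: eq_bigr => c _; rewrite -mulrA.
rewrite iT.2; apply: (le_trans (ler_norm_sum _ _ _)).
apply: (@le_trans _ _ (\sum_(i < N) \sum_(c < n) (1 + k) * (C * tau ^+ 2))).
  apply: ler_sum => i _; rewrite (iS i).2; apply: (le_trans (ler_norm_sum _ _ _)).
  apply: ler_sum => c _; rewrite RintegralZl//; last exact: (hY i c).1.
  rewrite normrM ler_pM//; last exact: (hY i c).2.
  rewrite (le_trans (mx_norm_entry _ _ _))//; apply: lift_gain_le; apply: hadm.2.
  by apply: (grid_time T0) => //; exact: ltnW.
have tN : N%:R * tau = T by rewrite /tau mulrC divfK// pnatr_eq0 -lt0n.
have -> : n%:R * (1 + k) * C * T ^+ 2 / N%:R = n%:R * (1 + k) * C * (T * tau).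
  by rewrite /tau; ring.
rewrite !sumr_const !card_ord -2!mulr_natl -[in leRHS]tN.
by rewrite le_eqVlt; apply/orP; left; apply/eqP; ring.
Qed.

(** At corresponding times the regressors differ in mean square by [O(tau)]: by
    the increment of the state over a cell, and by the change of gain. Products
    are then compared through [mean_prod_diff] with [s = sqrt tau]. *)
Lemma gram_mean : exists2 C, 0 <= C & forall N K K' X X' a b, (0 < N)%N ->
  grid_gain T k N K -> admissible T k K' -> solves K X -> solves K' X' ->
  (forall s, 0 <= s <= T -> `|K s - K' s| <= k * (T / N%:R)) ->
  let G w := integ (fun s => state_vec K' (X' w) s a 0 * state_vec K' (X' w) s b 0) 0 T in
  [/\ measurable_fun setT G, P.-integrable setT (EFin \o G) &
  `|(\int[P]_w gram_sum T N K (X w) a b)%R - (\int[P]_w G w)%R| <= C * Num.sqrt (T / N%:R)].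
Proof.
have [CX CX0 hCX] := state_sqr_mean T0 A B x0 k0 hW hWc.
have [CI CI0 hCI] := state_incr_mean T0 A B x0 k0 hW hWc.
have [CD CD0 hCD] := state_diff_mean T0 A B x0 k0 hW hWc.
pose q := 1 + k; have q0 : 0 <= q by rewrite addr_ge0.
pose n2 : R := 2 ^+ n * n%:R; have n20 : 0 <= n2 by rewrite mulr_ge0// exprn_ge0.
pose M1 := n2 * (q ^+ 2 * CX).
pose M2 := 2 * (n2 * ((2 * k) ^+ 2 * CX) * T) + 2 * (n2 * (q ^+ 2 * (2 * CI + 2 * (CD * k ^+ 2 * T)))).
pose M := M1 + M2.
have M10 : 0 <= M1 by rewrite /M1; nonneg.
have M20 : 0 <= M2 by rewrite /M2; nonneg.
have M0 : 0 <= M by rewrite addr_ge0.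
exists (2 * M * T); first by nonneg.
move=> N K K' X X' a b N0 [hK jK] hK' hX hX' hKK G.
have [mX _ _] := hX; have [mX' _ _] := hX'.
set tau := T / N%:R in jK hKK *; pose t (i : nat) := i%:R * tau.
have tau0 : 0 < tau by rewrite divr_gt0// ltr0n.
have tauT : tau <= T.
  by rewrite /tau ler_pdivrMr ?ltr0n// ler_peMr ?ler1n// ltW.
have tT i : (i <= N)%N -> 0 <= t i <= T by move=> iN; exact: (grid_time T0).
have tN : t N = T by rewrite /t /tau mulrC divfK// pnatr_eq0 -lt0n.
have tS i : t i <= t i.+1 by rewrite /t ler_pM2r// ler_nat.
have tE i : t i.+1 - t i = tau by rewrite /t -natr1 mulrDl mul1r addrAC subrr add0r.
have hl H : `|H| <= k -> forall c e, `|lift_gain (R := R) (n := n) (d := d) H c e| <= q.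
  by move=> hH c e; rewrite (le_trans (mx_norm_entry _ _ _))//; exact: lift_gain_le.
have sq K1 X1 : admissible T k K1 -> solves K1 X1 -> forall s c, 0 <= s <= T ->
    (\int[P]_w (state_vec K1 (X1 w) s c 0 ^+ 2)%:E <= M%:E)%E.
  move=> hK1 hX1 s c hs; apply: (@le_trans _ _ M1%:E); last by rewrite lee_fin lerDl.
  under eq_integral do rewrite state_vec_sum.
  rewrite /M1 /n2 -mulrA; apply: int_sqr_lin.
  - by move=> e; apply: hl; exact: hK1.2.
  - by move=> e; case: hX1 => m _ _; exact: m.
  - by move=> e; exact: (hCX K1 X1).
have mz K1 X1 c s : admissible T k K1 -> solves K1 X1 -> 0 <= s <= T ->
    measurable_fun setT (fun w => state_vec K1 (X1 w) s c 0).
  by move=> hK1 hX1 hs; exact: state_vec_measurable.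
have iz K1 X1 c e s : admissible T k K1 -> solves K1 X1 -> 0 <= s <= T ->
    P.-integrable setT (EFin \o (fun w => state_vec K1 (X1 w) s c 0 * state_vec K1 (X1 w) s e 0)) /\
    (\int[P]_w `|state_vec K1 (X1 w) s c 0 * state_vec K1 (X1 w) s e 0|%:E <= M%:E)%E.
  move=> hK1 hX1 hs; have m1 := mz K1 X1 c s hK1 hX1 hs; have m2 := mz K1 X1 e s hK1 hX1 hs.
  have h := int_prod_le ltr01 m1 m2 (sq K1 X1 hK1 hX1 s c hs) (sq K1 X1 hK1 hX1 s e hs).
  split; first by case: (abs_mean_le (measurable_funM m1 m2) h).
  by apply: le_trans h _; rewrite lee_fin invr1 !mul1r; lra.
have dz i s c : (i < N)%N -> t i <= s <= t i.+1 ->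
   (\int[P]_w ((state_vec K (X w) (t i) c 0 - state_vec K' (X' w) s c 0) ^+ 2)%:E <=
     (M * (Num.sqrt tau) ^+ 2)%:E)%E.
  move=> iN hs; have /andP[s1 s2] := hs; have hti := tT i (ltnW iN).
  have /andP[ti0 tiT] := hti; have /andP[ti10 ti1T] := tT i.+1 iN.
  have sT : 0 <= s <= T by rewrite (le_trans ti0)//= (le_trans s2).
  have dK : `|K (t i) - K' s| <= 2 * k * tau.
    rewrite -(subrK (K s) (K (t i))) -addrA (le_trans (ler_normD _ _))//.
    rewrite -mulrA mulr_natl mulr2n lerD ?hKK// -normrN opprB; exact: jK.
  pose y1 w := \sum_e (lift_gain (K (t i)) c e - lift_gain (K' s) c e) * X w (t i) e 0.
  pose y2 w := \sum_e lift_gain (K' s) c e * (X w (t i) e 0 - X' w s e 0).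
  have h1 : (\int[P]_w (y1 w ^+ 2)%:E <= (2 ^+ n * (n%:R * ((2 * k * tau) ^+ 2 * CX)))%:E)%E.
    apply: int_sqr_lin.
    - move=> e; rewrite -mxeN -mxeD (le_trans (mx_norm_entry _ _ _))//.
      exact: le_trans (lift_gain_diff _ _) dK.
    - by move=> e; exact: mX.
    - by move=> e; exact: (hCX K X).
  have h2 : (\int[P]_w (y2 w ^+ 2)%:E <=
      (2 ^+ n * (n%:R * (q ^+ 2 * ((2 * CI + 2 * (CD * k ^+ 2 * T)) * tau))))%:E)%E.
    apply: int_sqr_lin.
    - by move=> e; apply: hl; exact: hK'.2.
    - by move=> e; apply: measurable_funB; [exact: mX|exact: mX'].
    move=> e.
    have g1 := hCI K X hK hX (t i) s e ti0 s1 (le_trans s2 ti1T).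
    have ktau0 : 0 <= k * tau by rewrite mulr_ge0// ltW.
    have g2 := hCD K K' X X' _ hK hK' hX hX' ktau0 hKK s e sT.
    have m1 : measurable_fun setT (fun w => (X w s e 0 - X w (t i) e 0) ^+ 2).
      by apply: measurable_funX; apply: measurable_funB; exact: mX.
    have m2 : measurable_fun setT (fun w => (X w s e 0 - X' w s e 0) ^+ 2).
      by apply: measurable_funX; apply: measurable_funB; [exact: mX|exact: mX'].
    have g1' := int_scale (ler0n R 2) m1 (fun w => sqr_ge0 _) g1.
    have g2' := int_scale (ler0n R 2) m2 (fun w => sqr_ge0 _) g2.
    have m1' : measurable_fun setT (fun w => 2 * (X w s e 0 - X w (t i) e 0) ^+ 2).
      exact: measurable_funM.
    have m2' : measurable_fun setT (fun w => 2 * (X w s e 0 - X' w s e 0) ^+ 2).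
      exact: measurable_funM.
    have := int_add_le m1' m2' _ _ g1' g2'.
    move=> /(_ (fun w => mulr_ge0 (ler0n R 2) (sqr_ge0 _)) (fun w => mulr_ge0 (ler0n R 2) (sqr_ge0 _))) g.
    apply: (@le_trans _ _ (2 * (CI * (s - t i)) + 2 * (CD * (k * tau) ^+ 2))%:E).
      apply: le_trans g; apply: ge0_le_int.
      - by apply: measurable_funX; apply: measurable_funB; [exact: mX|exact: mX'].
      - exact: measurable_funD.
      - by move=> w; exact: sqr_ge0.
      - move=> w; move: (X w (t i) e 0) (X w s e 0) (X' w s e 0) => x y z.
        by have := sqr_ge0 (2 * y - x - z); lra.
    have hst : s - t i <= tau by rewrite -(tE i) lerD2r.
    rewrite lee_fin [leRHS]mulrDl; apply: lerD.
      by rewrite -[leRHS]mulrA ler_wpM2l// ler_wpM2l.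
    rewrite [leLHS](_ : _ = 2 * (CD * k ^+ 2 * tau) * tau); last by ring.
    rewrite ler_wpM2r ?(ltW tau0)// ler_wpM2l// ler_wpM2l//; nonneg.
  have my1 : measurable_fun setT y1.
    by apply: measurable_sum => e; apply: measurable_funM => //; exact: mX.
  have my2 : measurable_fun setT y2.
    apply: measurable_sum => e; apply: measurable_funM => //.
    by apply: measurable_funB; [exact: mX|exact: mX'].
  have m1 := measurable_funX 2 my1; have m2 := measurable_funX 2 my2.
  have g1' := int_scale (ler0n R 2) m1 (fun w => sqr_ge0 _) h1.
  have g2' := int_scale (ler0n R 2) m2 (fun w => sqr_ge0 _) h2.
  have m1' : measurable_fun setT (fun w => 2 * y1 w ^+ 2) by exact: measurable_funM.
  have m2' : measurable_fun setT (fun w => 2 * y2 w ^+ 2) by exact: measurable_funM.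
  have := int_add_le m1' m2' _ _ g1' g2'.
  move=> /(_ (fun w => mulr_ge0 (ler0n R 2) (sqr_ge0 _)) (fun w => mulr_ge0 (ler0n R 2) (sqr_ge0 _))) g.
  apply: (@le_trans _ _ (M2 * tau)%:E).
    apply: (@le_trans _ _ (\int[P]_w (2 * y1 w ^+ 2 + 2 * y2 w ^+ 2)%:E)%E).
      apply: ge0_le_int.
      - by apply: measurable_funX; apply: measurable_funB; exact: mz.
      - exact: measurable_funD.
      - by move=> w; exact: sqr_ge0.
      - move=> w.
        have -> : state_vec K (X w) (t i) c 0 - state_vec K' (X' w) s c 0 = y1 w + y2 w.
          rewrite !state_vec_sum -sumrB -big_split/=; apply: eq_bigr => e _; ring.
        by have := sqr_ge0 (y1 w - y2 w); nra.
    apply: (le_trans g); rewrite lee_fin /M2 [leRHS]mulrDl; apply: lerD.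
      rewrite [leLHS](_ : _ = 2 * (n2 * ((2 * k) ^+ 2 * CX) * tau) * tau); last by rewrite /n2; ring.
      rewrite ler_wpM2r ?(ltW tau0)// ler_wpM2l// ler_wpM2l//; nonneg.
    by rewrite le_eqVlt; apply/orP; left; apply/eqP; rewrite /n2; ring.
  by rewrite lee_fin sqr_sqrtr ?(ltW tau0)// ler_wpM2r ?(ltW tau0)// lerDr.
have pz : process T (fun w s => state_vec K' (X' w) s a 0 * state_vec K' (X' w) s b 0).
  by apply: processM; exact: state_vec_process.
have [bG hG] := path_fubini T0 pz (fun s hs => (iz K' X' a b s hK' hX' hs).2).
have [mG iG EG] := hG 0 T (lexx _) (ltW T0) (lexx _).
split=> //.
set g' := (fun s => (\int[P]_w _)%R) in bG EG.
rewrite EG.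
have bg' := bG.
have sumI j : (j <= N)%N -> \sum_(i < j) integ g' (t i) (t i.+1) = integ g' 0 (t j).
  elim: j => [|j IH] jN.
    by rewrite big_ord0 /t mul0r set_itv1 Rintegral_set1.
  rewrite big_ord_recr /= IH ?(ltnW jN)//; symmetry.
  have /andP[u1 u2] := tT j (ltnW jN); have /andP[u3 u4] := tT _ jN.
  exact: (integ_chasles bg' u1 (tS j) u4).
rewrite -{2}tN -(sumI N (leqnn N)).
have izi (i : 'I_N) : P.-integrable setT (EFin \o (fun w => tau *
    (state_vec K (X w) (t i) a 0 * state_vec K (X w) (t i) b 0))).
  have [h _] := iz K X a b (t i) hK hX (tT i (ltnW (ltn_ord i))).
  exact: (integrableZl measurableT tau h).
have [_ ->] := Rint_sum (index_enum 'I_N) izi.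
rewrite -sumrB; apply: (le_trans (ler_norm_sum _ _ _)).
have s0 : 0 < Num.sqrt tau by rewrite sqrtr_gt0.
apply: (@le_trans _ _ (\sum_(i < N) (2 * M * Num.sqrt tau) * tau)); last first.
  have tauN : N%:R * tau = T by rewrite /tau mulrC divfK// pnatr_eq0 -lt0n.
  rewrite sumr_const card_ord -[leLHS]mulr_natl -[in leRHS]tauN.
  by rewrite le_eqVlt; apply/orP; left; apply/eqP; ring.
apply: ler_sum => i _; have iN := ltn_ord i.
have /andP[ti0 tiT] := tT i (ltnW iN); have /andP[ti10 ti1T] := tT i.+1 iN.
have hzi := iz K X a b (t i) hK hX (tT i (ltnW iN)).
rewrite RintegralZl//; last exact: hzi.1.
set e := (\int[P]_w _)%R.
have bge := bmeasN bg'; have be := bmeas_cst T e.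
have -> : tau * e - integ g' (t i) (t i.+1) = integ (fun s => e + - g' s) (t i) (t i.+1).
  rewrite (integD be bge)// integ_cst// tE; congr (_ + _); first by rewrite mulrC.
  rewrite -mulN1r -(integZ _ bg')//; apply: eq_integ => s _; by rewrite mulN1r.
apply: (le_trans (norm_integ (bmeasD be bge) ti0 ti1T)).
rewrite [leRHS](_ : _ = integ (fun=> 2 * M * Num.sqrt tau) (t i) (t i.+1)); last first.
  by rewrite integ_cst// tE.
apply: (le_integ (bmeas_norm (bmeasD be bge)) (bmeas_cst T _) ti0 ti1T) => s hs.
have sT : 0 <= s <= T.
  by case/andP: hs => u1 u2; rewrite (le_trans ti0)//= (le_trans u2).
apply: mean_prod_diff => //.
- by apply: mz => //; exact: tT (ltnW iN).
- by apply: mz => //; exact: tT (ltnW iN).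
- exact: mz.
- exact: mz.
- exact: sq.
- by apply: sq => //; exact: tT (ltnW iN).
- exact: dz.
- exact: dz.
- exact: hzi.1.
- exact: (iz K' X' a b s hK' hX' sT).1.
Qed.

End Observables.

(** * Passage to the given solutions and gains *)

Section NonMeasurable.
Context {R : realType} {dOm : measure_display} {Om : measurableType dOm}.
Variable P : probability Om R.

Import HBNNSimple.

Lemma ge0_integral_ae_le (f g : Om -> \bar R) : (forall w, (0 <= f w)%E) ->
  (forall w, (0 <= g w)%E) -> {ae P, forall w, f w = g w} ->
  (\int[P]_w f w <= \int[P]_w g w)%E.
Proof.
move=> f0 g0 [N [mN N0 hN]].
rewrite ge0_integralTE// ge0_integralTE//; apply: ge_ereal_sup => _ [h /= hf <-].
have mNC : measurable (~` N) by exact: measurableC.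
apply: (@le_trans _ _ (sintegral P (proj_nnsfun h mNC))); last first.
  apply: ereal_sup_ubound; exists (proj_nnsfun h mNC) => //= w.
  rewrite mindicE; case: (boolP (w \in ~` N)) => [wN|_]; last by rewrite mulr0.
  rewrite mulr1 -(_ : f w = g w)//; apply: contrapT => fg.
  by move/set_mem: wN; apply; exact: hN.
rewrite -!integralT_nnsfun le_eqVlt; apply/orP; left; apply/eqP.
apply: ae_eq_integral => //.
- exact/measurable_EFinP.
- exact/measurable_EFinP.
exists N; split=> // w /= hw; apply: contrapT => wN; apply: hw => _.
by rewrite mindicE mem_set// mulr1.
Qed.

(** An expectation does not see a null set, even when the integrand is not
    measurable: simple minorants may be cut off on the null set. *)
Lemma integral_ae (f g : Om -> R) : {ae P, forall w, f w = g w} ->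
  (\int[P]_w (f w)%:E = \int[P]_w (g w)%:E)%E.
Proof.
have key (u v : Om -> \bar R) : (forall w, (0 <= u w)%E) -> (forall w, (0 <= v w)%E) ->
    {ae P, forall w, u w = v w} -> (\int[P]_w u w = \int[P]_w v w)%E.
  move=> u0 v0 uv; apply/eqP; rewrite eq_le !ge0_integral_ae_le//.
  by apply: filterS uv => w ->.
move=> fg; rewrite integralE [RHS]integralE; congr (_ - _)%E; apply: key.
- by move=> w; exact: funepos_ge0.
- by move=> w; exact: funepos_ge0.
- by apply: filterS fg => w e; rewrite !funeposE e.
- by move=> w; exact: funeneg_ge0.
- by move=> w; exact: funeneg_ge0.
- by apply: filterS fg => w e; rewrite !funenegE e.
Qed.

Lemma Rintegral_ae (f g : Om -> R) : {ae P, forall w, f w = g w} ->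
  (\int[P]_w f w)%R = (\int[P]_w g w)%R.
Proof. by move=> h; rewrite /Rintegral (integral_ae h). Qed.

End NonMeasurable.

Section Solutions.
Context {R : realType} {dOm : measure_display} {Om : measurableType dOm}.
Variable P : probability Om R.
Variables (n d : nat) (T : R) (T0 : 0 < T).
Variables (A : 'M[R]_n) (B : 'M[R]_(n, d)) (x0 : 'cV[R]_n).
Variables (W W' : Om -> R -> 'cV[R]_n).
Hypothesis hW' : {ae P, forall w, W' w = W w}.
Hypothesis hWc : forall w, W' w 0 = 0 /\ {within `[0, +oo[, continuous (W' w)}.

(** All paths of the new process are continuous, as joint measurability demands;
    the equation and the identity with the given process hold almost surely. *)
Lemma sde_modification K X : sde_solution P T A B x0 W K X ->
  exists2 X', solves P T A B x0 W' K X' & {ae P, forall w, X' w = X w}.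
Proof.
move=> [mX aeX]; have [X' [mX' X'E aeX']] := modification aeX mX.
exists X'; last by apply: filterS aeX' => w [].
split.
- by move=> t i ht; apply: mX'; rewrite /= in_itv.
- move=> w; case: (X'E w) => [[[Xc _] ->]//|->].
  exact/continuous_subspaceT/cst_continuous.
- apply: filterS2 hW' aeX' => w eW [[Xc hX] eX]; split.
  + by rewrite eX.
  + exact: (noise_cont hWc).
  + by rewrite eX eW.
Qed.

End Solutions.

Section GridGains.
Context {R : realType} {n d : nat}.
Variables (T : R) (T0 : 0 < T) (Q : 'M[R]_n) (Rc : 'M[R]_d).

Lemma measurable_of_truncn (D : set R) (g : nat -> R) (tau : R) :
  measurable D -> (forall t, D t -> 0 <= t) -> 0 < tau ->
  measurable_fun D (fun t => g (Num.truncn (t / tau))).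
Proof.
move=> mD D0 tau0 _ Y mY.
rewrite (_ : D `&` _ = \bigcup_(j in [set j | Y (g j)]) (D `&` `[j%:R * tau, j.+1%:R * tau[)).
  apply: bigcup_measurable => j _; apply: measurableI => //; exact: measurable_itv.
apply/seteqP; split=> [t /= [Dt hY]|t [j /= hj [Dt]]].
  exists (Num.truncn (t / tau)) => //; split=> //=; rewrite in_itv/=.
  have := truncn_itv (divr_ge0 (D0 t Dt) (ltW tau0)).
  by rewrite ler_pdivlMr// ltr_pdivrMr.
rewrite /= in_itv/= => /andP[h1 h2]; split=> //.
have q0 : 0 <= t / tau by rewrite divr_ge0 ?(ltW tau0)// D0.
rewrite (_ : Num.truncn _ = j)//; apply/eqP; rewrite truncn_eq//.
by rewrite ler_pdivlMr// ltr_pdivrMr// h1.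
Qed.

(** At [t = T] the cell index is [N], beyond the last cell; the Riccati iterate
    taken there is the terminal value zero. *)
Lemma gain_pw_end theta N : (0 < N)%N -> gain_pw T Q Rc theta N T = 0.
Proof.
move=> N0; rewrite /gain_pw.
have -> : Num.truncn (T / (T / N%:R)) = N.
  rewrite invf_div mulrCA divff ?mulr1 ?(lt0r_neq0 T0)//.
  by apply/eqP; rewrite truncn_eq// lexx ltr_nat ltnSn.
have -> : riccati_pw T Q Rc theta N N.+1 = 0.
  by rewrite /riccati_pw (eqP (_ : N - N.+1 == 0)%N) ?subn_eq0.
by rewrite mulmx0 mul0mx oppr0.
Qed.

(** The continuous gain is Lipschitz and the piecewise constant one follows it
    within [O(tau)], hence varies by [O(tau)] over a cell. At [t = T] both
    vanish, so that the comparison extends to the closed interval. *)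
Lemma gains_grid (hQ : sym_psd Q) (hRc : sym_pd Rc) (a : R) :
  exists2 k, 0 <= k & forall theta p, frobenius_norm theta <= a ->
  riccati_solution T Q Rc theta p ->
  admissible T k (gain_ct Rc theta p) /\
  forall N, (0 < N)%N -> grid_gain T k N (gain_pw T Q Rc theta N) /\
  forall s, 0 <= s <= T ->
    `|gain_pw T Q Rc theta N s - gain_ct Rc theta p s| <= k * (T / N%:R).
Proof.
have [C hC] := gains_uniform hQ hRc T0 a.
exists (3 * `|C|); first by rewrite mulr_ge0.
move=> theta p ha hp; have [h1 h2 h3 h4] := hC theta p (small_of_frobenius ha) hp.
have CC : C <= `|C| by exact: ler_norm.
have C3 : C <= 3 * `|C| by have := normr_ge0 C; lra.
have [pc _ pT] := hp.
have adm : admissible T (3 * `|C|) (gain_ct Rc theta p).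
  split=> [i j|s hs]; last exact: le_trans (h1 s hs) C3.
  suff [] : bmeas T (fun s => gain_ct Rc theta p s i j) by [].
  rewrite (_ : (fun s => _) = fun s => - \sum_l (invmx Rc *m (B_of theta)^T) i l * p s l j).
    apply: bmeasN; apply: bmeas_sum => l; apply: bmeasM; first exact: bmeas_cst.
    apply: bmeas_cont => x; apply: (@cvg_comp _ _ _ p (fun M => M l j) _ _ _ (pc x)).
    exact: coord_continuous.
  by apply/funext => s; rewrite /gain_ct mxeN mxE.
split=> // N N0; set tau := T / N%:R.
have tau0 : 0 < tau by rewrite divr_gt0// ltr0n.
have tN : N%:R * tau = T by rewrite /tau mulrC divfK// pnatr_eq0 -lt0n.
have hd s : 0 <= s <= T -> `|gain_pw T Q Rc theta N s - gain_ct Rc theta p s| <= `|C| * tau.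
  move=> /andP[s0]; rewrite le_eqVlt => /predU1P[->|sT].
    by rewrite gain_pw_end// /gain_ct pT mulmx0 oppr0 subrr normr0 mulr_ge0// ltW.
  apply: (le_trans (h4 N N0 s _)); first by rewrite s0.
  by rewrite ler_wpM2r// ltW.
split; last first.
  move=> s hs; apply: (le_trans (hd s hs)); rewrite ler_wpM2r ?(ltW tau0)//.
  by have := normr_ge0 C; lra.
split; first split=> [i j|s hs].
- pose g m := (- (invmx (Rc + tau *: ((B_of theta)^T *m riccati_pw T Q Rc theta N m.+1 *m B_of theta))
     *m (B_of theta)^T *m riccati_pw T Q Rc theta N m.+1 *m (1%:M + tau *: A_of theta))) i j.
  apply: (@measurable_of_truncn `[0, T]%classic g tau) => //.
  by move=> t /=; rewrite in_itv/= => /andP[].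
- exact: le_trans (h3 N N0 s) C3.
move=> i s iN; rewrite -/tau => /andP[s1 s2].
have i0 : 0 <= i%:R * tau by rewrite mulr_ge0// ltW.
have sT : s <= T by rewrite (le_trans s2)// -tN ler_pM2r// ler_nat.
have hs : 0 <= s <= T by rewrite (le_trans i0).
have hi : 0 <= i%:R * tau <= T by rewrite i0 (le_trans s1).
have e1 := hd s hs; have e2 := hd _ hi; have e3 := h2 _ _ i0 s1 sT.
have st : s - i%:R * tau <= tau.
  by rewrite lerBlDl (le_trans s2)// -natr1 mulrDl mul1r.
have e4 : `|gain_ct Rc theta p s - gain_ct Rc theta p (i%:R * tau)| <= `|C| * tau.
  apply: (le_trans e3); apply: (le_trans (ler_wpM2r _ CC)); first by rewrite subr_ge0.
  by rewrite ler_wpM2l.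
rewrite distrC in e2.
apply: (le_trans (ler_distD (gain_ct Rc theta p s) _ _)).
have e5 := ler_distD (gain_ct Rc theta p (i%:R * tau)) (gain_ct Rc theta p s)
  (gain_pw T Q Rc theta N (i%:R * tau)).
apply: (le_trans (lerD e1 (le_trans e5 (lerD e4 e2)))); lra.
Qed.

End GridGains.

(** * Moments of the regression sums in the model *)

Section ModelMoments.
Context {R : realType} {dOm : measure_display} {Om : measurableType dOm}.
Variable P : probability Om R.
Variables (n d : nat) (n0 : (0 < n)%N) (T : R) (T0 : 0 < T).
Variables (A : 'M[R]_n) (B : 'M[R]_(n, d)) (x0 : 'cV[R]_n) (k : R) (k0 : 0 <= k).
Variables (W : Om -> R -> 'cV[R]_n) (hW : brownian_motion P W).

(** The preceding estimates concern modifications all of whose paths are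
    continuous. The conclusions are expectations, hence they pass to the given
    processes, even though the time integrals of the latter need not be
    measurable functions of the outcome. *)
Lemma model_moments : exists l M C, [/\ 0 < l, 0 <= M, 0 <= C &
  forall N K K' (X X' : Om -> R -> 'cV[R]_n), (0 < N)%N ->
  grid_gain T k N K -> admissible T k K' ->
  sde_solution P T A B x0 W K X -> sde_solution P T A B x0 W K' X' ->
  (forall s, 0 <= s <= T -> `|K s - K' s| <= k * (T / N%:R)) -> forall a,
  (forall b, (\int[P]_w (expR (l * `|residual_sum T A B N K (X w) a b|))%:E <= M%:E)%E /\
     `|(\int[P]_w residual_sum T A B N K (X w) a b)%R| <= C / N%:R) /\
  (forall b, (\int[P]_w (expR (l * `|gram_sum T N K (X w) a b|))%:E <= M%:E)%E /\
     `|(\int[P]_w gram_sum T N K (X w) a b)%R -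
       expected_V P T (state_control K' X') a b| <= C * Num.sqrt (T / N%:R))].
Proof.
have [W' [hW' hWc aeW]] := brownian_modification hW.
have [l [M [l0 M0 hE]]] := observables_exp n0 T0 A B x0 k0 hW' hWc.
have [C1 C10 hR] := residual_mean T0 A B x0 k0 hW' hWc.
have [C2 C20 hG] := gram_mean T0 A B x0 k0 hW' hWc.
exists l, M, (C1 + C2); split=> //; first by rewrite addr_ge0.
move=> N K K' X X' N0 hK hK' hX hX' hKK a.
have N0' : 0 < N%:R :> R by rewrite ltr0n.
have [Y hY aeY] := sde_modification aeW hWc hX.
have [Y' hY' aeY'] := sde_modification aeW hWc hX'.
have [hEr hEg] := hE N K Y a N0 hK hY.
split=> b; split.
- apply: le_trans (hEr b); rewrite le_eqVlt; apply/orP; left; apply/eqP.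
  by apply: integral_ae; apply: filterS aeY => w ->.
- rewrite (_ : (\int[P]_w _)%R = (\int[P]_w residual_sum T A B N K (Y w) a b)%R); last first.
    by apply: Rintegral_ae; apply: filterS aeY => w ->.
  apply: (le_trans (hR N K Y a b N0 hK hY)).
  by rewrite ler_wpM2r ?invr_ge0// lerDl.
- apply: le_trans (hEg b); rewrite le_eqVlt; apply/orP; left; apply/eqP.
  by apply: integral_ae; apply: filterS aeY => w ->.
have [mG iG hGb] := hG N K K' Y Y' a b N0 hK hK' hY hY' hKK.
rewrite (_ : (\int[P]_w _)%R = (\int[P]_w gram_sum T N K (Y w) a b)%R); last first.
  by apply: Rintegral_ae; apply: filterS aeY => w ->.
rewrite /expected_V mxE expectation.unlock.
rewrite (_ : fine _ = (\int[P]_w (integ (fun s => state_vec K' (Y' w) s a 0 *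
   state_vec K' (Y' w) s b 0) 0 T))%R); last first.
  apply: Rintegral_ae; apply: filterS aeY' => w ->.
  rewrite /mx_integral mxE; apply: eq_integ => s _.
  by rewrite mxE big_ord1 [X in _ * X]mxE.
apply: (le_trans hGb); rewrite ler_wpM2r ?sqrtr_ge0// lerDr//.
Qed.

End ModelMoments.

(** * Observables of a path, measurability and the union bound *)

Section PathSpace.
Context {R : realType} {dOm : measure_display} {Om : measurableType dOm}.
Variable P : probability Om R.

Lemma path_sigma_preimage (D : set R) p (U : Om -> R -> 'cV[R]_p) C :
  stochastic_process D U -> path_sigma D C -> measurable (U @^-1` C).
Proof.
move=> mU; apply: preimage_generated => _ [t [E [Dt hE ->]]].
have : measurable ((fun w => U w t) @^-1` E); last by [].
move: E hE; apply: preimage_generated => _ [i [F [mF ->]]].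
by have := mU t Dt i measurableT F mF; rewrite setTI.
Qed.

(** Two nested generated sigma-algebras: coordinates of the path at observed
    times are measurable. *)
Lemma path_sigma_coord (D : set R) p t (i : 'I_p) (B : set R) : D t -> measurable B ->
  path_sigma D ((fun u : R -> 'cV[R]_p => u t i 0) @^-1` B).
Proof.
move=> Dt mB; apply: sub_sigma_algebra; exists t, [set v : 'cV[R]_p | B (v i 0)].
by split=> //; exact: vec_sigma_coord.
Qed.

(** The class of observables of a path: closed under the operations that
    build the regression sums out of coordinates. *)
Definition observable (D : set R) p (psi : (R -> 'cV[R]_p) -> R) : Prop :=
  forall B, measurable B -> path_sigma D (psi @^-1` B).

End PathSpace.

Section Observable.
Context {R : realType}.
Variables (D : set R) (p : nat).
Let G : set (set (R -> 'cV[R]_p)) := [set C | exists (t : R) (E : set 'cV[R]_p),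
  [/\ D t, vec_sigma E & C = [set x : R -> 'cV[R]_p | E (x t)]]].
Let pathT := g_sigma_algebraType G.

Let observable_measurable (psi : (R -> 'cV[R]_p) -> R) :
  observable D psi <-> measurable_fun setT (psi : pathT -> R).
Proof.
split=> h.
  by move=> _ B mB; rewrite setTI; exact: (h B mB).
by move=> B mB; have := h measurableT B mB; rewrite setTI.
Qed.

Lemma observable_coord t i : D t -> observable D (fun u : R -> 'cV[R]_p => u t i 0).
Proof. by move=> Dt B mB; exact: path_sigma_coord. Qed.

Lemma observable_cst c : observable D (fun _ : R -> 'cV[R]_p => c : R).
Proof. by apply/observable_measurable; exact: measurable_cst. Qed.

Lemma observableD (f g : (R -> 'cV[R]_p) -> R) : observable D f -> observable D g -> observable D (fun u => f u + g u).
Proof.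
move=> /observable_measurable hf /observable_measurable hg.
by apply/observable_measurable; exact: measurable_funD.
Qed.

Lemma observableM (f g : (R -> 'cV[R]_p) -> R) : observable D f -> observable D g -> observable D (fun u => f u * g u).
Proof.
move=> /observable_measurable hf /observable_measurable hg.
by apply/observable_measurable; exact: measurable_funM.
Qed.

Lemma observableN (f : (R -> 'cV[R]_p) -> R) : observable D f -> observable D (fun u => - f u).
Proof.
move=> hf; have := observableM (observable_cst (-1)) hf.
by congr observable; apply/funext => u; rewrite mulN1r.
Qed.

Lemma observable_sum (J : Type) (r : seq J) (f : J -> (R -> 'cV[R]_p) -> R) : (forall j, observable D (f j)) ->
  observable D (fun u => \sum_(j <- r) f j u).
Proof.
move=> hf; elim: r => [|j r IH].
  by under eq_fun do rewrite big_nil; exact: observable_cst.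
by under eq_fun do rewrite big_cons; exact: observableD.
Qed.

End Observable.

Section Sums.
Context {R : realType} {n d : nat}.
Variables (T : R) (theta : 'M[R]_(n + d, n)) (N : nat).
Let tau := T / N%:R.
Let t (i : nat) : R := i%:R * tau.

(** The sums are restated on the joint path of state and regressor, because the
    independence and the common law of the copies are those of this path. *)
Definition path_residual (a : 'I_(n + d)) (b : 'I_n) (u : R -> 'cV[R]_(n + (n + d))) : R :=
  \sum_(i < N) dsubmx (u (t i)) a 0 *
   ((usubmx (u (t i.+1)) - usubmx (u (t i))) b 0 -
     tau * \sum_j theta j b * dsubmx (u (t i)) j 0).

Definition path_gram (a b : 'I_(n + d)) (u : R -> 'cV[R]_(n + (n + d))) : R :=
  \sum_(i < N) tau * (dsubmx (u (t i)) a 0 * dsubmx (u (t i)) b 0).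

Lemma observable_residual a b : 0 < T -> (0 < N)%N -> observable `[0, T]%classic (path_residual a b).
Proof.
move=> T0 N0.
have hd i j : (i <= N)%N -> observable `[0, T]%classic
    (fun u : R -> 'cV[R]_(n + (n + d)) => dsubmx (u (t i)) j 0).
  move=> iN; rewrite (_ : (fun _ => _) = fun u : R -> 'cV[R]_(n + (n + d)) => u (t i) (rshift n j) 0); last first.
    by apply/funext => u; rewrite mxE.
  by apply: observable_coord; rewrite /= in_itv/=; exact: grid_time.
have hu i j : (i <= N)%N -> observable `[0, T]%classic
    (fun u : R -> 'cV[R]_(n + (n + d)) => usubmx (u (t i)) j 0).
  move=> iN; rewrite (_ : (fun _ => _) = fun u : R -> 'cV[R]_(n + (n + d)) => u (t i) (lshift (n + d) j) 0); last first.
    by apply/funext => u; rewrite mxE.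
  by apply: observable_coord; rewrite /= in_itv/=; exact: grid_time.
apply: observable_sum => i; have iN := ltn_ord i.
apply: observableM; first exact: hd (ltnW iN).
apply: observableD.
  rewrite (_ : (fun _ => _) = fun u : R -> 'cV[R]_(n + (n + d)) =>
    usubmx (u (t i.+1)) b 0 + - usubmx (u (t i)) b 0); last first.
    by apply/funext => u; rewrite mxeD mxeN.
  by apply: observableD; [exact: hu|apply: observableN; exact: hu (ltnW iN)].
apply: observableN; apply: observableM; first exact: observable_cst.
apply: observable_sum => j; apply: observableM; first exact: observable_cst.
exact: hd (ltnW iN).
Qed.

Lemma observable_gram a b : 0 < T -> (0 < N)%N -> observable `[0, T]%classic (path_gram a b).
Proof.
move=> T0 N0.
have hd i j : (i <= N)%N -> observable `[0, T]%classic
    (fun u : R -> 'cV[R]_(n + (n + d)) => dsubmx (u (t i)) j 0).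
  move=> iN; rewrite (_ : (fun _ => _) = fun u : R -> 'cV[R]_(n + (n + d)) => u (t i) (rshift n j) 0); last first.
    by apply/funext => u; rewrite mxE.
  by apply: observable_coord; rewrite /= in_itv/=; exact: grid_time.
apply: observable_sum => i; have iN := ltnW (ltn_ord i).
apply: observableM; first exact: observable_cst.
by apply: observableM; exact: hd.
Qed.

End Sums.

Lemma path_residual_joint {R : realType} {n d : nat} (T : R) A (B : 'M[R]_(n, d)) N K
  (x : R -> 'cV[R]_n) a b :
  path_residual T (theta_of A B) N a b (fun t => col_mx (x t) (col_mx (x t) (K t *m x t))) =
  residual_sum T A B N K x a b.
Proof.
apply: eq_bigr => i _; rewrite !col_mxKd !col_mxKu [in RHS]mxeD mxeN mxeZ; congr (_ * (_ - _ * _)).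
rewrite /drift mulmxA -[X in (_ + X *m _)]/(B *m K _) /theta_of.
rewrite -mulmxA -(mul_row_col A B) mxE; apply: eq_bigr => j _; congr (_ * _).
by rewrite -tr_row_mx mxE.
Qed.

Lemma path_gram_joint {R : realType} {n d : nat} (T : R) N (K : R -> 'M[R]_(d, n))
  (x : R -> 'cV[R]_n) a b :
  path_gram T N a b (fun t => col_mx (x t) (col_mx (x t) (K t *m x t))) = gram_sum T N K x a b.
Proof. by apply: eq_bigr => i _; rewrite !col_mxKd. Qed.

Section MatrixMeasurability.
Context {R : realType} {dOm : measure_display} {Om : measurableType dOm}.

Definition measurable_mx p q (M : Om -> 'M[R]_(p, q)) : Prop :=
  forall i j, measurable_fun setT (fun w => M w i j).

Lemma measurable_det p (M : Om -> 'M[R]_p) : measurable_mx M ->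
  measurable_fun setT (fun w => \det (M w)).
Proof.
move=> mM; rewrite /determinant; apply: measurable_sum => s; apply: measurable_funM => //.
by apply: measurable_prod => i _; exact: mM.
Qed.

Lemma measurable_inv : measurable_fun setT (fun x : R => x^-1).
Proof.
have m0 : measurable [set 0 : R] by [].
have mC : measurable (~` [set 0 : R]) by exact: measurableC.
rewrite -(setvU [set 0 : R]); apply/measurable_funU => //; split; last first.
  exact: measurable_fun_set1.
apply: open_continuous_measurable_fun.
  by apply: closed_openC; exact: closed_eq.
by move=> x /set_mem/eqP x0; exact: inv_continuous.
Qed.

(** The formula of Cramer where the determinant does not vanish, and the matrix
    itself elsewhere, by convention. *)
Lemma measurable_invmx p (M : Om -> 'M[R]_p) : measurable_mx M ->
  measurable_mx (fun w => invmx (M w)).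
Proof.
move=> mM i j; have mdet := measurable_det mM.
rewrite (_ : (fun w => _) = fun w => if \det (M w) == 0 then M w i j
  else (\det (M w))^-1 * \adj (M w) i j).
  apply: measurable_fun_ifT; [|exact: mM|].
    exact: (measurable_fun_eqr mdet (@measurable_cst _ _ Om R setT 0)).
  apply: measurable_funM; first exact: (measurableT_comp measurable_inv mdet).
  under eq_fun do rewrite mxE /cofactor; apply: measurable_funM => //.
  by apply: measurable_det => a b; under eq_fun do rewrite !mxE; exact: mM.
apply/funext => w; rewrite /invmx unitmxE unitfE; case: eqP => _ //=.
by rewrite mxE.
Qed.

Lemma measurable_mulmx p q r (M : Om -> 'M[R]_(p, q)) (M' : Om -> 'M[R]_(q, r)) :
  measurable_mx M -> measurable_mx M' -> measurable_mx (fun w => M w *m M' w).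
Proof.
move=> mM mM' i j; under eq_fun do rewrite mxE.
by apply: measurable_sum => l; exact: measurable_funM.
Qed.

Lemma measurable_frobenius_le p q (M : Om -> 'M[R]_(p, q)) c : measurable_mx M ->
  measurable [set w | frobenius_norm (M w) <= c].
Proof.
move=> mM; have [c0|c0] := ltP c 0.
  rewrite (_ : [set w | _] = set0)//; apply/seteqP; split=> // w /= h.
  by have := le_lt_trans h c0; rewrite ltNge frobenius_norm_ge0.
have mS : measurable_fun setT (fun w => \sum_i \sum_j M w i j ^+ 2).
  by apply: measurable_sum => i; apply: measurable_sum => j; exact: measurable_funX.
rewrite (_ : [set w | _] = setT `&` (fun w => \sum_i \sum_j M w i j ^+ 2) @^-1` `]-oo, c ^+ 2]).
  by apply: mS => //; exact: measurable_itv.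
rewrite setTI; apply/seteqP; split=> w /=; rewrite in_itv/=.
  move=> h; rewrite -[leLHS]sqr_sqrtr.
    by rewrite lerXn2r// nnegrE// frobenius_norm_ge0.
  by apply: sumr_ge0 => i _; apply: sumr_ge0 => j _; exact: sqr_ge0.
by move=> h; rewrite -[leRHS]ger0_norm// -sqrtr_sqr ler_wsqrtr.
Qed.

End MatrixMeasurability.

Section UnionBound.
Context {R : realType} {dOm : measure_display} {Om : measurableType dOm}.
Variable P : probability Om R.

Lemma union_bound (J : finType) (E : J -> set Om) (F : set Om) (q : R) :
  (forall j, measurable (E j)) -> measurable F -> (forall w, (forall j, ~ E j w) -> F w) ->
  (forall j, (P (E j) <= q%:E)%E) -> ((1 - #|J|%:R * q)%:E <= P F)%E.
Proof.
move=> mE mF hF hq.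
have : (P (~` F) <= (#|J|%:R * q)%:E)%E.
  rewrite -[~` F]setIT -integral_indic//; last exact: measurableC.
  apply: (@le_trans _ _ (\int[P]_w (\sum_(j : J) \1_(E j) w)%:E)%E).
    apply: ge0_le_int.
    - by apply: measurable_indic; exact: measurableC.
    - by apply: measurable_sum => j; exact: measurable_indic.
    - by move=> w.
    - move=> w; rewrite indicE; case: (boolP (w \in ~` F)) => [/set_mem wF|_]; last first.
        exact: sumr_ge0.
      have [j Ej] : exists j, E j w.
        by apply: contrapT => h; apply: wF; apply: hF => j Ej; apply: h; exists j.
      by rewrite (bigD1 j)//= indicE mem_set// lerDl sumr_ge0.
  rewrite -[#|J|](_ : size (index_enum J) = _); last by rewrite cardT enumT.
  apply: int_sum => // j; first exact: measurable_indic.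
  by rewrite integral_indic// setIT; exact: hq.
rewrite probability_setC//.
have pF : P F \is a fin_num by exact: fin_num_measure.
by rewrite -(fineK pF) -EFinB !lee_fin; lra.
Qed.

End UnionBound.

(** * The estimator and its concentration *)

(** Without residual and regularisation the regression returns [th]; hence the
    error is the image of [F - r th] under an inverse that [invmx_perturb] bounds
    by twice that of [EV]. *)
Lemma regression_error {R : realType} p n (V EV : 'M[R]_p) (F th : 'M[R]_(p, n)) (c e f r : R) :
  EV \in unitmx -> `|invmx EV| <= c -> 0 <= r -> `|V - EV| <= e ->
  p%:R ^+ 2 * (e + r) * c <= 1 / 2 -> `|F| <= f ->
  `|invmx (V + r *: 1%:M) *m (F + V *m th) - th| <= p%:R * (2 * c) * (f + r * `|th|).
Proof.
move=> uE hE r0 hV small_e hF.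
have hM : `|V + r *: 1%:M - EV| <= e + r.
  rewrite addrAC (le_trans (ler_normD _ _))// lerD// normrZ ger0_norm//.
  by rewrite -[leRHS]mulr1 ler_wpM2l// mx_norm_1.
have [uM hMi] := invmx_perturb uE hE hM small_e.
have -> : invmx (V + r *: 1%:M) *m (F + V *m th) - th =
    invmx (V + r *: 1%:M) *m (F - r *: th).
  apply: (can_inj (mulKmx uM)); rewrite mulmxBr !mulKVmx//.
  by rewrite mulmxDl -scalemxAl mul1mx opprD addrA addrK.
apply: mx_norm_mulmx_le => //.
by rewrite (le_trans (ler_normB _ _))// lerD// normrZ ger0_norm.
Qed.

Section Estimator.
Context {R : realType} {n d m : nat}.
Variables (T : R) (N : nat) (theta : 'M[R]_(n + d, n)).
Variables (x : 'I_m -> R -> 'cV[R]_n) (z : 'I_m -> R -> 'cV[R]_(n + d)).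
Let u j t := col_mx (x j t) (z j t).

Definition mean_gram : 'M[R]_(n + d) :=
  \matrix_(a, b) (m%:R^-1 * \sum_(j < m) path_gram T N a b (u j)).

Definition mean_residual : 'M[R]_(n + d, n) :=
  \matrix_(a, b) (m%:R^-1 * \sum_(j < m) path_residual T theta N a b (u j)).

(** Regressing on the true parameter: the observations are its image under
    the empirical Gram matrix, up to the residuals. *)
Lemma theta_hat_split : theta_hat T N x z =
  invmx (mean_gram + m%:R^-1 *: 1%:M) *m (mean_residual + mean_gram *m theta).
Proof.
rewrite /theta_hat; congr (invmx (_ + _) *m _).
  apply/matrixP => a b; rewrite !mxE summxE; congr (_ * _); apply: eq_bigr => j _.
  rewrite summxE; apply: eq_bigr => i _; rewrite /u !col_mxKd mxeZ; congr (_ * _).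
  by rewrite mxE big_ord1 [X in _ * X]mxE.
apply/matrixP => a b; rewrite mxeZ summxE mxeD !mxE.
have -> : \sum_l mean_gram a l * theta l b =
    m%:R^-1 * \sum_(j < m) \sum_l path_gram T N a l (u j) * theta l b.
  rewrite exchange_big mulr_sumr; apply: eq_bigr => l _.
  by rewrite mxE -mulrA mulr_suml.
rewrite -mulrDr -big_split/=; congr (_ * _); apply: eq_bigr => j _.
rewrite summxE.
have -> : \sum_l path_gram T N a l (u j) * theta l b =
   \sum_(i < N) z j (i%:R * (T / N%:R)) a 0 *
     (T / N%:R * \sum_l theta l b * z j (i%:R * (T / N%:R)) l 0).
  under eq_bigr do rewrite mulr_suml.
  rewrite exchange_big; apply: eq_bigr => i _; rewrite !mulr_sumr.
  by apply: eq_bigr => l _; rewrite /u !col_mxKd; ring.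
rewrite -big_split/=; apply: eq_bigr => i _.
rewrite /u !col_mxKd !col_mxKu -mulrDr subrK.
by rewrite mxE big_ord1 [X in _ * X]mxE.
Qed.

End Estimator.

Section JointProcess.
Context {R : realType} {dOm : measure_display} {Om : measurableType dOm}.

Lemma joint_stochastic n d (D : set R) (K : R -> 'M[R]_(d, n)) (X : Om -> R -> 'cV[R]_n) :
  stochastic_process D X -> stochastic_process D (joint_process X (state_control K X)).
Proof.
move=> mX t Dt i; rewrite /joint_process /state_control; case: (split_ordP i) => i' ->.
  by under eq_fun do rewrite col_mxEu; exact: mX.
under eq_fun do rewrite col_mxEd; case: (split_ordP i') => l ->.
  by under eq_fun do rewrite col_mxEu; exact: mX.
under eq_fun do rewrite col_mxEd mxE.
by apply: measurable_sum => c; apply: measurable_funM => //; exact: mX.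
Qed.

End JointProcess.

(** Listing the entries of both empirical matrices in one finite type lets a
    single union bound control them together. *)
Section Entries.
Context {R : realType} {n d : nat}.
Variables (T : R) (N : nat) (theta : 'M[R]_(n + d, n)).

Definition entry : finType := (('I_(n + d) * 'I_(n + d)) + ('I_(n + d) * 'I_n))%type.

Definition entry_obs (e : entry) (u : R -> 'cV[R]_(n + (n + d))) : R :=
  match e with
  | inl ab => path_gram T N ab.1 ab.2 u
  | inr ab => path_residual T theta N ab.1 ab.2 u
  end.

Lemma observable_entry e : 0 < T -> (0 < N)%N -> observable `[0, T]%classic (entry_obs e).
Proof.
by case: e => ab T0 N0; [exact: observable_gram|exact: observable_residual].
Qed.

End Entries.

(** The Chernoff bound at level [kappa ell] with [kappa = 1 + 2 c], for [c] entries,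
    gives each of them the failure probability [2 delta exp (- 2 c ell)]. As
    [delta < 1 / 2] forces [ell > 1 / 2], the [c] events together have
    probability at most [2 delta]. *)
Lemma entries_concentrate {R : realType} {n d : nat} (T : R) (theta : 'M[R]_(n + d, n)) N m
  (dOm dOm' : measure_display) (Om : measurableType dOm) (Om' : measurableType dOm')
  (P : probability Om R) (P' : probability Om' R)
  (U : Om -> R -> 'cV[R]_(n + (n + d))) (Uc : 'I_m -> Om' -> R -> 'cV[R]_(n + (n + d)))
  (l M delta : R) (G : set Om') :
  0 < T -> (0 < N)%N -> (0 < m)%N -> 0 < l -> 0 <= M -> 0 < delta < 1 / 2 ->
  stochastic_process `[0, T] U ->
  independent_copies P P' `[0, T] U Uc ->
  (forall e, (\int[P]_w (expR (l * `|entry_obs T N theta e (U w)|))%:E <= M%:E)%E) ->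
  let s := Num.sqrt (- ln delta / m%:R) in s <= l / 2 ->
  measurable G ->
  (forall w, (forall e, `|m%:R^-1 * \sum_j entry_obs T N theta e (Uc j w) -
     (\int[P]_w entry_obs T N theta e (U w))%R| <=
     (16 * M / l ^+ 2 + (1 + 2 * #|@entry n d|%:R)) * s) -> G w) ->
  ((1 - 2 * delta)%:E <= P' G)%E.
Proof.
move=> T0 N0 m0 l0 M0 /andP[d0 d1] mU [mUc indep law] hexp s hs mG hG.
pose ell := - ln delta.
have dE : delta = expR (- ell) by rewrite /ell opprK lnK.
have ell1 : 1 / 2 < ell.
  rewrite -ltrN2 -ltr_expR -dE (lt_le_trans d1)//.
  by apply: le_trans (expR_ge1Dx _); lra.
have ell0 : 0 <= ell by lra.
have S_T := @gen_setT _ _ : path_sigma `[0, T] (p := n + (n + d)) setT.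
have S_I := @gen_setI _ _ : setI_closed (path_sigma `[0, T] (p := n + (n + d))).
have mS j C : path_sigma `[0, T] C -> measurable (Uc j @^-1` C).
  exact: path_sigma_preimage (mUc j).
have obs e : observable `[0, T]%classic (entry_obs T N theta e) by exact: observable_entry.
have mc e j : measurable_fun setT (fun w => entry_obs T N theta e (Uc j w)).
  by move=> _ B mB; rewrite setTI; exact: (mS j _ (obs e B mB)).
have mo e : measurable_fun setT (fun w => entry_obs T N theta e (U w)).
  by move=> _ B mB; rewrite setTI; exact: (path_sigma_preimage mU (obs e B mB)).
pose kap : R := 1 + 2 * #|@entry n d|%:R; pose C := 16 * M / l ^+ 2.
pose E e := [set w | ((C + kap) * s <= `|m%:R^-1 * \sum_j entry_obs T N theta e (Uc j w) -
     (\int[P]_w entry_obs T N theta e (U w))%R|)%R].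
have mE e : measurable (E e).
  have mf : measurable_fun setT (fun w => `|m%:R^-1 * \sum_j entry_obs T N theta e (Uc j w) -
     (\int[P]_w entry_obs T N theta e (U w))%R|).
    apply: measurableT_comp => //; apply: measurable_funB => //.
    by apply: measurable_funM => //; exact: measurable_sum.
  have := mf measurableT _ (measurable_itv `[(C + kap) * s, +oo[).
  rewrite setTI; congr measurable; apply/seteqP.
  by split=> w /=; rewrite in_itv/= andbT.
have hP e : (P' (E e) <= (2 * expR (- (kap * ell)))%R%:E)%E.
  have := @chernoff _ _ _ P' _ _ _ Uc indep S_T S_I mS (entry_obs T N theta e)
    (\int[P]_w entry_obs T N theta e (U w))%R C (l / 2) kap ell (obs e).
  rewrite card_ord; apply=> // l' j hl'.
  rewrite (eq_law_integral (P := P) (Y := fun w => entry_obs T N theta e (U w))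
    (g := fun y => (expR (l' * y))%:E))//.
  - exact: mgf_bound.
  - by move=> B mB; have := law j _ (obs e B mB).
  - by apply/measurable_EFinP; apply: measurableT_comp => //; exact: measurable_funM.
have := union_bound mE mG _ hP.
move=> h; apply: le_trans (h _); last first.
  move=> w hw; apply: hG => e; apply: ltW; rewrite ltNge; apply/negP; exact: hw.
rewrite lee_fin lerB//.
have -> : - (kap * ell) = - ell + - (2 * #|@entry n d|%:R * ell) by rewrite /kap; ring.
rewrite expRD -dE; set c := #|@entry n d|%:R.
have c0 : 0 <= c :> R by [].
have hc : c * expR (- (2 * c * ell)) <= 1.
  rewrite expRN ler_pdivrMr ?expR_gt0// mul1r; apply: le_trans (expR_ge1Dx _); nra.
have := ler_wpM2l (ltW d0) hc; lra.
Qed.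

(** * The error bound *)

Theorem proposition3p14 (R : realType) (n d : nat) (hn : (0 < n)%N)
    (hd : (0 < d)%N) (T : R) (hT : 0 < T) (x0 : 'cV[R]_n)
    (Astar : 'M[R]_n) (Bstar : 'M[R]_(n, d))
    (Q : 'M[R]_n) (hQ : sym_psd Q) (Rc : 'M[R]_d) (hRc : sym_pd Rc)
    (* the driving Brownian motion *)
    (dOm : measure_display) (Om : measurableType dOm) (P : probability Om R)
    (W : Om -> R -> 'cV[R]_n) (hW : brownian_motion P W)
    (Theta : set 'M[R]_(n + d, n))
    (* the solution of the Riccati equation for each parameter *)
    (Pric : 'M[R]_(n + d, n) -> R -> 'M[R]_n)
    (hPric : forall theta, Theta theta ->
       riccati_solution T Q Rc theta (Pric theta))
    (* the state process driven by each of the feedback gains considered *)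
    (X : (R -> 'M[R]_(d, n)) -> Om -> R -> 'cV[R]_n)
    (hXct : forall theta, Theta theta ->
       let K := gain_ct Rc theta (Pric theta) in
       sde_solution P T Astar Bstar x0 W K (X K))
    (hXpw : forall theta (N : nat), Theta theta -> (0 < N)%N ->
       let K := gain_pw T Q Rc theta N in
       sde_solution P T Astar Bstar x0 W K (X K))
    (hTheta : exists2 C1 : R, 0 < C1 & forall theta, Theta theta ->
       let K := gain_ct Rc theta (Pric theta) in
       let EV := expected_V P T (state_control K (X K)) in
       [/\ EV \in unitmx, spectral_norm (invmx EV) <= C1
         & frobenius_norm theta <= C1]) :
  exists (C1bar C2bar : R) (n0 : nat),
    [/\ 0 <= C1bar, 0 <= C2bar, (0 < n0)%N &
    forall theta (N : nat) (delta : R), Theta theta -> (n0 <= N)%N ->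
      0 < delta < 1 / 2 ->
    forall m : nat, (0 < m)%N -> C1bar * - ln delta <= m%:R ->
    forall (dOm' : measure_display) (Om' : measurableType dOm')
      (P' : probability Om' R)
      (Xc : 'I_m -> Om' -> R -> 'cV[R]_n)
      (Zc : 'I_m -> Om' -> R -> 'cV[R]_(n + d)),
      (let K := gain_pw T Q Rc theta N in
       independent_copies P P' `[0, T]
         (joint_process (X K) (state_control K (X K)))
         (fun j => joint_process (Xc j) (Zc j))) ->
      ((1 - 2 * delta)%:E <=
        P' [set w | (frobenius_norm
              (theta_hat T N (fun j => Xc j w) (fun j => Zc j w)
               - theta_of Astar Bstar) <=
            C2bar * (Num.sqrt (- ln delta / m%:R) + - ln delta / m%:R
                     + (- ln delta) ^+ 2 / m%:R ^+ 2 + N%:R^-1))%R])%E].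
Proof.
have [C1 C10 hC1] := hTheta.
have [k k0 hgain] := gains_grid hT hQ hRc C1.
have [l [M [C [l0 M0 C0 hmom]]]] := model_moments hn hT Astar Bstar x0 k0 hW.
pose p : R := (n + d)%:R; pose th := `|theta_of Astar Bstar|.
have p0 : 0 <= p by [].
have th0 : 0 <= th by exact: normr_ge0.
pose L := p ^+ 2 * C1; have L0 : 0 <= L by rewrite mulr_ge0 ?sqr_ge0 ?ltW.
pose q := 16 * M / l ^+ 2 + (1 + 2 * #|@entry n d|%:R).
have q0 : 0 <= q by rewrite /q; nonneg.
(* [D1] and [D2] share the allowance of [1 / 2] in [regression_error] between the
   statistical error, with the regularisation, and the discretisation error. *)
pose D1 := 4 * L * (q + 2) + 1; pose D2 := 4 * L * C + 1.
have D10 : 0 < D1 by rewrite /D1 ltr_wpDl//; nonneg.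
have D20 : 0 < D2 by rewrite /D2 ltr_wpDl//; nonneg.
pose s0 := Num.min (Num.min 1 (l / 2)) D1^-1.
have s00 : 0 < s0 by rewrite /s0 !lt_min ltr01 divr_gt0// invr_gt0.
have s01 : s0 <= 1 by rewrite /s0 !ge_min lexx.
have s0l : s0 <= l / 2 by rewrite /s0 !ge_min lexx orbT.
have s0D : s0 <= D1^-1 by rewrite /s0 !ge_min lexx orbT.
(* [m >= s0 ^- 2 * ell] says that [sqrt (ell / m) <= s0]. *)
exists (s0 ^- 2), ((((n + d) * n)%N)%:R * (p * (2 * C1) * (q + C + 2 * th))),
  (Num.truncn (T * D2 ^+ 2)).+1; split=> //.
- by rewrite invr_ge0 sqr_ge0.
- by nonneg.
move=> theta N delta hth hN hdelta m m0 hm dOm' Om' P' Xc Zc /= hcopies.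
have N0 : (0 < N)%N by exact: leq_trans hN.
have mR : 0 < m%:R :> R by rewrite ltr0n.
have NR : 0 < N%:R :> R by rewrite ltr0n.
have [uE hE hf] := hC1 theta hth.
have [hKct hKN] := hgain theta _ hf (hPric theta hth).
have [hKpw hKK] := hKN N N0.
set K := gain_pw T Q Rc theta N in hcopies hKpw hKK.
set K' := gain_ct Rc theta (Pric theta) in uE hE hKct hKK.
have hXK : sde_solution P T Astar Bstar x0 W K (X K) := hXpw theta N hth N0.
have hXK' : sde_solution P T Astar Bstar x0 W K' (X K') := hXct theta hth.
have hobs := hmom N K K' (X K) (X K') N0 hKpw hKct hXK hXK' hKK.
set EV := expected_V P T (state_control K' (X K')) in uE hE hobs.
pose U := joint_process (X K) (state_control K (X K)).
pose Uc j := joint_process (Xc j) (Zc j).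
pose ths := theta_of Astar Bstar.
have mU : stochastic_process `[0, T] U by apply: joint_stochastic; case: hXK.
have [mUc _ _] := hcopies.
have obs_exp e : (\int[P]_w (expR (l * `|entry_obs T N ths e (U w)|))%:E <= M%:E)%E.
  case: e => -[a b] /=; have [hr hg] := hobs a.
    have [h _] := hg b; apply: le_trans h; rewrite le_eqVlt; apply/orP; left; apply/eqP.
    by apply: eq_integral => w _; rewrite -path_gram_joint.
  have [h _] := hr b; apply: le_trans h; rewrite le_eqVlt; apply/orP; left; apply/eqP.
  by apply: eq_integral => w _; rewrite -path_residual_joint.
pose ell := - ln delta; have /andP[d0 d1] := hdelta.
have dE : delta = expR (- ell) by rewrite /ell opprK lnK.
(* Bounded below, [ell] lets [ell / m] absorb the regularisation [1 / m]. *)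
have ell1 : 1 / 2 < ell.
  rewrite -ltrN2 -ltr_expR -dE (lt_le_trans d1)//.
  by apply: le_trans (expR_ge1Dx _); lra.
pose s := Num.sqrt (ell / m%:R).
have s_ge0 : 0 <= s by exact: sqrtr_ge0.
have elm0 : 0 <= ell / m%:R by rewrite divr_ge0//; lra.
have s2 : s ^+ 2 = ell / m%:R by rewrite /s sqr_sqrtr.
have hs0 : s <= s0.
  rewrite -(ger0_norm (ltW s00)) -sqrtr_sqr ler_wsqrtr// ler_pdivrMr// -ler_pdivrMl ?exprn_gt0//.
have minv : m%:R^-1 <= 2 * (ell / m%:R).
  by rewrite mulrA ler_pdivlMr// mulVf ?lt0r_neq0//; lra.
pose r := Num.sqrt (T / N%:R).
have r_ge0 : 0 <= r by exact: sqrtr_ge0.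
have hr0 : r <= D2^-1.
  have Di : 0 <= D2^-1 by rewrite invr_ge0 ltW.
  rewrite -(ger0_norm Di) -sqrtr_sqr ler_wsqrtr// exprVn ler_pdivrMr// mulrC ler_pdivlMr ?exprn_gt0//.
  have T2 : 0 <= T * D2 ^+ 2 by rewrite mulr_ge0 ?sqr_ge0// ltW.
  have /andP[_ h] := truncn_itv T2; apply: (le_trans (ltW h)).
  by rewrite ler_nat.
pose F := [set w | (frobenius_norm (theta_hat T N (fun j => Xc j w) (fun j => Zc j w) - ths) <=
   (((n + d) * n)%N)%:R * (p * (2 * C1) * (q + C + 2 * th)) *
     (Num.sqrt (- ln delta / m%:R) + - ln delta / m%:R
                     + (- ln delta) ^+ 2 / m%:R ^+ 2 + N%:R^-1))%R].
have Uobs j e : measurable_fun setT (fun w => entry_obs T N ths e (Uc j w)).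
  move=> _ B mB; rewrite setTI.
  have h := observable_entry ths e hT N0 mB.
  exact: (path_sigma_preimage (mUc j) h).
have mF : measurable F.
  apply: measurable_frobenius_le.
  have mV : measurable_mx (fun w => mean_gram T N (fun j => Xc j w) (fun j => Zc j w)).
    move=> a b; under eq_fun do rewrite mxE.
    by apply: measurable_funM => //; apply: measurable_sum => j; exact: (Uobs j (inl (a, b))).
  have mRes : measurable_mx (fun w => mean_residual T N ths (fun j => Xc j w) (fun j => Zc j w)).
    move=> a b; under eq_fun do rewrite mxE.
    by apply: measurable_funM => //; apply: measurable_sum => j; exact: (Uobs j (inr (a, b))).
  have mI : measurable_mx (fun w => mean_gram T N (fun j => Xc j w) (fun j => Zc j w) +
      m%:R^-1 *: 1%:M).
    by move=> a b; under eq_fun do rewrite mxeD; exact: measurable_funD.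
  have mth : measurable_mx (fun _ : Om' => ths) by move=> a b; exact: measurable_cst.
  have mVth := measurable_mulmx mV mth.
  have mS : measurable_mx (fun w => mean_residual T N ths (fun j => Xc j w) (fun j => Zc j w) +
      mean_gram T N (fun j => Xc j w) (fun j => Zc j w) *m ths).
    by move=> a b; under eq_fun do rewrite mxeD; exact: measurable_funD.
  move=> a b; under eq_fun do rewrite (theta_hat_split T N ths) mxeD mxeN.
  by apply: measurable_funB => //; exact: (measurable_mulmx (measurable_invmx mI) mS).
apply: (entries_concentrate (T := T) (N := N) (P := P) (delta := delta) (theta := ths) (U := U) (Uc := Uc) (l := l) (M := M)) => //.
  exact: le_trans hs0 s0l.
move=> w hw; rewrite /F /=.
apply: (le_trans (frobenius_mx_norm _)); rewrite -mulrA ler_wpM2l//.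
rewrite (theta_hat_split T N ths).
set V := mean_gram _ _ _ _; set Re := mean_residual _ _ _ _ _.
have eN : 0 <= N%:R^-1 :> R by rewrite invr_ge0.
have hV : `|V - EV| <= q * s + C * r.
  apply: ler_mx_normP => [|a b]; first by nonneg.
  have [_ hg] := hobs a; have [_ hgb] := hg b.
  rewrite mxeD mxeN mxE; apply: (le_trans (ler_distD _ _ _)); apply: lerD; last exact: hgb.
  have := hw (inl (a, b)); rewrite /= -/ell -/s -/q.
  rewrite [(\int[P]_w0 _)%R](_ : _ = (\int[P]_w gram_sum T N K (X K w) a b)%R)//.
  by apply: eq_Rintegral => w' _; rewrite -path_gram_joint.
have hRe : `|Re| <= q * s + C / N%:R.
  apply: ler_mx_normP => [|a b]; first by nonneg.
  have [hr _] := hobs a; have [_ hrb] := hr b.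
  rewrite mxE -[X in `|X|](subrK (\int[P]_w residual_sum T Astar Bstar N K (X K w) a b)%R).
  apply: (le_trans (ler_normD _ _)); apply: lerD => //.
  have := hw (inr (a, b)); rewrite /= -/ell -/s -/q.
  rewrite [(\int[P]_w0 _)%R](_ : _ =
    (\int[P]_w residual_sum T Astar Bstar N K (X K w) a b)%R)//.
  by apply: eq_Rintegral => w' _; rewrite -path_residual_joint.
have hEn : `|invmx EV| <= C1 by exact: le_trans (mx_norm_spectral _) hE.
have mi0 : 0 <= m%:R^-1 :> R by rewrite invr_ge0.
have s1 : s <= 1 by exact: le_trans hs0 s01.
have hsm : p ^+ 2 * (q * s + C * r + m%:R^-1) * C1 <= 1 / 2.
  have h1 : m%:R^-1 <= 2 * s.
    by apply: (le_trans minv); rewrite -s2; nra.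
  have h2 : s * D1 <= 1 by rewrite -ler_pdivlMr// div1r (le_trans hs0).
  have h3 : r * D2 <= 1 by rewrite -ler_pdivlMr// div1r.
  have h4 : L * (q * s + C * r + m%:R^-1) <= L * (q * s + C * r + 2 * s).
    by rewrite ler_wpM2l// lerD2l.
  have -> : p ^+ 2 * (q * s + C * r + m%:R^-1) * C1 = L * (q * s + C * r + m%:R^-1).
    by rewrite /L; ring.
  apply: (le_trans h4); rewrite /D1 in h2; rewrite /D2 in h3; lra.
have hreg := regression_error ths uE hEn mi0 hV hsm hRe.
apply: (le_trans hreg); rewrite -/p -[leRHS]mulrA.
have C1' : 0 <= p * (2 * C1) by nonneg.
rewrite ler_wpM2l// -/th -/ell -/s.
have e2 : 0 <= ell ^+ 2 / m%:R ^+ 2 by rewrite divr_ge0 ?sqr_ge0.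
set x := ell / m%:R in minv elm0 *; set y := ell ^+ 2 / _ in e2 *; set z := N%:R^-1 in eN *.
have g1 := ler_wpM2r th0 minv.
have g2 : 0 <= (q + C + 2 * th) * y by nonneg.
have g3 : 0 <= (C + 2 * th) * s by nonneg.
have g4 : 0 <= (q + C) * x by nonneg.
have g5 : 0 <= (q + 2 * th) * z by nonneg.
rewrite -/th in g1 *; lra.
Qed.
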